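(* If ${\rm UP}={\rm coUP}$, then ${\rm CLU\#P}={\rm CLU\#P_{free}}={\rm CLU\#P_{circular}}$.
   Context: Alphabet $\Sigma=\{0,1\}$; NPTM = nondeterministic polynomial-time Turing machine. ${\rm UP}$: languages accepted by NPTMs with at most one accepting path on every input; ${\rm coUP}$: their complements. For a polynomial $p$, an NPTM $M$ is $p$-balanced if on every input $x$ its computation paths correspond exactly to the guess strings in $\{0,1\}^{p(|x|)}$; paths are identified with guess strings. $\mathrm{acc}_M(x)$ is the set of accepting paths, $\#\mathrm{acc}_M(x)$ its size. ${\rm FP}_{\rm t}$: total polynomial-time computable functions. For same-length strings, $a\prec_{\rm lex}b$ means $b$ is the immediate lexicographic successor of $a$; $\le_{\rm lex}$ is lexicographic order. ${\rm CLU\#P}$: total $f:\Sigma^*\to\mathbb{N}$ such that there exist a polynomial $p$, a $p$-balanced NPTM $M$, $b,t\in{\rm FP}_{\rm t}$ and a polynomial-time 3-argument predicate $\prec$ such that for every $x$ there is a bijection $h_x$ of $\Sigma^{p(|x|)}$ with: $|b(x)|=|t(x)|=p(|x|)$; $h_x(b(x))=0^{p(|x|)}$, $h_x(t(x))=1^{p(|x|)}$; (adjacency) for $y,z\in\{0,1\}^{p(|x|)}$, $\prec(x,y,z)$ iff $h_x(y)\prec_{\rm lex}h_x(z)$; (cluster) if $f(x)\neq0$ there exist $\ell,u$ with $\mathrm{acc}_M(x)=\{w\in\{0,1\}^{p(|x|)}: h_x(\ell)\le_{\rm lex}h_x(w)\le_{\rm lex}h_x(u)\}$; $f(x)=\#\mathrm{acc}_M(x)$.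 ${\rm CLU\#P_{free}}$: defined like ${\rm CLU\#P}$ but with no functions $b,t$ and no conditions on them (only a polynomial $p$, $p$-balanced NPTM $M$, polynomial-time $\prec$, and bijections $h_x$ satisfying the adjacency, cluster, and counting conditions). ${\rm CLU\#P_{circular}}$: defined like ${\rm CLU\#P_{free}}$ except that the adjacency condition is: $\prec(x,y,z)$ iff $h_x(y)\prec_{\rm lex}h_x(z)$ or ($h_x(y)=1^{p(|x|)}$ and $h_x(z)=0^{p(|x|)}$). *)

(* Defs.v *)
From HB Require Import structures.
From mathcomp Require Import all_boot all_order all_algebra.
From mathcomp Require Import mathcomp_extra boolp classical_sets functions cardinality.
Set Implicit Arguments.
Unset Strict Implicit.
Unset Printing Implicit Defensive.

Local Open Scope classical_set_scope.
Local Open Scope card_scope.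

Definition string := seq bool.

Definition strings (n : nat) : set string := [set y | size y = n].

(* A tape cell is blank ([None]), a bit, or a symbol of the machine's own
   auxiliary alphabet [G]. *)
Definition symbol (G : finType) : finType := option (bool + G).

(* Two-way infinite tape [(l, r)]: the scanned cell is the head of [r], followed
   by the cells to its right; [l] lists the cells to its left, nearest first.
   All cells beyond the two lists are blank. *)
Definition tape (G : finType) : Type := (seq (symbol G) * seq (symbol G))%type.

Variant dir := GoLeft | Stay | GoRight.

Definition read G (t : tape G) : symbol G := head None t.2.

Definition write_move G (a : symbol G * dir) (t : tape G) : tape G :=
  let: (s, d) := a in
  match d with
  | GoLeft => (behead t.1, head None t.1 :: s :: behead t.2)
  | Stay => (t.1, s :: behead t.2)
  | GoRight => (s :: t.1, behead t.2)
  end.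

Definition action (k : nat) (G Q : finType) : Type :=
  (Q * {ffun 'I_k -> symbol G * dir})%type.

(* An entry of the transition table: halt (accepting or rejecting), make a
   deterministic step, or guess one bit and make the step it selects. *)
Variant instr (k : nat) (G Q : finType) :=
  | Halt of bool
  | Step of action k G Q
  | Guess of (bool -> action k G Q).
Arguments Halt {k G Q} _.

(* [work] is the number of tapes besides tape 0. *)
Record machine := Machine {
  work : nat;
  aux : finType;
  state : finType;
  start : state;
  delta : state -> {ffun 'I_work.+1 -> symbol aux} -> instr work.+1 aux state }.

Definition config (M : machine) : Type :=
  (state M * {ffun 'I_(work M).+1 -> tape (aux M)})%type.

Definition instr_at M (c : config M) : instr (work M).+1 (aux M) (state M) :=
  delta c.1 [ffun i => read (c.2 i)].

Definition apply_action M (a : action (work M).+1 (aux M) (state M))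
    (c : config M) : config M :=
  (a.1, [ffun i => write_move (a.2 i) (c.2 i)]).

(* The [i]-th argument is written on tape [i], with the head on its first bit. *)
Definition init M (xs : seq string) : config M :=
  (start M, [ffun i : 'I_(work M).+1 =>
    ([::], [seq Some (inl b) | b <- nth [::] xs i])]).

(* [reach c w n d]: some computation leads from [c] to [d] in [n] steps, with [w]
   the sequence of bits guessed on the way. *)
Inductive reach M : config M -> string -> nat -> config M -> Prop :=
  | reach_nil c : reach c [::] 0 c
  | reach_step c a w n d : instr_at c = Step a ->
      reach (apply_action a c) w n d -> reach c w n.+1 d
  | reach_guess c g b w n d : instr_at c = Guess g ->
      reach (apply_action (g b) c) w n d -> reach c (b :: w) n.+1 d.

(* [M] has, on arguments [xs], a complete computation path with guess string [w]
   and final configuration [d]. *)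
Definition path_to M (xs : seq string) (w : string) (d : config M) : Prop :=
  (exists n, reach (init M xs) w n d) /\ exists v, instr_at d = Halt v.

Definition accepts_along M (xs : seq string) (w : string) : Prop :=
  exists2 d : config M, path_to xs w d & instr_at d = Halt true.

(* As a non-halting configuration always has a successor, bounding the length of
   all partial computations also forces every computation to halt. *)
Definition polytime (arity : nat) (M : machine) : Prop :=
  exists q : {poly nat}, forall xs : seq string, size xs = arity ->
    forall w n (d : config M), reach (init M xs) w n d ->
      n <= (q.[sumn [seq size x | x <- xs]])%R.

Definition deterministic (M : machine) : Prop :=
  forall (s : state M) r, if delta s r is Guess _ then False else True.

(* The output is the string of bits on tape 0 that starts under the head and
   extends up to the first cell not holding a bit. *)
Fixpoint leading_bits (G : finType) (r : seq (symbol G)) : string :=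
  if r is Some (inl b) :: r' then b :: leading_bits r' else [::].

Definition output M (d : config M) : string := leading_bits (d.2 ord0).2.

Definition NPTM (M : machine) : Prop := polytime 1 M.

Definition FPt : set (string -> string) :=
  [set f | exists M, [/\ deterministic M, polytime 1 M &
    forall x, exists2 d : config M, path_to [:: x] [::] d & output d = f x]].

Definition polytime_pred3 (P : string -> string -> string -> bool) : Prop :=
  exists M, [/\ deterministic M, polytime 3 M &
    forall x y z, P x y z <-> accepts_along M [:: x; y; z] [::]].

Definition acc M (x : string) : set string := [set w | accepts_along M [:: x] w].

Definition UP : set (set string) :=
  [set L | exists M, [/\ NPTM M,
    forall x w1 w2, acc M x w1 -> acc M x w2 -> w1 = w2 &
    forall x, L x <-> exists w, acc M x w]].

Definition coUP : set (set string) := [set ~` L | L in UP].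

(* A computation path is determined by its guess string, so this identifies the
   paths of [M] on [x] with the strings of length [p(|x|)]. *)
Definition balanced (p : {poly nat}) (M : machine) : Prop :=
  forall x w, (exists d : config M, path_to [:: x] w d) <->
              strings (p.[size x])%R w.

Definition lex_le (a b : string) : bool := ((a : seqlexi bool) <= b)%O.

Definition lex_lt (a b : string) : bool := ((a : seqlexi bool) < b)%O.

Definition lex_succ (a b : string) : Prop :=
  [/\ size a = size b, lex_lt a b &
      forall c, size c = size a -> ~ (lex_lt a c /\ lex_lt c b)].

Definition circ_succ (n : nat) (a b : string) : Prop :=
  lex_succ a b \/
  (a = nseq n true /\ b = nseq n false).

(* The conditions on the bijection [h = h_x], with [n = p(|x|)], for adjacency
   taken with respect to [adj]. *)
Definition cluster_order (adj : string -> string -> Prop) (n : nat)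
    (M : machine) (prec : string -> string -> string -> bool)
    (f : string -> nat) (x : string) (h : string -> string) : Prop :=
  [/\ set_bij (strings n) (strings n) h,
      forall y z, strings n y -> strings n z ->
        (prec x y z <-> adj (h y) (h z)),
      f x <> 0 -> exists l u, [/\ strings n l, strings n u &
        acc M x = [set w | [/\ strings n w, lex_le (h l) (h w) &
                               lex_le (h w) (h u)]]] &
      acc M x #= `I_(f x)].

Definition CLUsharpP : set (string -> nat) :=
  [set f | exists (p : {poly nat}) M b t prec,
    [/\ NPTM M /\ balanced p M, FPt b, FPt t, polytime_pred3 prec &
      forall x, let n := (p.[size x])%R in
        exists h, [/\ cluster_order lex_succ n M prec f x h,
          strings n (b x), strings n (t x),
          h (b x) = nseq n false & h (t x) = nseq n true]]].

Definition CLUsharpP_free : set (string -> nat) :=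
  [set f | exists (p : {poly nat}) M prec,
    [/\ NPTM M, balanced p M, polytime_pred3 prec &
      forall x, let n := (p.[size x])%R in
        exists h, cluster_order lex_succ n M prec f x h]].

Definition CLUsharpP_circular : set (string -> nat) :=
  [set f | exists (p : {poly nat}) M prec,
    [/\ NPTM M, balanced p M, polytime_pred3 prec &
      forall x, let n := (p.[size x])%R in
        exists h, cluster_order (circ_succ n) n M prec f x h]].

(* Main.v *)
(* With UP = coUP, the first and the last accepting path [y] of a machine have
   unique polynomial-size certificates: "[y] has no accepting predecessor" is the
   complement of a UP statement.  So a new order can be built in which everything
   is checkable: list all strings in the order of binary counting, which has known
   endpoints, take the codes of the accepting paths out of it, and splice them back
   in, in their own order, right after the one string that encodes the first path,
   the last path and their certificates.  Only the order of the accepting paths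
   among themselves matters.  For a circular order they form a linear chain unless
   all paths accept; whether they do is again certified uniquely under UP = coUP,
   and in that case the circle is cut at the string of zeros. *)

Require Import Defs.
From mathcomp Require Import all_boot all_order all_algebra classical_sets.
From mathcomp Require Import boolp functions cardinality zify.
Set Implicit Arguments.
Unset Strict Implicit.
Unset Printing Implicit Defensive.

(** An adjacency predicate sees only [x] and two strings and cannot guess. A certificate that the
    chain starts or ends at some path must therefore be readable off one of the two strings
    compared, and this is why the certificates are made part of a position in the new order.
    Uniqueness is needed twice: two strings with valid certificates would give the chain two places,
    and in the circular case, where a certificate is attached to every path, a second one would
    double the count. A further obstacle is length: certificates vary in length, while all paths of
    a balanced machine on an input have the same one, so everything is padded in a canonical way. In
    the new order each [s] occurs as [0s] and then [1s] before the count passes to [s+1]. Only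
    strings [0u] are ever taken out, so [1u] stays behind and a neighbour is found by one increment
    and a few tests; no run of removed strings has to be skipped. Since the classes refer to
    concrete Turing machines, polynomial-time claims rest on a small language of program fragments
    working on stacks. *)

Definition pbound (B : nat -> nat) : Prop :=
  exists q : {poly nat}, forall n, B n <= q.[n]%R.

Lemma pbound_poly (q : {poly nat}) : pbound (fun n => q.[n]%R).
Proof. by exists q. Qed.

Lemma pbound_const c : pbound (fun=> c).
Proof. by exists (polyC c) => n; rewrite hornerC. Qed.

Lemma pbound_id : pbound id.
Proof. by exists 'X%R => n; rewrite hornerX. Qed.

Lemma pbound_add B C : pbound B -> pbound C -> pbound (fun n => B n + C n).
Proof.
move=> [q hq] [r hr]; exists (q + r)%R => n; rewrite hornerD.
by apply: leq_add; [apply: hq | apply: hr].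
Qed.

Lemma pbound_mul B C : pbound B -> pbound C -> pbound (fun n => B n * C n).
Proof.
move=> [q hq] [r hr]; exists (q * r)%R => n; rewrite hornerM.
by apply: leq_mul; [apply: hq | apply: hr].
Qed.

Lemma leq_horner (q : {poly nat}) m n : m <= n -> q.[m]%R <= q.[n]%R.
Proof.
move=> le_mn; rewrite !horner_coef.
elim/big_ind2: _ => // [x1 x2 y1 y2 h1 h2|i _]; first exact: leq_add.
apply: leq_mul => //; elim: (i : nat) => // k IHk.
by rewrite !GRing.exprS; apply: leq_mul.
Qed.

Lemma pbound_comp B C : pbound B -> pbound C -> pbound (fun n => B (C n)).
Proof.
move=> [q hq] [r hr]; exists (q \Po r)%R => n; rewrite horner_comp.
exact: leq_trans (hq _) (leq_horner _ (hr n)).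
Qed.

(** A function under a polynomial may itself fail to be monotone, while running times have to be
    evaluated at estimated input sizes. The dominating polynomial has natural coefficients and is
    monotone. *)
Lemma pbound_mono B : pbound B ->
  exists B', [/\ pbound B', (forall n, B n <= B' n) &
                 forall m n, m <= n -> B' m <= B' n].
Proof.
by case=> q hq; exists (fun n => q.[n]%R); split=> //; [exists q | exact: leq_horner].
Qed.

(** * Tapes as pairs of streams *)

Section Streams.
Variable T : Type.

Definition stream : Type := nat -> option T.
Definition blank : stream := fun=> None.
Definition scons (s : option T) (f : stream) : stream :=
  fun n => if n is n'.+1 then f n' else s.
Definition stail (f : stream) : stream := fun n => f n.+1.
Fixpoint sapp (u : seq (option T)) (f : stream) : stream :=
  if u is s :: u' then scons s (sapp u' f) else f.

Lemma stail_scons s f : stail (scons s f) = f. Proof. by []. Qed.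

Lemma scons_stail f : scons (f 0) (stail f) = f.
Proof. by apply/funext => -[]. Qed.

Lemma scons_blank : scons None blank = blank.
Proof. by apply/funext => -[]. Qed.

Lemma nth_nil_blank : nth None [::] = blank.
Proof. by apply/funext => n; rewrite nth_nil. Qed.

Lemma nth_cons_scons s u : nth None (s :: u) = scons s (nth None u).
Proof. by apply/funext => -[]. Qed.

Lemma nth_behead_stail (u : seq (option T)) :
  nth None (behead u) = stail (nth None u).
Proof. by case: u => [|s u]; apply/funext => n //=; rewrite /stail !nth_nil. Qed.

Lemma sapp_blank u : sapp u blank = nth None u.
Proof.
by elim: u => [|s u /= ->]; rewrite ?nth_nil_blank // nth_cons_scons.
Qed.

End Streams.

Section Tapes.
Variable G : finType.
Implicit Types (s : symbol G) (l r f : stream (bool + G)%type) (u v w : string).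

(* Representing a tape by the streams of its cells to the left of the head and
   from the head on makes tapes that differ only by trailing blanks equal. *)
Definition stape : Type := (stream (bool + G) * stream (bool + G))%type.

Definition bit (b : bool) : symbol G := Some (inl b).
Definition is_bit s : bool := if s is Some (inl _) then true else false.
Definition str u f : stream (bool + G) := sapp (map bit u) f.

(* A stack of bits: the top is under the head, everything else is blank. *)
Definition stk u : stape := (@blank _, str u (@blank _)).

Definition smove (a : symbol G * dir) (t : stape) : stape :=
  let: (s, d) := a in
  match d with
  | GoLeft => (stail t.1, scons (t.1 0) (scons s (stail t.2)))
  | Stay => (t.1, scons s (stail t.2))
  | GoRight => (scons s t.1, stail t.2)
  end.

Definition tape_streams (t : tape G) : stape := (nth None t.1, nth None t.2).

Lemma tape_streams_move a t :
  tape_streams (write_move a t) = smove a (tape_streams t).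
Proof.
have nth0h (u : seq (symbol G)) : head None u = nth None u 0 by case: u.
case: a t => s [] [l r]; rewrite /tape_streams /=;
  by rewrite ?nth_cons_scons ?nth_behead_stail ?nth0h.
Qed.

Lemma tape_streams_read t : read t = (tape_streams t).2 0.
Proof. by case: t => l []. Qed.

Lemma str_cat u v f : str (u ++ v) f = str u (str v f).
Proof. by elim: u => //= b u; rewrite /str /= => ->. Qed.

Lemma leading_bits_str (r : seq (symbol G)) u f :
  nth None r = str u f -> ~~ is_bit (f 0) -> leading_bits r = u.
Proof.
elim: u r => [|b u IHu] r /=.
  by case: r => [|[[b|g]|] r] //=; rewrite /str /= => <-.
case: r => [|s r]; first by move/(congr1 (fun h => h 0)).
rewrite nth_cons_scons /str /= => eq_r nb; have /= -> := congr1 (fun h => h 0) eq_r.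
by rewrite (IHu r) //; have := congr1 (@stail _) eq_r; rewrite !stail_scons.
Qed.

Lemma str_leading_bits (r : seq (symbol G)) :
  exists2 f, nth None r = str (leading_bits r) f & ~~ is_bit (f 0).
Proof.
elim: r => [|s r [f eq_f nb]]; first by exists (@blank _); rewrite // nth_nil_blank.
case: s => [[b|g]|] /=; first by exists f; rewrite // nth_cons_scons eq_f.
  by exists (nth None (Some (inr g) :: r)).
by exists (nth None (None :: r)).
Qed.

End Tapes.

Arguments bit {G} b.
Arguments stk {G} u.

(** * Program fragments *)

Section Fragments.
Variables (V G : finType).

Definition store := V -> stape G.
Definition actions := V -> symbol G * dir.

Definition upd (t : store) i a : store := fun j => if j == i then a else t j.
Definition look (t : store) : V -> symbol G := fun i => (t i).2 0.
Definition act (a : actions) (t : store) : store := fun i => smove (a i) (t i).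

Variant finstr (S : Type) :=
  | FStep of option S & actions
  | FGuess of (bool -> option S * actions).

(* A piece of finite control; moving to [None] leaves the fragment. *)
Record frag := Frag {
  fstate : finType;
  fstart : fstate;
  fdelta : fstate -> (V -> symbol G) -> finstr fstate }.

Inductive run (F : frag) : option (fstate F) -> store -> string -> nat -> store -> Prop :=
  | run_exit t : run None t [::] 0 t
  | run_step s t o a w n t' : fdelta s (look t) = FStep o a ->
      run o (act a t) w n t' -> run (Some s) t w n.+1 t'
  | run_guess s t g b w n t' : fdelta s (look t) = FGuess g ->
      run (g b).1 (act (g b).2 t) w n t' -> run (Some s) t (b :: w) n.+1 t'.

(** [B] is only an upper bound on the number of steps, so bounds of composed fragments are added up
    formally and simplified once at the end. *)
Definition ends (F : frag) t w B t' : Prop :=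
  exists2 n, n <= B & run (Some (fstart F)) t w n t'.

Definition deterministic_frag (F : frag) : Prop :=
  forall (s : fstate F) r, if fdelta s r is FGuess _ then False else True.

Lemma ends_le F t w B B' t' : ends F t w B t' -> B <= B' -> ends F t w B' t'.
Proof. by case=> n nB r le; exists n => //; apply: leq_trans le. Qed.

Definition lift_instr (S S' : Type) (h : option S -> option S') (i : finstr S) : finstr S' :=
  match i with
  | FStep o a => FStep (h o) a
  | FGuess g => FGuess (fun b => (h (g b).1, (g b).2))
  end.

(** [h] embeds the control of [F] into that of [F'] and sends the exit [None] to whatever comes next
    there, so a run of [F] is replayed and then prolonged from [h None]. Sequencing, branching and
    looping are instances: the exit leads to the second fragment, out of the whole fragment, or back
    to the loop test. *)
Lemma lift_run (F F' : frag) (h : option (fstate F) -> option (fstate F')) :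
  (forall s r, exists2 s', h (Some s) = Some s' &
     fdelta s' r = lift_instr h (fdelta s r)) ->
  forall o t w n t', run o t w n t' ->
  forall w' n' t'', run (h None) t' w' n' t'' ->
  run (h o) t (w ++ w') (n + n') t''.
Proof.
move=> sim o t w n t' R w' n' t'' R'; elim: R R' => //= {}o {}t.
  move=> o' a {}w {}n {}t' d _ IH /IH{}IH; have [s' -> ds'] := sim o (look t).
  by rewrite d in ds'; apply: run_step ds' IH.
move=> g b {}w {}n {}t' d _ IH /IH{}IH; have [s' -> ds'] := sim o (look t).
by rewrite d in ds'; apply: run_guess ds' IH.
Qed.

Definition nop (r : V -> symbol G) : actions := fun j => (r j, Stay).

Lemma act_nop t : act (nop (look t)) t = t.
Proof.
apply/funext => j; rewrite /act /nop /look /=.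
by case: (t j) => l r /=; rewrite scons_stail.
Qed.

Definition act1 i (f : (V -> symbol G) -> symbol G * dir) : frag :=
  @Frag unit tt (fun _ r => FStep None (fun j => if j == i then f r else nop r j)).

Lemma act1_ends i f t :
  ends (act1 i f) t [::] 1 (upd t i (smove (f (look t)) (t i))).
Proof.
exists 1 => //; apply: run_step => //=.
set t1 := act _ _; suff -> : upd t i (smove (f (look t)) (t i)) = t1 by apply: run_exit.
apply/funext => j; rewrite /t1 /act /upd; case: eqP => [->|] //= _.
by rewrite -[LHS](congr1 (fun h => h j) (act_nop t)).
Qed.

Definition seqf (F1 F2 : frag) : frag :=
  @Frag (fstate F1 + fstate F2)%type (inl (fstart F1))
    (fun s r => match s with
      | inl s => lift_instr (fun o => Some (if o is Some s' then inl s' else inr (fstart F2)))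
                            (fdelta s r)
      | inr s => lift_instr (omap inr) (fdelta s r)
      end).

Lemma seqf_ends F1 F2 t t1 t2 w1 w2 B1 B2 :
  ends F1 t w1 B1 t1 -> ends F2 t1 w2 B2 t2 ->
  ends (seqf F1 F2) t (w1 ++ w2) (B1 + B2) t2.
Proof.
move=> [n1 le1 R1] [n2 le2 R2]; exists (n1 + n2); first exact: leq_add.
pose h1 o : option (fstate (seqf F1 F2)) :=
  Some (if o is Some s' then inl s' else inr (fstart F2)).
apply: (@lift_run F1 (seqf F1 F2) h1 _ _ _ _ _ _ R1); first by move=> s r; exists (inl s).
rewrite -[w2]cats0 -[n2]addn0; pose h2 o : option (fstate (seqf F1 F2)) := omap inr o.
apply: (@lift_run F2 (seqf F1 F2) h2 _ _ _ _ _ _ R2); first by move=> s r; exists (inr s).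
exact: run_exit.
Qed.

Definition iff_ (b : (V -> symbol G) -> bool) (F1 F2 : frag) : frag :=
  @Frag (option (fstate F1 + fstate F2))%type None
    (fun s r => match s with
      | None => FStep (Some (Some (if b r then inl (fstart F1) else inr (fstart F2)))) (nop r)
      | Some (inl s) => lift_instr (omap (Some \o inl)) (fdelta s r)
      | Some (inr s) => lift_instr (omap (Some \o inr)) (fdelta s r)
      end).

Lemma iff_ends (b : (V -> symbol G) -> bool) F1 F2 t t' w B :
  (if b (look t) then ends F1 t w B t' else ends F2 t w B t') ->
  ends (iff_ b F1 F2) t w B.+1 t'.
Proof.
case e: (b (look t)) => -[n le R]; exists n.+1 => //; apply: run_step => //;
  rewrite e act_nop -[w]cats0 -[n]addn0.
- pose h o : option (fstate (iff_ b F1 F2)) := omap (Some \o inl) o.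
  apply: (@lift_run F1 (iff_ b F1 F2) h _ _ _ _ _ _ R); last exact: run_exit.
  by move=> s r; exists (Some (inl s)).
- pose h o : option (fstate (iff_ b F1 F2)) := omap (Some \o inr) o.
  apply: (@lift_run F2 (iff_ b F1 F2) h _ _ _ _ _ _ R); last exact: run_exit.
  by move=> s r; exists (Some (inr s)).
Qed.

(** The added state [None] performs the test. Under [lift_instr Some] the exit [None] of the body
    turns into [Some None], which is this very state. *)
Definition whilef (b : (V -> symbol G) -> bool) (F : frag) : frag :=
  @Frag (option (fstate F)) None
    (fun s r => match s with
      | None => FStep (if b r then Some (Some (fstart F)) else None) (nop r)
      | Some s => lift_instr Some (fdelta s r)
      end).

Lemma whilef_stop (b : (V -> symbol G) -> bool) F t : ~~ b (look t) -> ends (whilef b F) t [::] 1 t.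
Proof.
move=> nb; exists 1 => //; apply: run_step => //; rewrite (negbTE nb) act_nop.
exact: run_exit.
Qed.

Lemma whilef_step (b : (V -> symbol G) -> bool) F t t1 t2 w1 w2 B1 B2 : b (look t) ->
  ends F t w1 B1 t1 -> ends (whilef b F) t1 w2 B2 t2 ->
  ends (whilef b F) t (w1 ++ w2) (B1 + B2).+1 t2.
Proof.
move=> bt [n1 le1 R1] [n2 le2 R2]; exists (n1 + n2).+1; first by rewrite ltnS leq_add.
apply: run_step => //=; rewrite bt act_nop.
pose h o : option (fstate (whilef b F)) := Some o.
apply: (@lift_run F (whilef b F) h _ _ _ _ _ _ R1) => //.
by move=> s r; exists (Some s).
Qed.

Lemma deterministic_act1 i f : deterministic_frag (act1 i f).
Proof. by []. Qed.

Lemma deterministic_seqf F1 F2 :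
  deterministic_frag F1 -> deterministic_frag F2 -> deterministic_frag (seqf F1 F2).
Proof.
by move=> d1 d2 [s|s] r /=; [have := d1 s r | have := d2 s r]; case: fdelta.
Qed.

Lemma deterministic_iff b F1 F2 :
  deterministic_frag F1 -> deterministic_frag F2 -> deterministic_frag (iff_ b F1 F2).
Proof.
by move=> d1 d2 [[s|s]|] r //=; [have := d1 s r | have := d2 s r]; case: fdelta.
Qed.

Lemma deterministic_whilef b F :
  deterministic_frag F -> deterministic_frag (whilef b F).
Proof. by move=> d [s|] r //=; have := d s r; case: fdelta. Qed.

End Fragments.
(** * Machines from fragments *)

(** A computation is determined by its guesses, so two computations whose guess strings are
    compatible, one being a prefix of the other, retrace each other. The halting one cannot be
    overtaken. Time bounds, balancedness and uniqueness of final configurations all come from such a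
    comparison with one known halting run. *)
Lemma reach_prefix M (c : config M) w n d w' n' d' :
  reach c w n d -> (exists v, instr_at d = Halt v) -> reach c w' n' d' ->
  (exists u u', w ++ u = w' ++ u') -> n' <= n /\ exists u, w = w' ++ u.
Proof.
move=> R; elim: R w' n' d' => {c w n d} [c|c a w n d Hc _ IH|c g b w n d Hc _ IH] w' n' d' Hd R'.
- case: Hd => v Hv Hw; case: R' Hv Hw => {c w' n' d'} [c|c a w' n' d' E _|c g b w' n' d' E _];
    rewrite ?E // => _ _.
  by split=> //; exists [::].
- case: R' Hc IH => {c w' n' d'} [c|c a' w' n' d' E R1|c g b w' n' d' E R1];
    rewrite ?E // => Hc IH Hw; first by split=> //; exists w.
  case: Hc IH => <- IH; have [le [u ->]] := IH _ _ _ Hd R1 Hw.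
  by split=> //; exists u.
- case: R' Hc IH => {c w' n' d'} [c|c a' w' n' d' E R1|c g' b' w' n' d' E R1];
    rewrite ?E // => Hc IH Hw; first by split=> //; exists (b :: w).
  case: Hw => u [u' [eqb Hw]]; case: Hc IH => <- IH; subst b'.
  have [le [u1 ->]] := IH _ _ _ Hd R1 (ex_intro _ u (ex_intro _ u' Hw)).
  by split=> //; exists u1.
Qed.

Lemma reach_unique M (c : config M) w n d n' d' :
  reach c w n d -> (exists v, instr_at d = Halt v) ->
  reach c w n' d' -> (exists v, instr_at d' = Halt v) -> d = d'.
Proof.
move=> R; elim: R n' d' => {c w n d} [c|c a w n d Hc _ IH|c g b w n d Hc _ IH] n' d' Hd R' Hd'.
- case: Hd => v Hv; case: R' Hv {Hd'} => {c n' d'} [c|c a w n' d' E _|c g b w n' d' E _] //;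
    by rewrite E.
- case: R' Hc IH Hd' => {c w n' d'} [c|c a' w n' d' E R1|c g b w n' d' E R1];
    rewrite ?E // => Hc; first by move=> _ [v]; rewrite Hc.
  by case: Hc => <- IH Hd'; apply: IH Hd R1 Hd'.
- have [bw ebw] : exists bw, bw = b :: w by eexists.
  rewrite -ebw in R'; case: R' ebw Hc IH Hd' => {c n' d'} [c|c a' w' n' d' E R1|c g' b' w' n' d' E R1];
    rewrite ?E // => ebw Hc IH Hd'.
  by case: ebw R1 Hc IH => -> -> R1 [<-] IH; apply: IH Hd R1 Hd'.
Qed.

Section FragmentMachine.
Variables (X G : finType).
Local Notation V := ('I_3 + X)%type.

(** Three named tapes suffice since no machine built here has more than three arguments; [X] names
    the remaining ones. The index type has [(2 + #|X|).+1] elements, convertible to [3 + #|X|],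
    which is what lets [split] and [unsplit] apply. *)
Definition tape_of (v : V) : 'I_(2 + #|X|).+1 :=
  fintype.unsplit (match v with inl i => inl i | inr x => inr (enum_rank x) end) : 'I_(3 + #|X|).

Definition var_of (i : 'I_(2 + #|X|).+1) : V :=
  match fintype.split (i : 'I_(3 + #|X|)) with inl j => inl j | inr j => inr (enum_val j) end.

Lemma tape_ofK : cancel tape_of var_of.
Proof.
by case=> v; rewrite /var_of /tape_of unsplitK // enum_rankK.
Qed.

Definition frag_machine (F : frag V G) : machine :=
  @Machine (2 + #|X|) G (option (fstate F)) (Some (fstart F))
    (fun o r => match o with
      | None => Halt (r ord0 == bit true)
      | Some s => match fdelta s (fun v => r (tape_of v)) with
        | FStep o a => Step (o, [ffun i => a (var_of i)])
        | FGuess g => Guess (fun b => ((g b).1, [ffun i => (g b).2 (var_of i)]))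
        end
      end).

Definition config_store (F : frag V G) (c : config (frag_machine F)) : store V G :=
  fun v => tape_streams (c.2 (tape_of v)).

Definition input_store (xs : seq string) : store V G :=
  fun v => if v is inl i then stk (nth [::] xs i) else stk [::].

Lemma tape_streams_input (x : string) :
  tape_streams ([::], [seq Some (inl b) | b <- x]) = stk x :> stape G.
Proof. by rewrite /tape_streams /stk /str sapp_blank nth_nil_blank. Qed.

Lemma config_store_init F xs : size xs <= 3 ->
  config_store (init (frag_machine F) xs) = input_store xs.
Proof.
move=> sz; apply/funext => -[i|x]; rewrite /config_store /= ffunE /tape_of /=.
  by rewrite tape_streams_input.
by rewrite nth_default ?tape_streams_input //; apply: leq_trans sz (leq_addr _ _).
Qed.

Lemma run_reach F o t w n t' : @run V G F o t w n t' ->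
  forall c : config (frag_machine F), c.1 = o -> config_store c = t ->
  exists d, [/\ reach c w n d, d.1 = None & config_store d = t'].
Proof.
have look_store (c : config (frag_machine F)) :
    (fun v => [ffun i => read (c.2 i)] (tape_of v)) = look (config_store c).
  by apply/funext => v; rewrite ffunE tape_streams_read.
have store_act (c : config (frag_machine F)) (o' : option (fstate F)) (a : actions V G) :
    config_store (@apply_action (frag_machine F) (o', [ffun i => a (var_of i)]) c) = act a (config_store c).
  apply/funext => v; rewrite /config_store /apply_action /= !ffunE tape_streams_move.
  by rewrite tape_ofK.
elim=> {o t w n t'} [t|s t o a w n t' d _ IH|s t g b w n t' d _ IH] c cs ct.
- by exists c; split=> //; apply: reach_nil.
- have ic : instr_at c = Step (o, [ffun i => a (var_of i)]).
    by rewrite /instr_at /= cs look_store ct d.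
  have [//||e [R e1 e2]] := IH (@apply_action (frag_machine F) (o, [ffun i => a (var_of i)]) c).
    by rewrite store_act ct.
  by exists e; split=> //; apply: reach_step ic R.
- have ic : instr_at c = Guess (fun b => ((g b).1, [ffun i => (g b).2 (var_of i)])).
    by rewrite /instr_at /= cs look_store ct d.
  have [//||e [R e1 e2]] := IH (@apply_action (frag_machine F) ((g b).1, [ffun i => (g b).2 (var_of i)]) c).
    by rewrite store_act ct.
  by exists e; split=> //; apply: reach_guess ic _.
Qed.

Lemma ends_path F xs w B t' : size xs <= 3 -> ends F (input_store xs) w B t' ->
  exists n d, [/\ n <= B, reach (init (frag_machine F) xs) w n d,
    config_store d = t' & instr_at d = Halt ((t' (inl ord0)).2 0 == bit true)].
Proof.
move=> sz [n nB R].
have [|d [Rd d1 dt]] := run_reach R (c := init (frag_machine F) xs) erefl.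
  exact: config_store_init.
exists n, d; split=> //; rewrite /instr_at /= d1 -dt /config_store -tape_streams_read.
by rewrite ffunE; congr (Halt (read (d.2 _) == _)); apply/val_inj.
Qed.

Lemma deterministic_frag_machine F : deterministic_frag F -> deterministic (frag_machine F).
Proof.
by move=> detF [s|] r //=; have := detF s (fun v => r (tape_of v)); case: fdelta.
Qed.

Lemma polytime_frag_machine F k B : k <= 3 -> pbound B ->
  (forall xs, size xs = k ->
    exists t', ends F (input_store xs) [::] (B (sumn [seq size x | x <- xs])) t') ->
  polytime k (frag_machine F).
Proof.
move=> k3 [q hq] run_xs; exists q => xs szx w n d Rd.
have [t' E] := run_xs xs szx.
have [|n' [d' [le R' _ H']]] := ends_path _ E; first by rewrite szx.
have [] := reach_prefix R' (ex_intro _ _ H') Rd; first by exists w, [::]; rewrite cats0.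
by move=> nn _; apply: leq_trans nn (leq_trans le (hq _)).
Qed.

Lemma frag_FPt (F : frag V G) B f : deterministic_frag F -> pbound B ->
  (forall x, exists t' l r, [/\ ends F (input_store [:: x]) [::] (B (size x)) t',
     t' (inl ord0) = (l, str (f x) r) & ~~ is_bit (r 0)]) ->
  FPt f.
Proof.
move=> detF pB run_x; exists (frag_machine F); split.
- exact: deterministic_frag_machine.
- apply: (@polytime_frag_machine F 1 B) => // -[|x []] // _ /=.
  by have [t' [l [r [E _ _]]]] := run_x x; exists t'; rewrite addn0.
- move=> x; have [t' [l [r [E et nb]]]] := run_x x.
  have [//|n [d [_ R dt H]]] := ends_path _ E.
  exists d; first by split; [exists n | eexists; exact: H].
  apply: (leading_bits_str (f := r)) nb.
  move: et; rewrite -dt /config_store => /(congr1 snd) /= <-.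
  by congr (nth None (d.2 _).2); apply/val_inj.
Qed.

Lemma frag_pred3 (F : frag V G) B P : deterministic_frag F -> pbound B ->
  (forall x y z, exists2 t', ends F (input_store [:: x; y; z]) [::]
       (B (size x + (size y + size z))) t' & ((t' (inl ord0)).2 0 == bit true) = P x y z) ->
  polytime_pred3 P.
Proof.
move=> detF pB run_x; exists (frag_machine F); split.
- exact: deterministic_frag_machine.
- apply: (@polytime_frag_machine F 3 B) => // -[|x [|y [|z []]]] // _ /=.
  by have [t' E _] := run_x x y z; exists t'; rewrite addn0.
- move=> x y z; have [t' E <-] := run_x x y z.
  have [//|n [d [_ R dt H]]] := ends_path _ E; split=> [acc_t|[d' [[n' R'] H'] Hd']].
    by exists d; [split; [exists n | eexists; exact: H] | rewrite H acc_t].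
  have dd : d = d' by apply: reach_unique R (ex_intro _ _ H) R' H'.
  by move: Hd'; rewrite -dd H => -[->].
Qed.

Lemma frag_NPTM (F : frag V G) B (q : {poly nat}) (P : string -> string -> bool) :
  pbound B ->
  (forall x w, size w = q.[size x]%R ->
     exists2 t', ends F (input_store [:: x]) w (B (size x)) t' &
       ((t' (inl ord0)).2 0 == bit true) = P x w) ->
  exists M, [/\ NPTM M, balanced q M &
    forall x w, acc M x w <-> size w = q.[size x]%R /\ P x w].
Proof.
move=> [b hb] run_x; exists (frag_machine F).
have path_w x w : size w = q.[size x]%R -> exists n d, [/\ n <= B (size x),
    reach (init (frag_machine F) [:: x]) w n d & instr_at d = Halt (P x w)].
  move=> szw; have [t' E <-] := run_x x w szw.
  by have [//|n [d [le R dt H]]] := ends_path _ E; exists n, d.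
pose N (x : string) : nat := q.[size x]%R.
(* Halting runs are known only along strings of length [N x]. An arbitrary guess string is cut or
   filled up to that length, which keeps it comparable with the original in the sense of
   [reach_prefix]; comparing in both directions then shows that a complete path has length exactly
   [N x]. *)
pose fit (x w : string) : string := take (N x) w ++ nseq (N x - size w) false.
have size_fit x w : size (fit x w) = N x.
  by rewrite size_cat size_nseq size_take; case: ltnP => h; lia.
have fitP x w : exists u u', fit x w ++ u = w ++ u'.
  case: (leqP (size w) (N x)) => h.
    by exists [::], (nseq (N x - size w) false); rewrite cats0 /fit take_oversize.
  exists (drop (N x) w), [::]; rewrite /fit (eqP (_ : N x - size w == 0)) ?subn_eq0 ?(ltnW h) //.
  by rewrite /= !cats0 cat_take_drop.
clearbody fit.
have path_size x w : (exists d, @path_to (frag_machine F) [:: x] w d) -> size w = N x.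
  move=> [d [[n R] H]].
  have [n' [d' [_ R' H']]] := path_w x _ (size_fit x w).
  have [_ [u fu]] := reach_prefix R' (ex_intro _ _ H') R (fitP x w).
  have [u1 [u2 e]] := fitP x w.
  have [_ [u' fu']] := reach_prefix R H R' (ex_intro _ u2 (ex_intro _ u1 (esym e))).
  have := congr1 size fu; have := congr1 size fu'; rewrite !size_cat size_fit; lia.
split.
- exists b => -[|x []] // _ w n d R; rewrite /= addn0.
  have [n' [d' [le R' H']]] := path_w x _ (size_fit x w).
  have [le' _] := reach_prefix R' (ex_intro _ _ H') R (fitP x w).
  exact: leq_trans le' (leq_trans le (hb _)).
- move=> x w; split; first exact: path_size.
  move=> /path_w[n [d [_ R H]]]; exists d; split; first by exists n.
  by eexists; exact: H.
- move=> x w; split.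
    move=> [d [[n R] Hd] Ha]; have szw := path_size x w (ex_intro _ d (conj (ex_intro _ n R) Hd)).
    split=> //; have [n' [d' [_ R' H']]] := path_w x w szw.
    have dd := reach_unique R Hd R' (ex_intro _ _ H').
    by move: Ha; rewrite dd H' => -[->].
  move=> [szw Pw]; have [n [d [_ R H]]] := path_w x w szw.
  exists d; last by rewrite H Pw.
  by split; [exists n | eexists; exact: H].
Qed.

End FragmentMachine.

Arguments input_store {X G}.
(** * Stack programs *)

(** Self-delimiting code: a marker [true] announces each bit of the first component and [false] ends
    it, so a pair is taken apart by one scan with finite control. *)
Fixpoint dbl (s : string) : string :=
  if s is b :: s' then true :: b :: dbl s' else [::].

Definition bpair (s r : string) : string := dbl s ++ false :: r.

(** Malformed strings get default components, which makes the projections total. Where a code has to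
    be unique, being a genuine pair is tested by rebuilding it from its components. *)
Fixpoint unpair (s : string) : string * string :=
  match s with
  | true :: b :: s' => (b :: (unpair s').1, (unpair s').2)
  | false :: s' => ([::], s')
  | _ => ([::], [::])
  end.

Definition fst_s s := (unpair s).1.
Definition snd_s s := (unpair s).2.

Lemma pairK s r : unpair (bpair s r) = (s, r).
Proof. by elim: s => [|b s IHs] //; rewrite /= -/(bpair s r) IHs. Qed.

Lemma fst_pair s r : fst_s (bpair s r) = s. Proof. by rewrite /fst_s pairK. Qed.

Lemma snd_pair s r : snd_s (bpair s r) = r. Proof. by rewrite /snd_s pairK. Qed.

Lemma dbl_cat s r : dbl (s ++ r) = dbl s ++ dbl r.
Proof. by elim: s => //= b s ->. Qed.

Lemma size_dbl s : size (dbl s) = (size s).*2.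
Proof. by elim: s => //= b s ->. Qed.

Lemma size_pair s r : size (bpair s r) = (size s).*2 + (size r).+1.
Proof. by rewrite size_cat size_dbl. Qed.

Lemma string2_ind (P : string -> Prop) :
  P [::] -> (forall b, P [:: b]) -> (forall b c s, P s -> P (b :: c :: s)) ->
  forall s, P s.
Proof.
move=> P0 P1 P2 s; suff [] : P s /\ forall b, P (b :: s) by [].
by elim: s => [|b s [Ps Pbs]]; split=> // c; apply: P2.
Qed.

Lemma size_unpair s : size (fst_s s) + size (snd_s s) <= size s.
Proof.
by elim/string2_ind: s => [|[]|[] b s] //=; rewrite /fst_s /snd_s /=; lia.
Qed.

(* Adds one to a binary number, least significant bit first. *)
Fixpoint inc (s : string) : string :=
  match s with
  | true :: s' => false :: inc s'
  | false :: s' => true :: s'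
  | [::] => [::]
  end.

Ltac upd_ext := apply/funext => ?; rewrite /upd; do ?case: eqP => //.

Section StackPrograms.
Variables (V G : finType).
Implicit Types (t : store V G) (i j k : V) (u v : string) (f h l : stream (bool + G)).
Local Notation blk := (@blank (bool + G)).

Lemma upd_eq t i a : upd t i a i = a. Proof. by rewrite /upd eqxx. Qed.

Lemma upd_ne t i j a : j != i -> upd t i a j = t j.
Proof. by rewrite /upd => /negbTE ->. Qed.

Lemma upd_upd t i a b : upd (upd t i a) i b = upd t i b.
Proof. by apply/funext => j; rewrite /upd; case: eqP. Qed.

Lemma upd_id t i : upd t i (t i) = t.
Proof. by apply/funext => j; rewrite /upd; case: eqP => [->|]. Qed.

Lemma upd_comm t i j a b : i != j -> upd (upd t i a) j b = upd (upd t j b) i a.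
Proof.
by move=> ij; apply/funext => k; rewrite /upd; case: (eqVneq k i) => [->|//];
  rewrite (negbTE ij).
Qed.

Definition skip i : frag V G := act1 i (fun r => (r i, Stay)).

Lemma skip_ends i t : ends (skip i) t [::] 1 t.
Proof.
have := act1_ends i (fun r => (r i, Stay)) t; rewrite /look /=.
by case e: (t i) => [l f] /=; rewrite scons_stail -e upd_id.
Qed.

Definition pop i : frag V G := act1 i (fun=> (None, GoRight)).

Lemma pop_ends i t l s f : t i = (l, scons s f) ->
  ends (pop i) t [::] 1 (upd t i (scons None l, f)).
Proof. by move=> ti; have := act1_ends i (fun=> (None, GoRight)) t; rewrite ti. Qed.

Definition push_by i (g : (V -> symbol G) -> symbol G) : frag V G :=
  seqf (act1 i (fun r => (r i, GoLeft))) (act1 i (fun r => (g r, Stay))).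

(** The symbol is chosen after the head has moved left, so it must not depend on what tape [i]
    shows. The left half being blank, the move uncovers a fresh cell. *)
Lemma push_by_ends i g s t f : t i = (blk, f) ->
  (forall a, g (look (upd t i a)) = s) ->
  ends (push_by i g) t [::] 2 (upd t i (blk, scons s f)).
Proof.
move=> ti gs.
have E1 := act1_ends i (fun r => (r i, GoLeft)) t.
have E2 := act1_ends i (fun r => (g r, Stay))
  (upd t i (smove (look t i, GoLeft) (t i))).
have := seqf_ends E1 E2; rewrite gs upd_upd upd_eq ti /look ti /=.
by rewrite stail_scons scons_stail.
Qed.

Definition push i b : frag V G := push_by i (fun=> bit b).

Lemma push_ends i b t f : t i = (blk, f) ->
  ends (push i b) t [::] 2 (upd t i (blk, scons (bit b) f)).
Proof. by move=> ti; apply: push_by_ends. Qed.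

Definition map_bit (g : bool -> bool) (s : symbol G) : symbol G :=
  if s is Some (inl b) then bit (g b) else s.

Definition push_top g i j : frag V G := push_by j (fun r => map_bit g (r i)).

Lemma push_top_ends g i j b t l f h : i != j -> t i = (l, scons (bit b) f) ->
  t j = (blk, h) ->
  ends (push_top g i j) t [::] 2 (upd t j (blk, scons (bit (g b)) h)).
Proof.
move=> ij ti tj; apply: push_by_ends => // a.
by rewrite /look upd_ne // ti.
Qed.

Definition bit_at i : (V -> symbol G) -> bool := fun r => is_bit (r i).

Lemma bit_atE i t l f : t i = (l, f) -> bit_at i (look t) = is_bit (f 0).
Proof. by rewrite /bit_at /look => ->. Qed.

(** An embedded machine may leave anything to the left of its head; this is that left half after [n]
    cells of its output have been popped. *)
Definition nones n l := iter n (scons None) l.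

Lemma nones_blank n : nones n blk = blk.
Proof. by elim: n => //= n ->; rewrite scons_blank. Qed.

Lemma nonesSr n l : nones n.+1 l = nones n (scons None l).
Proof. by rewrite /nones iterSr. Qed.

(** A transfer between stacks reverses the string, which is why most transfers below are made
    twice. *)
Definition shift g i j : frag V G :=
  whilef (bit_at i) (seqf (push_top g i j) (pop i)).

Lemma shift_ends g i j t l u f h : i != j -> t i = (l, str u f) -> ~~ is_bit (f 0) ->
  t j = (blk, h) ->
  ends (shift g i j) t [::] (4 * size u + 1)
    (upd (upd t i (nones (size u) l, f)) j (blk, str (rev (map g u)) h)).
Proof.
move=> ij + nf; elim: u t l h => [|b u IHu] t l h ti tj.
  rewrite -tj -ti !upd_id; apply: whilef_stop; rewrite (bit_atE ti) //.
have E := seqf_ends (push_top_ends g ij ti tj)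
  (pop_ends (etrans (upd_ne _ _ ij) ti)).
have bt : bit_at i (look t) by rewrite (bit_atE ti).
apply: (@ends_le _ _ _ _ _ (2 + 1 + (4 * size u + 1)).+1); last by rewrite /=; lia.
rewrite [rev _]rev_cons -cats1 str_cat nonesSr.
have := whilef_step bt E (IHu _ (scons None l) (scons (bit (g b)) h) _ _).
rewrite upd_eq upd_ne 1?eq_sym // upd_eq => /(_ erefl erefl).
by congr (ends _ _ _ _ _); upd_ext.
Qed.

Lemma pop_blank_ends i t s f : t i = (blk, scons s f) ->
  ends (pop i) t [::] 1 (upd t i (blk, f)).
Proof. by move=> /pop_ends; rewrite scons_blank. Qed.

Definition shift_dbl i j : frag V G :=
  whilef (bit_at i) (seqf (push_top id i j) (seqf (push j true) (pop i))).

Lemma shift_dbl_ends i j t u f h : i != j -> t i = (blk, str u f) -> ~~ is_bit (f 0) ->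
  t j = (blk, h) ->
  ends (shift_dbl i j) t [::] (6 * size u + 1)
    (upd (upd t i (blk, f)) j (blk, str (dbl (rev u)) h)).
Proof.
move=> ij + nf; have ji : j != i by rewrite eq_sym.
elim: u t h => [|b u IHu] t h ti tj.
  rewrite -tj -ti !upd_id; apply: whilef_stop; rewrite (bit_atE ti) //.
have E1 := push_top_ends id ij ti tj.
have E2 := push_ends true (upd_eq t j (blk, scons (bit b) h)).
have E3 := @pop_blank_ends i _ (bit b) (str u f) (etrans (upd_ne _ _ ij) (etrans (upd_ne _ _ ij) ti)).
have bt : bit_at i (look t) by rewrite (bit_atE ti).
have := whilef_step bt (seqf_ends E1 (seqf_ends E2 (E3 _ _)))
  (IHu _ (scons (bit true) (scons (bit b) h)) _ _).
rewrite !(upd_eq, upd_ne) // => /(_ erefl erefl) E.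
apply: (@ends_le _ _ _ _ _ (2 + (2 + 1) + (6 * size u + 1)).+1); last by rewrite /=; lia.
rewrite rev_cons -cats1 dbl_cat str_cat.
by move: E; congr (ends _ _ _ _ _); upd_ext.
Qed.

Definition dup g i j k : frag V G :=
  whilef (bit_at i) (seqf (push_top id i j) (seqf (push_top g i k) (pop i))).

Lemma dup_ends g i j k t u f h h' : [&& i != j, i != k & j != k] ->
  t i = (blk, str u f) -> ~~ is_bit (f 0) -> t j = (blk, h) -> t k = (blk, h') ->
  ends (dup g i j k) t [::] (6 * size u + 1)
    (upd (upd (upd t i (blk, f)) j (blk, str (rev u) h)) k (blk, str (rev (map g u)) h')).
Proof.
move=> /and3P[ij ik jk] + nf.
have [ji [ki kj]] : j != i /\ k != i /\ k != j by rewrite ![k == _]eq_sym [j == _]eq_sym.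
elim: u t h h' => [|b u IHu] t h h' ti tj tk.
  rewrite -tk -tj -ti !upd_id; apply: whilef_stop; rewrite (bit_atE ti) //.
have E1 := push_top_ends id ij ti tj.
have E2 := @push_top_ends g i k b _ _ _ _ ik (etrans (upd_ne _ _ ij) ti) (etrans (upd_ne _ _ kj) tk).
have E3 := @pop_blank_ends i _ (bit b) (str u f) (etrans (upd_ne _ _ ik) (etrans (upd_ne _ _ ij) ti)).
have bt : bit_at i (look t) by rewrite (bit_atE ti).
have := whilef_step bt (seqf_ends E1 (seqf_ends (E2 _) (E3 _ _)))
  (IHu _ (scons (bit b) h) (scons (bit (g b)) h') _ _ _).
rewrite !(upd_eq, upd_ne) // => /(_ erefl erefl erefl) E.
apply: (@ends_le _ _ _ _ _ (2 + (2 + 1) + (6 * size u + 1)).+1); last by rewrite /=; lia.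
rewrite /= !rev_cons -!cats1 !str_cat.
by move: E; congr (ends _ _ _ _ _); upd_ext.
Qed.

Definition clear i : frag V G := whilef (bit_at i) (pop i).

Lemma clear_ends i t u f : t i = (blk, str u f) -> ~~ is_bit (f 0) ->
  ends (clear i) t [::] (2 * size u + 1) (upd t i (blk, f)).
Proof.
move=> + nf; elim: u t => [|b u IHu] t ti.
  by rewrite -ti upd_id; apply: whilef_stop; rewrite (bit_atE ti).
have bt : bit_at i (look t) by rewrite (bit_atE ti).
have := whilef_step bt (pop_blank_ends ti) (IHu _ (upd_eq _ _ _)).
rewrite upd_upd => E; apply: ends_le E _; rewrite /=; lia.
Qed.

Definition split_pair i j : frag V G :=
  seqf (whilef (fun r => r i == bit true)
          (seqf (pop i) (iff_ (bit_at i) (seqf (push_top id i j) (pop i)) (skip i))))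
       (iff_ (bit_at i) (pop i) (skip i)).

Lemma split_pair_ends i j t u f h : i != j -> t i = (blk, str u f) ->
  ~~ is_bit (f 0) -> t j = (blk, h) ->
  ends (split_pair i j) t [::] (6 * size u + 3)
    (upd (upd t i (blk, str (snd_s u) f)) j (blk, str (rev (fst_s u)) h)).
Proof.
move=> ij ti nf tj; have ji : j != i by rewrite eq_sym.
have f0 : (f 0 == bit true) = false by apply/eqP => e; rewrite e in nf.
(* [v] is what the scan leaves on tape [i]: the delimiter followed by the second component, or
   nothing at all when a malformed string has run out before any delimiter. *)
have [v Ev E] : exists2 v, v = [::] /\ snd_s u = [::] \/ v = false :: snd_s u &
  ends (whilef (fun r => r i == bit true)
          (seqf (pop i) (iff_ (bit_at i) (seqf (push_top id i j) (pop i)) (skip i))))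
    t [::] (6 * size u + 1) (upd (upd t i (blk, str v f)) j (blk, str (rev (fst_s u)) h)).
  elim/string2_ind: u t h ti tj => [|b|[] c u IHu] t h ti tj.
  - exists [::]; first by left.
    by rewrite -tj -ti !upd_id; apply: whilef_stop; rewrite /look ti /= f0.
  - case: b ti => ti; last first.
      exists [:: false]; first by right.
      rewrite -tj -ti !upd_id; apply: ends_le (whilef_stop _ _) _; last by lia.
      by rewrite /look ti.
    exists [::]; first by left.
    have E1 := pop_blank_ends ti.
    have E2 : ends (iff_ (bit_at i) (seqf (push_top id i j) (pop i)) (skip i))
       (upd t i (blk, f)) [::] 2 (upd t i (blk, f)).
      by apply: iff_ends; rewrite (@bit_atE i _ blk f) ?upd_eq // (negbTE nf); apply: skip_ends.
    have ct : look t i == bit true by rewrite /look ti.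
    have E3 := whilef_step (b := fun r => r i == bit true) ct (seqf_ends E1 E2) (whilef_stop _ _).
    rewrite [upd _ _ (_, str (rev _) _)](_ : _ = upd t i (blk, f)).
      apply: ends_le (E3 _) _; last by rewrite /=; lia.
      by rewrite /look upd_eq /= f0.
    by rewrite -tj; apply/funext => k; rewrite /upd; case: (eqVneq k j) => [->|//]; rewrite (negbTE ji).
  - have E1 := @pop_blank_ends i t (bit true) (str (c :: u) f) ti.
    have E2 := @push_top_ends id i j c _ _ _ _ ij (upd_eq _ _ _) (etrans (upd_ne _ _ ji) tj).
    have E3 := @pop_blank_ends i _ (bit c) (str u f) (etrans (upd_ne _ _ ij) (upd_eq _ _ _)).
    have := @iff_ends _ _ (bit_at i) (seqf (push_top id i j) (pop i)) (skip i)
       (upd t i (blk, str (c :: u) f)) _ [::] 3.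
    rewrite (@bit_atE i _ blk (str (c :: u) f)) ?upd_eq // => /(_ _ (seqf_ends (E2 _ _) (E3 _ _))) E23.
    have ct : look t i == bit true by rewrite /look ti.
    have {}IHu := IHu (upd (upd (upd t i (blk, str (c :: u) f)) j (blk, scons (bit c) h))
      i (blk, str u f)) (scons (bit c) h) (upd_eq _ _ _).
    rewrite !(upd_eq, upd_ne) // in IHu; have [v Hv E4] := IHu erefl.
    exists v => //.
    have := whilef_step (b := fun r => r i == bit true) ct (seqf_ends E1 E23) E4.
    rewrite /fst_s /= rev_cons -cats1 str_cat => E5.
    apply: (@ends_le _ _ _ _ _ (1 + 4 + (6 * size u + 1)).+1); last by rewrite /=; lia.
    by move: E5; congr (ends _ _ _ _ _); upd_ext.
  - exists [:: false, c & u]; first by right.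
    rewrite -tj -ti !upd_id; apply: ends_le (whilef_stop _ _) _; last by lia.
    by rewrite /look ti.
have -> : 6 * size u + 3 = (6 * size u + 1) + 2 by lia.
apply: seqf_ends E _; apply: iff_ends.
case: Ev => [[-> ->]|->].
  rewrite (@bit_atE i _ blk f) ?(upd_eq, upd_ne) // (negbTE nf); exact: skip_ends.
rewrite (@bit_atE i _ blk (str (false :: snd_s u) f)) ?(upd_eq, upd_ne) //=.
have := @pop_blank_ends i (upd (upd t i (blk, str (false :: snd_s u) f)) j
  (blk, str (rev (fst_s u)) h)) (bit false) (str (snd_s u) f).
rewrite upd_ne // upd_eq => /(_ erefl).
by congr (ends _ _ _ _ _); rewrite (upd_comm _ _ _ ji) upd_upd.
Qed.

End StackPrograms.

Arguments skip {V G}.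
Arguments pop {V G}.
Arguments push {V G}.
Arguments push_top {V G}.
Arguments shift {V G}.
Arguments shift_dbl {V G}.
Arguments dup {V G}.
Arguments clear {V G}.
Arguments split_pair {V G}.
(** * Running a machine inside a fragment *)

Section Embedding.
Variables (V G : finType) (M : machine).
Variables (tau : 'I_(work M).+1 -> V) (gam : aux M -> G) (mag : G -> option (aux M)).
Hypotheses (tau_inj : injective tau) (gamK : pcancel gam mag).
Variables (gt fl : V).
Hypotheses (tau_gt : forall i, tau i != gt) (tau_fl : forall i, tau i != fl)
  (gt_fl : gt != fl).
Let fl_gt : fl != gt. Proof. by rewrite eq_sym. Qed.
Local Notation blk := (@blank (bool + G)).

Definition enc_sym (s : symbol (aux M)) : symbol G :=
  match s with
  | Some (inl b) => Some (inl b)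
  | Some (inr g) => Some (inr (gam g))
  | None => None
  end.

Definition dec_sym (s : symbol G) : symbol (aux M) :=
  match s with
  | Some (inl b) => Some (inl b)
  | Some (inr g) => omap inr (mag g)
  | None => None
  end.

Lemma enc_symK : cancel enc_sym dec_sym.
Proof. by case=> [[b|g]|] //=; rewrite gamK. Qed.

Definition enc_tape (t : stape (aux M)) : stape G := (enc_sym \o t.1, enc_sym \o t.2).

Lemma enc_scons s f : enc_sym \o scons s f = scons (enc_sym s) (enc_sym \o f).
Proof. by apply/funext => -[]. Qed.

Lemma enc_move s d t :
  enc_tape (smove (s, d) t) = smove (enc_sym s, d) (enc_tape t).
Proof. by case: d; rewrite /enc_tape /= ?enc_scons. Qed.

Lemma enc_stk u : enc_tape (stk u) = stk u.
Proof.
rewrite /enc_tape /stk /str /=; congr pair; elim: u => //= b u.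
by rewrite enc_scons => ->.
Qed.

Lemma enc_str u f : enc_sym \o str u f = str u (enc_sym \o f).
Proof. by elim: u => //= b u IHu; rewrite [str (b :: u) f]/(scons _ (str u f)) enc_scons IHu. Qed.

Definition on_tau (a : V) (T : Type) (x : 'I_(work M).+1 -> T) (y : T) : T :=
  if [pick i | tau i == a] is Some i then x i else y.

Lemma on_tauE i T (x : 'I_(work M).+1 -> T) y : on_tau (tau i) x y = x i.
Proof.
rewrite /on_tau; case: pickP => [j /eqP/tau_inj->//|/(_ i)].
by rewrite eqxx.
Qed.

Lemma on_tau_out a T (x : 'I_(work M).+1 -> T) y :
  (forall i, tau i != a) -> on_tau a x y = y.
Proof.
by rewrite /on_tau; case: pickP => // j /eqP <- /(_ j); rewrite eqxx.
Qed.

Definition emb_actions (a : {ffun 'I_(work M).+1 -> symbol (aux M) * dir})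
    (pop_gt : bool) (r : V -> symbol G) : actions V G := fun j =>
  if j == gt then (if pop_gt then (None, GoRight) else (r j, Stay))
  else on_tau j (fun i => (enc_sym (a i).1, (a i).2)) (r j, Stay).

(* Runs [M] with the guesses read off tape [gt]; tape [fl] records whether [M]
   accepts having used up all of them. *)
Definition emb : frag V G :=
  @Frag V G (state M) (start M) (fun s r =>
    match delta s [ffun i => dec_sym (r (tau i))] with
    | Halt v => FStep None (fun j =>
        if j == fl then (bit (v && ~~ is_bit (r gt)), Stay) else (r j, Stay))
    | Step a => FStep (Some a.1) (emb_actions a.2 false r)
    | Guess g => match r gt with
        | Some (inl b) => FStep (Some (g b).1) (emb_actions (g b).2 true r)
        | _ => FStep None (fun j => if j == fl then (bit false, Stay) else (r j, Stay))
        end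
    end).

Lemma deterministic_emb : deterministic_frag emb.
Proof. by move=> s r /=; case: delta => // g; case: (r gt) => [[]|]. Qed.

Definition emb_store (t : store V G) (c : config M) : store V G :=
  fun j => on_tau j (fun i => enc_tape (tape_streams (c.2 i))) (t j).

Lemma emb_store_out t c j : (forall i, tau i != j) -> emb_store t c j = t j.
Proof. exact: on_tau_out. Qed.

Lemma emb_look t c u :
  [ffun i => dec_sym (look (upd (emb_store t c) gt (stk u)) (tau i))] =
  [ffun i => read (c.2 i)].
Proof.
apply/ffunP => i; rewrite !ffunE /look upd_ne // /emb_store on_tauE /=.
by rewrite enc_symK tape_streams_read.
Qed.

Lemma emb_act t (c : config M) a b u :
  act (emb_actions a.2 b (look (upd (emb_store t c) gt (stk u))))
      (upd (emb_store t c) gt (stk u)) =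
  upd (emb_store t (apply_action a c)) gt (stk (if b then behead u else u)).
Proof.
apply/funext => j; rewrite /act /emb_actions /upd /look.
case: eqP => [_|/eqP jgt].
  case: b => /=; last by rewrite scons_stail.
  by congr pair; [exact: scons_blank | case: u].
rewrite /emb_store.
case: (boolP [exists i, tau i == j]) => [/existsP[i /eqP <-]|/existsPn out].
  rewrite !on_tauE /= !ffunE tape_streams_move.
  by case: (a.2 i) => s d; rewrite enc_move.
by rewrite !on_tau_out //=; case: (t j) => l r; rewrite scons_stail.
Qed.

Lemma stk_nil u : ~~ is_bit ((stk u : stape G).2 0) = (u == [::]).
Proof. by case: u. Qed.

Lemma emb_run t c w n d v u : reach c w n d -> instr_at d = Halt v ->
  run (F := emb) (Some c.1) (upd (emb_store t c) gt (stk (w ++ u))) [::] n.+1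
    (upd (upd (emb_store t d) gt (stk u)) fl
       ((t fl).1, scons (bit (v && (u == [::]))) (stail (t fl).2))).
Proof.
move=> R Hv; elim: R Hv => {c w n d} [c|c a w n d Hc _ IH|c g b w n d Hc _ IH] Hv /=.
- apply: run_step; first by rewrite /= emb_look -/(instr_at c) Hv.
  set t1 := act _ _; set t2 := upd _ _ _; suff -> : t1 = t2 by exact: run_exit.
  apply/funext => j; rewrite /t1 /t2 /act; case: (eqVneq j fl) => [->|jfl] /=.
    by rewrite upd_ne // emb_store_out // upd_eq /look upd_eq stk_nil.
  rewrite [RHS]upd_ne //.
  by rewrite /look; case: (upd _ _ _ j) => l r /=; rewrite scons_stail.
- apply: run_step; first by rewrite /= emb_look -/(instr_at c) Hc.
  by rewrite emb_act; apply: IH.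
- apply: run_step.
    by rewrite /= emb_look -/(instr_at c) Hc {1}/look upd_eq /=.
  by rewrite emb_act /=; apply: IH.
Qed.

(** The other way for [emb] to stop: [M] asks for a bit when none is left. The supplied string is
    then too short to be a complete path, so the flag must read [false]. *)
Lemma emb_run_short t c w n d g : reach c w n d -> instr_at d = Guess g ->
  run (F := emb) (Some c.1) (upd (emb_store t c) gt (stk w)) [::] n.+1
    (upd (upd (emb_store t d) gt (stk [::])) fl
       ((t fl).1, scons (bit false) (stail (t fl).2))).
Proof.
move=> R Hv; elim: R Hv => {c w n d} [c|c a w n d Hc _ IH|c g' b w n d Hc _ IH] Hv /=.
- apply: run_step; first by rewrite /= emb_look -/(instr_at c) Hv {1}/look upd_eq /=.
  set t1 := act _ _; set t2 := upd _ _ _; suff -> : t1 = t2 by exact: run_exit.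
  apply/funext => j; rewrite /t1 /t2 /act; case: (eqVneq j fl) => [->|jfl] /=.
    by rewrite upd_ne // emb_store_out // upd_eq.
  rewrite [RHS]upd_ne //.
  by rewrite /look; case: (upd _ _ _ j) => l r /=; rewrite scons_stail.
- apply: run_step; first by rewrite /= emb_look -/(instr_at c) Hc.
  by rewrite emb_act; apply: IH.
- apply: run_step.
    by rewrite /= emb_look -/(instr_at c) Hc {1}/look upd_eq /=.
  by rewrite emb_act /=; apply: IH.
Qed.

Lemma emb_store_init t xs :
  (forall i : 'I_(work M).+1, t (tau i) = stk (nth [::] xs i)) ->
  emb_store t (init M xs) = t.
Proof.
move=> ti; apply/funext => j; rewrite /emb_store /on_tau; case: pickP => // i /eqP <-.
by rewrite ffunE tape_streams_input enc_stk ti.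
Qed.

Lemma emb_ends t xs n d v u : (forall i : 'I_(work M).+1, t (tau i) = stk (nth [::] xs i)) ->
  t gt = stk u ->
  reach (init M xs) [::] n d -> instr_at d = Halt v ->
  exists2 t', ends emb t [::] n.+1 t' &
    [/\ forall j, (forall i, tau i != j) -> j != fl -> t' j = t j,
        exists l f, t' (tau ord0) = (l, str (output d) f) /\ ~~ is_bit (f 0) &
        t' fl = ((t fl).1, scons (bit (v && (u == [::]))) (stail (t fl).2))].
Proof.
move=> ti tgt R Hv; eexists.
  exists n.+1 => //; have := emb_run t u R Hv.
  by rewrite emb_store_init // -tgt upd_id; apply.
split.
- move=> j jt jfl; rewrite upd_ne //; case: (eqVneq j gt) => [->|jgt].
    by rewrite upd_eq.
  by rewrite upd_ne // emb_store_out.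
- rewrite !upd_ne // /emb_store on_tauE /enc_tape /tape_streams /output /=.
  have [f -> nf] := str_leading_bits (d.2 ord0).2.
  exists (enc_sym \o nth None (d.2 ord0).1), (enc_sym \o f); rewrite enc_str; split=> //=.
  by case: (f 0) nf => [[]|].
- by rewrite upd_eq.
Qed.

End Embedding.

(** A left move made where the right half is empty lengthens it by two cells, the one written and
    the one entered; hence the factor 2. It follows that outputs have polynomial length. *)
Lemma size_leading_bits M w n (c d : config M) i : reach c w n d ->
  size (d.2 i).2 <= size (c.2 i).2 + 2 * n.
Proof.
elim=> {c w n d} [c|c a w n d _ _ IH|c g b w n d _ _ IH]; first by rewrite addn0.
- apply: leq_trans IH _; rewrite /apply_action /= ffunE.
  by case: (a.2 i) => s [] /=; rewrite size_behead; lia.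
- apply: leq_trans IH _; rewrite /apply_action /= ffunE.
  by case: ((g b).2 i) => s [] /=; rewrite size_behead; lia.
Qed.
(** * Closure properties of polynomial-time functions *)

(** Induction on the clock: a configuration that neither halts nor asks for a missing bit has a
    successor, so within the time bound one of the two must occur, whatever supply [u] of guesses is
    offered. *)
Lemma polytime_runs k M xs : polytime k M -> size xs = k ->
  forall u, exists w u' n d, [/\ u = w ++ u', reach (init M xs) w n d &
    (exists v, instr_at d = Halt v) \/ (u' = [::] /\ exists g, instr_at d = Guess g)].
Proof.
move=> [q hq] szx; have := hq xs szx; move: (init M xs) (q.[_]%R : nat) => c N.
elim: N c => [|N IHN] c bound u; case Hc: (instr_at c) => [v|a|g].
- by exists [::], u, 0, c; split=> //; [apply: reach_nil | left; exists v].
- by have := bound _ _ _ (reach_step Hc (reach_nil _)).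
- by have := bound _ _ _ (reach_guess (b := true) Hc (reach_nil _)).
- by exists [::], u, 0, c; split=> //; [apply: reach_nil | left; exists v].
- have [|w [u' [n [d [-> R Hd]]]]] := IHN (apply_action a c) _ u.
    by move=> w n d R; have := bound _ _ _ (reach_step Hc R).
  by exists w, u', n.+1, d; split=> //; apply: reach_step Hc R.
- case: u => [|b u].
    by exists [::], [::], 0, c; split=> //; [apply: reach_nil | right; split=> //; exists g].
  have [|w [u' [n [d [-> R Hd]]]]] := IHN (apply_action (g b) c) _ u.
    by move=> w n d R; have := bound _ _ _ (reach_guess Hc R).
  by exists (b :: w), u', n.+1, d; split=> //; apply: reach_guess Hc R.
Qed.

(** One function bounds both time and output length. It is monotone so that it can be applied to
    size estimates, and the strict [n < B (size x)] absorbs the extra step with which [emb]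
    exits. *)
Definition computes (M : machine) (B : nat -> nat) (f : string -> string) : Prop :=
  [/\ pbound B, forall m n, m <= n -> B m <= B n,
      forall x, size (f x) <= B (size x) &
      forall x, exists n d v, [/\ n < B (size x), reach (init M [:: x]) [::] n d,
        instr_at d = Halt v & output d = f x]].

Lemma FPt_computes f : FPt f -> exists M B, computes M B f.
Proof.
move=> [M [_ [q hq] Mf]]; exists M, (fun n => (n + 2 * q.[n]%R).+1).
have Mx x : exists n d v, [/\ n <= q.[size x]%R, reach (init M [:: x]) [::] n d,
    instr_at d = Halt v & output d = f x].
  have [d [[n R] [v Hv]] out] := Mf x; exists n, d, v; split=> //.
  by have := hq [:: x] erefl _ _ _ R; rewrite /= addn0.
split.
- under eq_fun do rewrite -addn1.
  apply: pbound_add (pbound_const 1); apply: pbound_add pbound_id _.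
  by apply: pbound_mul (pbound_poly q); exact: pbound_const.
- by move=> m n mn; have := leq_horner q mn; lia.
- move=> x; have [n [d [v [le R _ <-]]]] := Mx x.
  have lb (G : finType) (r : seq (symbol G)) : size (leading_bits r) <= size r.
    by elim: r => [|[[b|g]|] r IHr].
  apply: leq_trans (lb _ _) _; apply: leq_trans (size_leading_bits _ R) _.
  by rewrite /= ffunE size_map /=; lia.
- by move=> x; have [n [d [v [le R H out]]]] := Mx x; exists n, d, v; split=> //; lia.
Qed.

Section Calls.
Variables (V G : finType).
Implicit Types (t : store V G) (i j k : V).

Definition mkpair i j k : frag V G :=
  seqf (push j false) (seqf (shift id i k) (shift_dbl k j)).

Lemma stkE u : stk u = (@blank _, str u (@blank _)) :> stape G. Proof. by []. Qed.

Lemma shift_stk i j t u v : i != j -> t i = stk u -> t j = stk v ->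
  ends (shift id i j) t [::] (4 * size u + 1)
    (upd (upd t i (stk [::])) j (stk (rev u ++ v))).
Proof.
move=> ij ti tj; have := @shift_ends _ _ id i j t _ u (@blank _) _ ij ti isT tj.
by rewrite nones_blank map_id -str_cat.
Qed.

Lemma mkpair_ends i j k t u v : [&& i != j, i != k & j != k] ->
  t i = stk u -> t j = stk v -> t k = stk [::] ->
  ends (mkpair i j k) t [::] (10 * size u + 4)
    (upd (upd t i (stk [::])) j (stk (bpair u v))).
Proof.
move=> /and3P[ij ik jk] ti tj tk.
have [ji [ki kj]] : j != i /\ k != i /\ k != j by rewrite ![k == _]eq_sym [j == _]eq_sym.
have E1 := push_ends false tj.
rewrite -[scons _ _]/(str (false :: v) _) -stkE in E1.
have := @shift_stk i k _ u [::] ik (etrans (upd_ne _ _ ij) ti) (etrans (upd_ne _ _ kj) tk).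
rewrite cats0 => /(_ (stk (false :: v))) E2.
have := @shift_dbl_ends V G k j _ (rev u) (@blank _) (str (false :: v) (@blank _)) kj (upd_eq _ _ _) isT
  (etrans (upd_ne _ _ jk) (etrans (upd_ne _ _ ji) (upd_eq _ _ (stk (false :: v))))).
rewrite revK size_rev -str_cat => /(_ t (stk [::])) E3.
apply: (@ends_le _ _ _ _ _ (2 + ((4 * size u + 1) + (6 * size u + 1)))); last by lia.
have := seqf_ends E1 (seqf_ends E2 E3).
congr (ends _ _ _ _ _); apply/funext => a; rewrite /upd.
case: eqP => [//|_]; case: (eqVneq a k) => [->|//]; by rewrite (negbTE ki) tk.
Qed.

Lemma deterministic_shift g i j : deterministic_frag (@shift V G g i j).
Proof.
apply: deterministic_whilef; apply: deterministic_seqf => //.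
exact: deterministic_seqf.
Qed.

Lemma deterministic_push i b : deterministic_frag (@push V G i b).
Proof. exact: deterministic_seqf. Qed.

Lemma deterministic_shift_dbl i j : deterministic_frag (@shift_dbl V G i j).
Proof. by apply: deterministic_whilef; do !apply: deterministic_seqf. Qed.

Lemma deterministic_dup g i j k : deterministic_frag (@dup V G g i j k).
Proof. by apply: deterministic_whilef; do !apply: deterministic_seqf. Qed.

Lemma deterministic_clear i : deterministic_frag (@clear V G i).
Proof. exact: deterministic_whilef. Qed.

Lemma deterministic_split_pair i j : deterministic_frag (@split_pair V G i j).
Proof.
apply: deterministic_seqf; last exact: deterministic_iff.
apply: deterministic_whilef; apply: deterministic_seqf => //.
by apply: deterministic_iff => //; do !apply: deterministic_seqf.
Qed.

Lemma deterministic_mkpair i j k : deterministic_frag (mkpair i j k).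
Proof.
apply: deterministic_seqf; first exact: deterministic_push.
by apply: deterministic_seqf; [exact: deterministic_shift | exact: deterministic_shift_dbl].
Qed.

Section Call.
Variables (M : machine) (B : nat -> nat) (f : string -> string).
Variables (tau : 'I_(work M).+1 -> V) (gam : aux M -> G) (mag : G -> option (aux M)).
Hypotheses (fM : computes M B f) (tau_inj : injective tau) (gamK : pcancel gam mag).
Variables (gt fl i k : V).
Hypotheses (out : forall m, [&& tau m != gt, tau m != fl, tau m != i & tau m != k])
  (dist : uniq [:: gt; fl; i; k]).

(** The argument travels to the input tape of [M] by two transfers through [k], so that it arrives
    unreversed, and the output returns in the same way. The tapes of [M] are left dirty, so each
    call in a program needs tapes of its own. *)
Definition call : frag V G :=
  seqf (seqf (shift id i k) (shift id k (tau ord0)))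
    (seqf (emb tau gam mag gt fl) (seqf (shift id (tau ord0) k) (shift id k i))).

Lemma deterministic_call : deterministic_frag call.
Proof.
apply: deterministic_seqf; first by apply: deterministic_seqf; exact: deterministic_shift.
apply: deterministic_seqf; first exact: deterministic_emb.
by apply: deterministic_seqf; exact: deterministic_shift.
Qed.

Lemma call_ends t x : (forall m, t (tau m) = stk [::]) ->
  t gt = stk [::] -> t i = stk x -> t k = stk [::] ->
  exists2 t', ends call t [::] (8 * size x + 9 * B (size x) + 4) t' &
    t' i = stk (f x) /\
    forall j, (forall m, tau m != j) -> j != fl -> j != i -> t' j = t j.
Proof.
move=> ttau tgt ti tk; have [_ _ szf Mf] := fM.
have tau_gt m : tau m != gt by case/and4P: (out m).
have tau_fl m : tau m != fl by case/and4P: (out m).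
have tau_i m : tau m != i by case/and4P: (out m).
have tau_k m : tau m != k by case/and4P: (out m).
have [gtfl gti gtk fli [flk ik]] : [/\ gt != fl, gt != i, gt != k, fl != i & fl != k /\ i != k].
  by move: dist; rewrite /= !inE !negb_or => /and4P[/and3P[-> -> ->] /andP[-> ->] -> _].
have sym (a b : V) : a != b -> b != a by rewrite eq_sym.
have E1 := shift_stk ik ti tk; rewrite cats0 in E1.
have := @shift_stk k (tau ord0) _ (rev x) [::] (sym _ _ (tau_k _)) (upd_eq _ _ _)
  (etrans (upd_ne _ _ (tau_k _)) (etrans (upd_ne _ _ (tau_i _)) (ttau _))).
rewrite revK cats0 size_rev => /(_ (stk [::])) E2.
set t2 := upd _ (tau ord0) _ in E2.
have t2E j : t2 j = if j == tau ord0 then stk x else if j == i then stk [::] else t j.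
  rewrite /t2 /upd; case: eqP => // _; case: (eqVneq j k) => [->|//].
  by rewrite eq_sym (negbTE ik) tk.
have [n [d [v [nB R Hv od]]]] := Mf x.
have t2tau (j : 'I_(work M).+1) : t2 (tau j) = stk (nth [::] [:: x] j).
  rewrite t2E (inj_eq tau_inj); case: eqP => [->//|/eqP j0].
  rewrite (negbTE (tau_i _)) ttau; case: j j0 => [[|j] lt] //= _.
  by rewrite nth_nil.
have t2gt : t2 gt = stk [::].
  by rewrite t2E eq_sym (negbTE (tau_gt _)) (negbTE gti) tgt.
have [t3 E3 [t3out [l [g [t3o ng]]] _]] :=
  emb_ends tau_inj gamK tau_gt tau_fl gtfl t2tau t2gt R Hv.
have t3i : t3 i = stk [::].
  by rewrite t3out 1?sym // t2E eqxx eq_sym (negbTE (tau_i _)).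
have t3k : t3 k = stk [::].
  by rewrite t3out 1?sym // t2E eq_sym (negbTE (tau_k _)) eq_sym (negbTE ik) tk.
rewrite od in t3o.
have E4 := shift_ends id (tau_k ord0) t3o ng t3k.
rewrite map_id -stkE in E4.
set t4 := upd _ k _ in E4.
have t4k : t4 k = stk (rev (f x)) by rewrite /t4 upd_eq.
have t4i : t4 i = stk [::] by rewrite /t4 !upd_ne // sym.
have := shift_stk (sym _ _ ik) t4k t4i; rewrite revK cats0 size_rev => E5.
exists (upd (upd t4 k (stk [::])) i (stk (f x))).
  apply: (ends_le (seqf_ends (seqf_ends E1 E2) (seqf_ends E3 (seqf_ends E4 E5)))).
  have := szf x; lia.
split; first by rewrite upd_eq.
move=> j jt jfl ji; rewrite upd_ne //; case: (eqVneq j k) => [->|jk].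
  by rewrite upd_eq tk.
rewrite upd_ne // /t4 upd_ne // upd_ne 1?sym // t3out // t2E (negbTE ji) ifN 1?sym //.
Qed.
End Call.
End Calls.

Arguments mkpair {V G}.
(** * Basic polynomial-time functions *)

Ltac pbound_tac := repeat first
  [ assumption | exact: pbound_id | exact: pbound_const | apply: pbound_add | apply: pbound_mul
  | match goal with H : pbound ?B |- pbound (fun n => ?B (@?C n)) =>
      apply: (@pbound_comp B C H) end ].

Notation tp0 := (inl ord0).
Notation tp1 := (inl (@Ordinal 3 1 isT)).
Notation tp2 := (inl (@Ordinal 3 2 isT)).

Lemma frag_FPt_stk (X G : finType) (F : frag ('I_3 + X)%type G) B f :
  deterministic_frag F -> pbound B ->
  (forall x, exists2 t', ends F (input_store [:: x]) [::] (B (size x)) t' &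
     t' tp0 = stk (f x)) ->
  FPt f.
Proof.
move=> detF pB run_x; apply: (frag_FPt detF pB) => x.
by have [t' E t'0] := run_x x; exists t', (@blank _), (@blank _).
Qed.

Ltac head_of t := lazymatch t with ?f _ => head_of f | _ => t end.

Ltac det_tac := repeat lazymatch goal with
  | |- deterministic_frag (seqf _ _) => apply: deterministic_seqf
  | |- deterministic_frag (iff_ _ _ _) => apply: deterministic_iff
  | |- deterministic_frag (whilef _ _) => apply: deterministic_whilef
  | |- deterministic_frag (shift _ _ _) => exact: deterministic_shift
  | |- deterministic_frag (push _ _) => exact: deterministic_push
  | |- deterministic_frag (dup _ _ _ _) => exact: deterministic_dup
  | |- deterministic_frag (clear _) => exact: deterministic_clear
  | |- deterministic_frag (split_pair _ _) => exact: deterministic_split_pair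
  | |- deterministic_frag (mkpair _ _ _) => exact: deterministic_mkpair
  | |- deterministic_frag (call _ _ _ _ _ _ _) => exact: deterministic_call
  | |- deterministic_frag (emb _ _ _ _ _) => exact: deterministic_emb
  | |- deterministic_frag (pop _) => exact: deterministic_act1
  | |- deterministic_frag (skip _) => exact: deterministic_act1
  | |- deterministic_frag ?F => let h := head_of F in unfold h
  end.

Section Basic.
Variables (V G : finType).
Implicit Types (t : store V G) (i j : V).

Lemma split_pair_stk i j t u v : i != j -> t i = stk u -> t j = stk v ->
  ends (split_pair i j) t [::] (6 * size u + 3)
    (upd (upd t i (stk (snd_s u))) j (stk (rev (fst_s u) ++ v))).
Proof.
move=> ij ti tj; have := split_pair_ends ij ti isT tj.
by rewrite -str_cat -!stkE.
Qed.

Lemma clear_stk i t u : t i = stk u ->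
  ends (clear i) t [::] (2 * size u + 1) (upd t i (stk [::])).
Proof. by move=> ti; apply: clear_ends ti isT. Qed.

Lemma push_stk i b t u : t i = stk u ->
  ends (push i b) t [::] 2 (upd t i (stk (b :: u))).
Proof. exact: push_ends. Qed.

Lemma pop_stk i t b u : t i = stk (b :: u) ->
  ends (pop i) t [::] 1 (upd t i (stk u)).
Proof. exact: pop_blank_ends. Qed.

Lemma bit_at_stk i t u : t i = stk u -> bit_at i (look t) = (u != [::]).
Proof. by move=> ti; rewrite (bit_atE ti); case: u ti. Qed.

Lemma look_stk i t u : t i = stk u -> look t i = (if u is b :: _ then bit b else None).
Proof. by rewrite /look => ->; case: u. Qed.

Definition carry i j : frag V G :=
  whilef (fun r => r i == bit true) (seqf (pop i) (push j false)).

(** [a] counts the leading ones, and [u'] is what follows them. If [u'] is empty the number was all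
    ones, and the increment wraps around to zeros. *)
Lemma carry_ends i j t u v : i != j -> t i = stk u -> t j = stk v ->
  exists a, exists2 u', size u' + a <= size u /\
      inc u = nseq a false ++ (if u' is _ :: u'' then true :: u'' else [::]) &
    ends (carry i j) t [::] (4 * size u + 1)
      (upd (upd t i (stk u')) j (stk (nseq a false ++ v))).
Proof.
move=> ij; have ji : j != i by rewrite eq_sym.
elim: u t v => [|b u IHu] t v ti tj.
  exists 0, [::]; first by [].
  rewrite /= -ti -tj !upd_id; apply: whilef_stop; by rewrite (look_stk ti).
case: b ti => ti; last first.
  exists 0, (false :: u); first by rewrite addn0.
  rewrite /= -ti -tj !upd_id; apply: ends_le (whilef_stop _ _) _; last by lia.
  by rewrite (look_stk ti).
have E1 := pop_stk ti; have E2 := push_stk false (etrans (upd_ne _ _ ji) tj).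
have [] := IHu (upd (upd t i (stk u)) j (stk (false :: v))) (false :: v).
- by rewrite upd_ne // upd_eq.
- by rewrite upd_eq.
move=> a [u' [le inc_u] E3]; exists a.+1, u'.
  by rewrite /= inc_u; split=> //; lia.
have ct : look t i == bit true by rewrite (look_stk ti).
have := whilef_step (b := fun r => r i == bit true) ct (seqf_ends E1 (E2 _)) E3.
move=> E; apply: (@ends_le _ _ _ _ _ (1 + 2 + (4 * size u + 1)).+1); last by rewrite /=; lia.
have -> : nseq a.+1 false ++ v = nseq a false ++ false :: v by elim: (a) => //= ? ->.
by move: E; congr (ends _ _ _ _ _); upd_ext.
Qed.

Definition strip_common i j : frag V G :=
  whilef (fun r => bit_at i r && (r i == r j)) (seqf (pop i) (pop j)).

Lemma strip_common_ends i j t u v : i != j -> t i = stk u -> t j = stk v ->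
  exists u' v' : string, [/\ size u' <= size u, (u == v) = (u' == [::]) && (v' == [::]) &
    ends (strip_common i j) t [::] (3 * size u + 1)
      (upd (upd t i (stk u')) j (stk v'))].
Proof.
move=> ij; have ji : j != i by rewrite eq_sym.
elim: u v t => [|b u IHu] v t ti tj.
  exists [::], v; split=> //.
  rewrite -ti -tj !upd_id; apply: whilef_stop; by rewrite (bit_at_stk ti).
case: (boolP (look t i == look t j)) => [eqij|neij]; last first.
  exists (b :: u), v; split=> //.
    apply/negbTE; apply: contra neij => /eqP e.
    by rewrite (look_stk ti) (look_stk tj) -e.
  rewrite -ti -tj !upd_id; apply: ends_le (whilef_stop _ _) _; last by rewrite /=; lia.
  by rewrite (negbTE neij) andbF.
move: (eqij); rewrite (look_stk ti) (look_stk tj).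
case: v tj => [//|c v] tj /eqP[eb]; subst c.
have E1 := pop_stk ti; have E2 := pop_stk (etrans (upd_ne _ _ ji) tj).
have [||u' [v' [le e E3]]] := IHu v (upd (upd t i (stk u)) j (stk v)).
- by rewrite upd_ne // upd_eq.
- by rewrite upd_eq.
exists u', v'; split; [exact: leqW | by rewrite eqseq_cons eqxx |].
have ct : bit_at i (look t) && (look t i == look t j) by rewrite eqij (bit_at_stk ti).
have := whilef_step (b := fun r => bit_at i r && (r i == r j)) ct (seqf_ends E1 (E2 _)) E3.
move=> E; apply: (@ends_le _ _ _ _ _ (1 + 1 + (3 * size u + 1)).+1); last by rewrite /=; lia.
by move: E; congr (ends _ _ _ _ _); upd_ext.
Qed.

(** Multiplication in unary: every bit on [i] adds as many ones to [l] as [j] has bits, while [k]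
    keeps the contents of [j], reversed, until they are moved back. It serves to evaluate
    polynomials by Horner's rule. *)
Definition mul_loop i j k l : frag V G :=
  whilef (bit_at i) (seqf (pop i) (seqf (dup (fun=> true) j k l) (shift id k j))).

Lemma mul_loop_ends i j k l t u v n : uniq [:: i; j; k; l] ->
  t i = stk u -> t j = stk v -> t k = stk [::] -> t l = stk (nseq n true) ->
  ends (mul_loop i j k l) t [::] (size u * (10 * size v + 4) + 1)
    (upd (upd t i (stk [::])) l (stk (nseq (size u * size v + n) true))).
Proof.
rewrite /= !inE !negb_or andbT => /and3P[/and3P[ij ik il] /andP[jk jl] kl].
have [ji ki li] : [/\ j != i, k != i & l != i] by split; rewrite eq_sym.
have [kj lj lk] : [/\ k != j, l != j & l != k] by split; rewrite eq_sym.
elim: u n t => [|b u IHu] n t ti tj tk tl.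
  rewrite -{1}ti upd_id /= mul0n -tl upd_id; apply: whilef_stop.
  by rewrite (bit_at_stk ti).
have E1 := pop_stk ti.
have dst : [&& j != k, j != l & k != l] by rewrite jk jl.
have E2 := dup_ends (fun=> true) dst (etrans (upd_ne _ _ ji) tj) isT
  (etrans (upd_ne _ _ ki) tk) (etrans (upd_ne _ _ li) tl).
have {E2} E2 := E2 (stk u).
set t2 := upd _ l _ in E2.
have t2k : t2 k = stk (rev v) by rewrite /t2 upd_ne // upd_eq.
have t2j : t2 j = stk [::] by rewrite /t2 !(upd_eq, upd_ne).
have E3 := shift_stk kj t2k t2j; rewrite revK cats0 size_rev in E3.
set t3 := upd _ j _ in E3.
have tt m : map (fun=> true) (rev m) ++ nseq n true = nseq (size m + n) true :> string.
  by rewrite nseqD -size_rev; congr (_ ++ _); elim: (rev m) => //= ? ? ->.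
have t3l : t3 l = stk (nseq (size v + n) true).
  by rewrite /t3 !(upd_eq, upd_ne) // /t2 upd_eq -str_cat -map_rev tt.
have := IHu (size v + n) t3.
have -> : t3 i = stk u by rewrite /t3 /t2 !(upd_eq, upd_ne).
have -> : t3 j = stk v by rewrite /t3 !(upd_eq, upd_ne).
have -> : t3 k = stk [::] by rewrite /t3 !(upd_eq, upd_ne).
move=> /(_ erefl erefl erefl t3l) E4.
have bt : bit_at i (look t) by rewrite (bit_at_stk ti).
have E := whilef_step bt (seqf_ends E1 (seqf_ends E2 E3)) E4.
have -> : size (b :: u) * size v + n = size u * size v + (size v + n).
  by rewrite /= mulSn addnCA addnA.
have le : (1 + (6 * size v + 1 + (4 * size v + 1)) + (size u * (10 * size v + 4) + 1)).+1
    <= size (b :: u) * (10 * size v + 4) + 1.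
  rewrite (_ : size (b :: u) = (size u).+1) // mulSn; move: (size u * (10 * size v + 4)) (size v) => m a.
  clear; lia.
rewrite [upd _ l _](_ : _ = upd (upd t3 i (stk [::])) l
  (stk (nseq (size u * size v + (size v + n)) true))); first exact: ends_le E le.
apply/funext => a; rewrite /t3 /t2 /upd.
case: (eqVneq a l) => // al; case: (eqVneq a i) => // ai.
case: (eqVneq a j) => [->|aj]; first by rewrite tj.
by case: (eqVneq a k) => [->|//]; rewrite tk.
Qed.

End Basic.

Arguments carry {V G}.
Arguments strip_common {V G}.
Arguments mul_loop {V G}.

Lemma FPt_fst : FPt fst_s.
Proof.
pose F : frag ('I_3 + void)%type void := seqf (split_pair tp0 tp1) (seqf (clear tp0) (shift id tp1 tp0)).
apply: (@frag_FPt_stk _ _ F (fun n => 12 * n + 5)) => [||x]; [by det_tac | by pbound_tac|].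
have E1 := @split_pair_stk _ _ tp0 tp1 (input_store [:: x] : store ('I_3 + void)%type void) x [::]
  isT erefl erefl.
rewrite cats0 in E1; set t1 := upd _ tp1 _ in E1.
have E2 := @clear_stk _ _ tp0 t1 (snd_s x) erefl.
have E3 := @shift_stk _ _ tp1 tp0 (upd t1 tp0 (stk [::])) (rev (fst_s x)) [::] isT erefl erefl.
rewrite revK cats0 in E3.
eexists; first apply: ends_le (seqf_ends E1 (seqf_ends E2 E3)) _; last by rewrite upd_eq.
by rewrite size_rev; have := size_unpair x; clear; lia.
Qed.

Lemma FPt_snd : FPt snd_s.
Proof.
pose F : frag ('I_3 + void)%type void := split_pair tp0 tp1.
apply: (@frag_FPt_stk _ _ F (fun n => 6 * n + 3)) => [||x]; [by det_tac | by pbound_tac|].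
have E1 := @split_pair_stk _ _ tp0 tp1 (input_store [:: x] : store ('I_3 + void)%type void) x [::]
  isT erefl erefl.
by eexists; first exact: E1.
Qed.

Lemma FPt_cons b : FPt (cons b).
Proof.
pose F : frag ('I_3 + void)%type void := push tp0 b.
apply: (@frag_FPt_stk _ _ F (fun n => 2)) => [||x]; [by det_tac | by pbound_tac|].
eexists; first by apply: push_stk.
by rewrite upd_eq.
Qed.

Lemma FPt_nil : FPt (fun=> [::]).
Proof.
pose F : frag ('I_3 + void)%type void := clear tp0.
apply: (@frag_FPt_stk _ _ F (fun n => 2 * n + 1)) => [||x]; [by det_tac | by pbound_tac|].
eexists; first by apply: clear_stk.
by rewrite upd_eq.
Qed.

Lemma FPt_behead : FPt behead.
Proof.
pose F : frag ('I_3 + void)%type void := iff_ (bit_at tp0) (pop tp0) (skip tp0).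
apply: (@frag_FPt_stk _ _ F (fun n => 2)) => [||[|b x]]; [by det_tac | by pbound_tac| |].
  by eexists; first by apply: iff_ends; apply: skip_ends.
eexists; first by apply: iff_ends; apply: (@pop_stk _ _ tp0 _ b x).
by rewrite upd_eq.
Qed.

Lemma FPt_map g : FPt (map g).
Proof.
pose F : frag ('I_3 + void)%type void := seqf (shift g tp0 tp1) (shift id tp1 tp0).
apply: (@frag_FPt_stk _ _ F (fun n => 8 * n + 2)) => [||x]; [by det_tac | by pbound_tac|].
have E1 := @shift_ends _ _ g tp0 tp1 (input_store [:: x] : store ('I_3 + void)%type void)
  (@blank _) x (@blank _) (@blank _) isT erefl isT erefl.
rewrite nones_blank -!stkE in E1; set t1 := upd _ tp1 _ in E1.
have E2 := @shift_stk _ _ tp1 tp0 t1 (rev (map g x)) [::] isT erefl erefl.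
rewrite revK cats0 size_rev size_map in E2.
eexists; first apply: ends_le (seqf_ends E1 E2) _; last by rewrite upd_eq.
by clear; lia.
Qed.

Lemma FPt_inc : FPt inc.
Proof.
pose F : frag ('I_3 + void)%type void := seqf (carry tp0 tp1)
  (seqf (iff_ (bit_at tp0) (seqf (pop tp0) (push tp0 true)) (skip tp0)) (shift id tp1 tp0)).
apply: (@frag_FPt_stk _ _ F (fun n => 8 * n + 6)) => [||x]; [| by pbound_tac|].
  by det_tac.
have [a [u [le incx]]] := @carry_ends _ _ tp0 tp1
  (input_store [:: x] : store ('I_3 + void)%type void) x [::] isT erefl erefl.
rewrite cats0; set t1 := upd _ tp1 _ => E1.
have E2 w t : t tp0 = stk w ->
  ends (iff_ (bit_at tp0) (seqf (pop tp0) (push tp0 true)) (skip tp0) : frag _ void) t [::] 4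
    (upd t tp0 (stk (if w is _ :: w' then true :: w' else [::]))).
  move=> tw; apply: iff_ends; rewrite (bit_at_stk tw); case: w tw => [|b w] tw /=.
    by rewrite -tw upd_id; apply: ends_le (skip_ends _ _) _.
  have := seqf_ends (pop_stk tw) (push_stk true (upd_eq _ _ _)).
  by rewrite upd_upd.
have {}E2 := E2 _ _ u t1 erefl; set v := (X in stk X) in E2; rewrite -/v in incx.
have := @shift_stk _ _ tp1 tp0 (upd t1 tp0 (stk v)) (nseq a false) v isT erefl erefl.
rewrite size_nseq => E3.
eexists; first apply: ends_le (seqf_ends E1 (seqf_ends E2 E3)) _.
  by move: le; clear; lia.
by rewrite upd_eq incx rev_nseq.
Qed.

Definition eq_test (s : string) : string := [:: fst_s s == snd_s s].

Lemma FPt_eq : FPt eq_test.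
Proof.
pose F : frag ('I_3 + void)%type void := seqf (split_pair tp0 tp1) (seqf (shift id tp1 tp2)
  (seqf (strip_common tp0 tp2)
    (iff_ (fun r => ~~ bit_at tp0 r && ~~ bit_at tp2 r) (push tp0 true)
       (seqf (clear tp0) (push tp0 false))))).
apply: (@frag_FPt_stk _ _ F (fun n => 15 * n + 9)) => [||x]; [| by pbound_tac|].
  by det_tac.
have E1 := @split_pair_stk _ _ tp0 tp1 (input_store [:: x] : store ('I_3 + void)%type void) x [::]
  isT erefl erefl.
rewrite cats0 in E1; set t1 := upd _ tp1 _ in E1.
have E2 := @shift_stk _ _ tp1 tp2 t1 (rev (fst_s x)) [::] isT erefl erefl.
rewrite revK cats0 size_rev in E2; set t2 := upd _ tp2 _ in E2.
have [u [v [le e E3]]] := @strip_common_ends _ _ tp0 tp2 t2 (snd_s x) (fst_s x) isT erefl erefl.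
set t3 := upd _ tp2 _ in E3.
have E4 : exists2 t4, ends (iff_ (fun r => ~~ bit_at tp0 r && ~~ bit_at tp2 r) (push tp0 true)
       (seqf (clear tp0) (push tp0 false))) t3 [::] (2 * size u + 4) t4 & t4 tp0 = stk (eq_test x).
  exists (upd t3 tp0 (stk (eq_test x))); last by rewrite upd_eq.
  have -> : 2 * size u + 4 = (2 * size u + 3).+1 by clear; lia.
  apply: iff_ends; rewrite /eq_test eq_sym e.
  rewrite (@bit_at_stk _ _ tp0 t3 u erefl) (@bit_at_stk _ _ tp2 t3 v erefl) !negbK.
  case: (boolP ((u == [::]) && (v == [::]))) => [/andP[/eqP u0 _]|_].
    apply: ends_le (@push_stk _ _ tp0 true t3 [::] _) _; last by clear; lia.
    by rewrite /t3 u0.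
  have := seqf_ends (@clear_stk _ _ tp0 t3 u erefl) (push_stk false (upd_eq _ _ _)).
  by rewrite upd_upd => E; apply: ends_le E _; clear; lia.
have [t4 {}E4 t40] := E4; exists t4 => //.
apply: ends_le (seqf_ends E1 (seqf_ends E2 (seqf_ends E3 E4))) _.
by have := size_unpair x; move: le; clear; lia.
Qed.

Definition ite_fun (s : string) : string :=
  if head false (fst_s s) then fst_s (snd_s s) else snd_s (snd_s s).

Lemma FPt_ite : FPt ite_fun.
Proof.
pose F : frag ('I_3 + void)%type void := seqf (split_pair tp0 tp1) (seqf (shift id tp1 tp2)
  (iff_ (fun r => r tp2 == bit true)
     (seqf (split_pair tp0 tp1) (seqf (clear tp0) (shift id tp1 tp0)))
     (split_pair tp0 tp1))).
apply: (@frag_FPt_stk _ _ F (fun n => 22 * n + 10)) => [||x]; [by det_tac| by pbound_tac|].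
have E1 := @split_pair_stk _ _ tp0 tp1 (input_store [:: x] : store ('I_3 + void)%type void) x [::]
  isT erefl erefl.
rewrite cats0 in E1; set t1 := upd _ tp1 _ in E1.
have E2 := @shift_stk _ _ tp1 tp2 t1 (rev (fst_s x)) [::] isT erefl erefl.
rewrite revK cats0 size_rev in E2; set t2 := upd _ tp2 _ in E2.
have E3 := @split_pair_stk _ _ tp0 tp1 t2 (snd_s x) [::] isT erefl erefl.
rewrite cats0 in E3; set t3 := upd _ tp1 _ in E3.
have E4 := @clear_stk _ _ tp0 t3 (snd_s (snd_s x)) erefl.
have E5 := @shift_stk _ _ tp1 tp0 (upd t3 tp0 (stk [::])) (rev (fst_s (snd_s x))) [::]
  isT erefl erefl.
rewrite revK cats0 size_rev in E5.
have sz1 := size_unpair x; have sz2 := size_unpair (snd_s x).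
have l2 : (look t2 tp2 == bit true) = head false (fst_s x).
  by rewrite (@look_stk _ _ tp2 t2 (fst_s x) erefl); case: (fst_s x) => [|[]].
have E6 : exists2 t6, ends (iff_ (fun r => r tp2 == bit true)
     (seqf (split_pair tp0 tp1) (seqf (clear tp0) (shift id tp1 tp0)))
     (split_pair tp0 tp1)) t2 [::] (12 * size x + 6) t6 & t6 tp0 = stk (ite_fun x).
  rewrite /ite_fun; case h: head.
    exists (upd (upd (upd t3 tp0 (stk [::])) tp1 (stk [::])) tp0 (stk (fst_s (snd_s x))));
      last by rewrite upd_eq.
    apply: (ends_le (B := (12 * size x + 5).+1)); last by clear; lia.
    apply: iff_ends; rewrite l2 h; apply: ends_le (seqf_ends E3 (seqf_ends E4 E5)) _.
    by move: sz1 sz2; clear; lia.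
  exists t3 => //; apply: (ends_le (B := (12 * size x + 5).+1)); last by clear; lia.
  apply: iff_ends; rewrite l2 h; apply: ends_le E3 _.
  by move: sz1 sz2; clear; lia.
have [t6 {}E6 t60] := E6; exists t6 => //.
apply: ends_le (seqf_ends E1 (seqf_ends E2 E6)) _.
by move: sz1; clear; lia.
Qed.

Definition ones_mul (s : string) : string := nseq (size (fst_s s) * size (snd_s s)) true.

Lemma FPt_mul : FPt ones_mul.
Proof.
pose tp3 : ('I_3 + unit)%type := inr tt.
pose F : frag ('I_3 + unit)%type void := seqf (split_pair tp0 tp1)
  (seqf (mul_loop tp1 tp0 tp2 tp3) (seqf (clear tp0) (shift id tp3 tp0))).
apply: (@frag_FPt_stk _ _ F (fun n => 6 * n + 3 + (n * (10 * n + 4) + 1 + (2 * n + 1 +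
  (4 * (n * n) + 1))))) => [||x]; [| by pbound_tac|].
  by det_tac.
have E1 := @split_pair_stk _ _ tp0 tp1 (input_store [:: x] : store ('I_3 + unit)%type void) x [::]
  isT erefl erefl.
rewrite cats0 in E1; set t1 := upd _ tp1 _ in E1.
have E2 := @mul_loop_ends _ _ tp1 tp0 tp2 tp3 t1 (rev (fst_s x)) (snd_s x) 0
  isT erefl erefl erefl erefl.
rewrite size_rev addn0 in E2; set t2 := upd _ tp3 _ in E2.
have E3 := @clear_stk _ _ tp0 t2 (snd_s x) erefl.
have := @shift_stk _ _ tp3 tp0 (upd t2 tp0 (stk [::])) (ones_mul x) [::] isT erefl erefl.
rewrite cats0 size_nseq => E4.
exists (upd (upd (upd t2 tp0 (stk [::])) tp3 (stk [::])) tp0 (stk (rev (ones_mul x))));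
  last by rewrite upd_eq /ones_mul rev_nseq.
apply: ends_le (seqf_ends E1 (seqf_ends E2 (seqf_ends E3 E4))) _.
have sz : size (fst_s x) <= size x /\ size (snd_s x) <= size x.
  by have := size_unpair x; clear; lia.
have [sz1 sz2] := sz; apply: leq_add => //; apply: leq_add.
  by rewrite leq_add2r; apply: leq_mul => //; move: sz2; clear; lia.
apply: leq_add; first by move: sz2; clear; lia.
by rewrite leq_add2r leq_mul2l /=; apply: leq_mul.
Qed.
(** * Composition, pairing and conversions between machines and functions *)

Definition inl_inv (A B : Type) (x : A + B) : option A := if x is inl a then Some a else None.
Definition inr_inv (A B : Type) (x : A + B) : option B := if x is inr b then Some b else None.

Lemma inl_invK A B : pcancel inl (@inl_inv A B). Proof. by []. Qed.
Lemma inr_invK A B : pcancel inr (@inr_inv A B). Proof. by []. Qed.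

Section TwoMachines.
Variables (M N : machine) (BM BN : nat -> nat) (f g : string -> string).
Hypotheses (cM : computes M BM f) (cN : computes N BN g).

(** Both machines get separate tapes and separate halves of the auxiliary alphabet, because a call
    does not clean up. The guess tape can be shared: a deterministic computation leaves it empty. *)
Definition vars2 : finType := ('I_3 + ('I_2 + ('I_(work M).+1 + 'I_(work N).+1)))%type.
Definition aux2 : finType := (aux M + aux N)%type.
Definition guess_tp : vars2 := inr (inl ord0).
Definition flag_tp : vars2 := inr (inl (@Ordinal 2 1 isT)).
Definition tau1 (m : 'I_(work M).+1) : vars2 := inr (inr (inl m)).
Definition tau2 (m : 'I_(work N).+1) : vars2 := inr (inr (inr m)).

Definition call1 (i k : vars2) : frag vars2 aux2 :=
  call tau1 inl (@inl_inv _ _) guess_tp flag_tp i k.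
Definition call2 (i k : vars2) : frag vars2 aux2 :=
  call tau2 inr (@inr_inv _ _) guess_tp flag_tp i k.

Definition is_user (i : vars2) : bool := if i is inl _ then true else false.

Lemma call1_ends i k (t : store vars2 aux2) x : is_user i -> is_user k -> i != k ->
  (forall m, t (tau1 m) = stk [::]) -> t guess_tp = stk [::] ->
  t i = stk x -> t k = stk [::] ->
  exists2 t', ends (call1 i k) t [::] (8 * size x + 9 * BM (size x) + 4) t' &
    [/\ t' i = stk (f x), t' guess_tp = stk [::], forall j, is_user j -> j != i -> t' j = t j &
        forall m, t' (tau2 m) = t (tau2 m)].
Proof.
case: i => // i _; case: k => // k _ ik tt tg ti tk.
have dist : uniq [:: guess_tp; flag_tp; inl i; inl k] by rewrite /= !inE ik.
have [t' E [t'i t'o]] := call_ends cM (tau := tau1) (gam := inl) (mag := @inl_inv _ (aux N))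
  (inj_comp (@inr_inj _ _) (inj_comp (@inr_inj _ _) (@inl_inj _ _))) (@inl_invK _ _)
  (gt := guess_tp) (fl := flag_tp) (i := inl i) (k := inl k)
  (fun _ => isT) dist tt tg ti tk.
by exists t' => //; split=> // [|[j|] // _ ji|m]; rewrite t'o // tg.
Qed.

Lemma call2_ends i k (t : store vars2 aux2) x : is_user i -> is_user k -> i != k ->
  (forall m, t (tau2 m) = stk [::]) -> t guess_tp = stk [::] ->
  t i = stk x -> t k = stk [::] ->
  exists2 t', ends (call2 i k) t [::] (8 * size x + 9 * BN (size x) + 4) t' &
    t' i = stk (g x) /\ forall j, is_user j -> j != i -> t' j = t j.
Proof.
case: i => // i _; case: k => // k _ ik tt tg ti tk.
have dist : uniq [:: guess_tp; flag_tp; inl i; inl k] by rewrite /= !inE ik.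
have [t' E [t'i t'o]] := call_ends cN (tau := tau2) (gam := inr) (mag := @inr_inv (aux M) _)
  (inj_comp (@inr_inj _ _) (inj_comp (@inr_inj _ _) (@inr_inj _ _))) (@inr_invK _ _)
  (gt := guess_tp) (fl := flag_tp) (i := inl i) (k := inl k)
  (fun _ => isT) dist tt tg ti tk.
by exists t' => //; split=> // -[j|] // _ ji; rewrite t'o.
Qed.

Lemma computes_comp : FPt (fun x => g (f x)).
Proof.
have [pM _ szM _] := cM; have [pN monoN _ _] := cN.
apply: (@frag_FPt_stk _ _ (seqf (call1 tp0 tp1) (call2 tp0 tp1))
  (fun n => 8 * n + 9 * BM n + 4 + (8 * BM n + 9 * BN (BM n) + 4))) => [||x].
- by det_tac.
- by pbound_tac.
have [t1 E1 [t10 t1g t1u t1t]] :=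
  @call1_ends tp0 tp1 (input_store [:: x]) x isT isT isT (fun=> erefl) erefl erefl erefl.
have [||t2 E2 [t20 _]] := @call2_ends tp0 tp1 t1 (f x) isT isT isT _ t1g t10.
- by move=> m; rewrite t1t.
- by rewrite t1u.
exists t2 => //; apply: ends_le (seqf_ends E1 E2) _.
by have := szM x; have := monoN _ _ (szM x); clear; lia.
Qed.

Lemma computes_bpair : FPt (fun x => bpair (f x) (g x)).
Proof.
have [pM _ szM _] := cM; have [pN monoN _ _] := cN.
pose F := seqf (seqf (shift id tp0 tp1) (dup id tp1 tp0 tp2))
  (seqf (call1 tp0 tp1) (seqf (call2 tp2 tp1)
     (seqf (mkpair tp0 tp2 tp1) (seqf (shift id tp2 tp1) (shift id tp1 tp0))))).
apply: (@frag_FPt_stk _ _ F (fun n => 10 * n + 2 + (8 * n + 9 * BM n + 4 +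
   (8 * n + 9 * BN n + 4 + (10 * BM n + 4 + (16 * BM n + 8 * BN n + 10)))))) => [||x].
- by det_tac.
- by pbound_tac.
have E1 := @shift_stk vars2 aux2 tp0 tp1 (input_store [:: x]) x [::] isT erefl erefl.
rewrite cats0 in E1; set t1 := upd _ tp1 _ in E1.
have E2 := @dup_ends vars2 aux2 id tp1 tp0 tp2 t1 (rev x) (@blank _) (@blank _) (@blank _)
  isT erefl isT erefl erefl.
rewrite map_id revK size_rev -!stkE in E2; set t2 := upd _ tp2 _ in E2.
have [t3 E3 [t30 t3g t3u t3t]] :=
  @call1_ends tp0 tp1 t2 x isT isT isT (fun=> erefl) erefl erefl erefl.
have [|||t4 E4 [t42 t4u]] := @call2_ends tp2 tp1 t3 x isT isT isT _ t3g _ _.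
- by move=> m; rewrite t3t.
- by rewrite t3u.
- by rewrite t3u.
have t40 : t4 tp0 = stk (f x) by rewrite t4u.
have t41 : t4 tp1 = stk [::] by rewrite t4u // t3u.
have E5 := @mkpair_ends vars2 aux2 tp0 tp2 tp1 t4 (f x) (g x) isT t40 t42 t41.
set t5 := upd _ tp2 _ in E5.
have E6 := @shift_stk vars2 aux2 tp2 tp1 t5 (bpair (f x) (g x)) [::] isT erefl t41.
rewrite cats0 in E6; set t6 := upd _ tp1 _ in E6.
have E7 := @shift_stk vars2 aux2 tp1 tp0 t6 (rev (bpair (f x) (g x))) [::] isT erefl erefl.
rewrite revK cats0 size_rev in E7.
eexists; first apply: ends_le (seqf_ends (seqf_ends E1 E2)
  (seqf_ends E3 (seqf_ends E4 (seqf_ends E5 (seqf_ends E6 E7))))) _; last by rewrite upd_eq.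
have [_ _ szN _] := cN.
by rewrite size_pair -!muln2; have := szM x; have := szN x; clear; lia.
Qed.

End TwoMachines.

Lemma FPt_comp f g : FPt f -> FPt g -> FPt (fun x => f (g x)).
Proof.
by move=> /FPt_computes[M [B cM]] /FPt_computes[N [C cN]]; exact: computes_comp cN cM.
Qed.

Lemma FPt_bpair f g : FPt f -> FPt g -> FPt (fun x => bpair (f x) (g x)).
Proof.
by move=> /FPt_computes[M [B cM]] /FPt_computes[N [C cN]]; exact: computes_bpair cM cN.
Qed.

(** * Predicates decided by machines, and machines that check predicates *)

Lemma reach_guess_bit M (c : config M) w n d g b : reach c w n d -> instr_at d = Guess g ->
  exists d', reach c (w ++ [:: b]) n.+1 d'.
Proof.
elim=> {c w n d} [c|c a w n d Hc _ IH|c g' b' w n d Hc _ IH] Hd.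
- by eexists; apply: reach_guess Hd (reach_nil _).
- by have [d' R] := IH Hd; exists d'; apply: reach_step Hc R.
- by have [d' R] := IH Hd; exists d'; apply: reach_guess Hc R.
Qed.

Section EmbeddingAccepts.
Variables (V G : finType) (M : machine) (k : nat).
Variables (tau : 'I_(work M).+1 -> V) (gam : aux M -> G) (mag : G -> option (aux M)).
Hypotheses (tau_inj : injective tau) (gamK : pcancel gam mag).
Variables (gt fl : V).
Hypotheses (tau_gt : forall i, tau i != gt) (tau_fl : forall i, tau i != fl)
  (gt_fl : gt != fl).
Hypothesis ptM : polytime k M.

(** Whatever string [u] is supplied, [polytime_runs] says how [emb] stops, and the flag agrees with
    acceptance along exactly [u]: leftover bits and missing bits both mean that [u] is not the guess
    string of a complete path. *)
Lemma emb_accepts : exists2 B, pbound B & forall (t : store V G) xs u, size xs = k ->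
  (forall i : 'I_(work M).+1, t (tau i) = stk (nth [::] xs i)) ->
  t gt = stk u -> t fl = stk [::] ->
  exists2 t', ends (emb tau gam mag gt fl) t [::] (B (sumn [seq size x | x <- xs])) t' &
    t' fl = stk [:: `[< accepts_along M xs u >]] /\
    forall j, (forall i, tau i != j) -> j != gt -> j != fl -> t' j = t j.
Proof.
have [q hq] := ptM; exists (fun n => q.[n]%R + 1).
  by apply: pbound_add (pbound_poly q) (pbound_const 1).
move=> t xs u szx ti tgt tfl.
have [w [u' [n [d [eu R Hd]]]]] := polytime_runs ptM szx u.
have le : n.+1 <= q.[sumn [seq size x | x <- xs]]%R + 1 by rewrite addn1; exact: hq R.
have init_t : upd (emb_store tau gam t (init M xs)) gt (stk u) = t.
  by rewrite (emb_store_init _ ti) -tgt upd_id.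
have frame (c : config M) a b j : (forall i, tau i != j) -> j != gt -> j != fl ->
    upd (upd (emb_store tau gam t c) gt a) fl b j = t j.
  by move=> jt jg jf; rewrite !upd_ne // emb_store_out.
case: Hd => [[v Hv]|[u'0 [g Hg]]].
- have := emb_run tau_inj gamK tau_gt tau_fl gt_fl t u' R Hv.
  rewrite -eu init_t => R'; eexists; first by exists n.+1; [exact: le | exact: R'].
  split; last by move=> j *; apply: frame.
  rewrite upd_eq tfl; congr (_, scons (bit _) _).
  apply/idP/asboolP => [/andP[vt /eqP u'0]|[d' [[n' Rd'] Hd'] acc_d']].
    rewrite eu u'0 cats0; exists d; last by rewrite Hv vt.
    by split; [exists n | exists v].
  have [|_ [z wz]] := reach_prefix R (ex_intro _ _ Hv) Rd'; first by exists u', [::]; rewrite cats0.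
  have u'0 : u' = [::].
    by apply/size0nil; have := congr1 size wz; rewrite eu !size_cat; clear; lia.
  rewrite u'0 cats0 in eu; rewrite u'0 eqxx andbT; rewrite -eu in R.
  have dd := reach_unique R (ex_intro _ _ Hv) Rd' Hd'.
  by move: acc_d'; rewrite -dd Hv => -[].
- rewrite u'0 cats0 in eu; subst w.
  have := emb_run_short tau_inj gamK tau_gt tau_fl gt_fl t R Hg.
  rewrite init_t => R'; eexists; first by exists n.+1; [exact: le | exact: R'].
  split; last by move=> j *; apply: frame.
  rewrite upd_eq tfl; congr (_, scons (bit _) _).
  apply/esym/asboolP => -[d' [[n' Rd'] Hd'] _].
  (* [M] still wants a bit after [u]. Feeding it one gives a computation that properly prolongs the
     alleged halting one along [u], against [reach_prefix]. *)
  have [d2 R2] := reach_guess_bit true R Hg.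
  have [|_ [z]] := reach_prefix Rd' Hd' R2; first by exists [:: true], [::]; rewrite cats0.
  by move/(congr1 size); rewrite !size_cat /=; clear; lia.
Qed.

End EmbeddingAccepts.

(** A predicate is represented by its one-bit characteristic function, so that closure properties
    reduce to composition and pairing of functions. *)
Definition PP (Q : string -> bool) : Prop := FPt (fun s => [:: Q s]).

Lemma PP_pred3 P : polytime_pred3 P ->
  PP (fun s => P (fst_s s) (fst_s (snd_s s)) (snd_s (snd_s s))).
Proof.
move=> [M [_ ptM MP]].
(* [M] may have fewer than three tapes, in which case [init] drops the surplus arguments. The two
   spare buffers receive them and then lie outside the range of [tau]. *)
pose X := ('I_2 + 'I_(work M).+3)%type; pose V := ('I_3 + X)%type.
have lew : (work M).+1 <= (work M).+3 by rewrite ltnS leqW.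
pose tau (m : 'I_(work M).+1) : V := inr (inr (widen_ord lew m)).
pose gt : V := inr (inl ord0); pose fl : V := inr (inl (@Ordinal 2 1 isT)).
pose b0 : V := inr (inr (@Ordinal (work M).+3 0 isT)).
pose b1 : V := inr (inr (@Ordinal (work M).+3 1 isT)).
pose b2 : V := inr (inr (@Ordinal (work M).+3 2 isT)).
have tau_inj : injective tau by move=> m m' [] /val_inj.
have someK : pcancel (@id (aux M)) Some by [].
have [B pB E] := emb_accepts tau_inj someK (gt := gt) (fl := fl)
  (fun=> isT) (fun=> isT) isT ptM.
have [C [pC leC monoC]] := pbound_mono pB.
pose F : frag V (aux M) := seqf (split_pair tp0 tp1) (seqf (shift id tp1 b0)
  (seqf (split_pair tp0 tp1) (seqf (shift id tp1 b1)
  (seqf (shift id tp0 tp1) (seqf (shift id tp1 b2)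
  (seqf (emb tau id Some gt fl) (shift id fl tp0))))))).
apply: (@frag_FPt_stk X (aux M) F (fun n => 28 * n + 16 + C n)) => [||s];
  [by det_tac | by pbound_tac |].
set x := fst_s s; set y := fst_s (snd_s s); set z := snd_s (snd_s s).
have E1 := @split_pair_stk V (aux M) tp0 tp1 (input_store [:: s]) s [::] isT erefl erefl.
rewrite cats0 -/x in E1; set t1 := upd _ tp1 _ in E1.
have E2 := @shift_stk V (aux M) tp1 b0 t1 (rev x) [::] isT erefl erefl.
rewrite revK cats0 size_rev in E2; set t2 := upd _ b0 _ in E2.
have E3 := @split_pair_stk V (aux M) tp0 tp1 t2 (snd_s s) [::] isT erefl erefl.
rewrite cats0 -/y -/z in E3; set t3 := upd _ tp1 _ in E3.
have E4 := @shift_stk V (aux M) tp1 b1 t3 (rev y) [::] isT erefl erefl.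
rewrite revK cats0 size_rev in E4; set t4 := upd _ b1 _ in E4.
have E5 := @shift_stk V (aux M) tp0 tp1 t4 z [::] isT erefl erefl.
rewrite cats0 in E5; set t5 := upd _ tp1 _ in E5.
have E6 := @shift_stk V (aux M) tp1 b2 t5 (rev z) [::] isT erefl erefl.
rewrite revK cats0 size_rev in E6; set t6 := upd _ b2 _ in E6.
have t6tau (m : 'I_(work M).+1) : t6 (tau m) = stk (nth [::] [:: x; y; z] m).
  by case: m => [[|[|[|m]]] lt] //=; rewrite nth_nil.
have [t7 E7 [t7fl t7o]] := E t6 [:: x; y; z] [::] erefl t6tau erefl erefl.
have t70 : t7 tp0 = stk [::] by rewrite t7o.
have E8 := @shift_stk V (aux M) fl tp0 t7 _ [::] isT t7fl t70.
eexists; first apply: ends_le (seqf_ends E1 (seqf_ends E2 (seqf_ends E3 (seqf_ends E4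
  (seqf_ends E5 (seqf_ends E6 (seqf_ends E7 E8))))))) _.
- have : size x + (size y + size z) <= size s.
    by apply: leq_trans (size_unpair s); rewrite leq_add2l; apply: size_unpair.
  have := size_unpair s; rewrite -/x.
  have := leC (sumn [seq size x | x <- [:: x; y; z]]); rewrite /= addn0 => le1 le2 le3.
  have := monoC _ _ le3; move: le1 le2 le3; clear; lia.
- rewrite upd_eq; congr (stk [:: _]); apply/asboolP/idP => [|Pxyz]; first by move=> /MP.
  exact/MP.
Qed.

(** Once the path is part of the input, nondeterminism disappears: the guesses are read off a
    tape. *)
Lemma NPTM_PP M : NPTM M -> PP (fun s => `[< acc M (fst_s s) (snd_s s) >]).
Proof.
move=> ptM.
pose X := ('I_2 + 'I_(work M).+1)%type; pose V := ('I_3 + X)%type.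
pose tau (m : 'I_(work M).+1) : V := inr (inr m).
pose gt : V := inr (inl ord0); pose fl : V := inr (inl (@Ordinal 2 1 isT)).
pose b0 : V := inr (inr ord0).
have tau_inj : injective tau by move=> m m' [].
have someK : pcancel (@id (aux M)) Some by [].
have [B pB E] := emb_accepts tau_inj someK (gt := gt) (fl := fl)
  (fun=> isT) (fun=> isT) isT ptM.
have [C [pC leC monoC]] := pbound_mono pB.
pose F : frag V (aux M) := seqf (split_pair tp0 tp1) (seqf (shift id tp1 b0)
  (seqf (shift id tp0 tp1) (seqf (shift id tp1 gt)
  (seqf (emb tau id Some gt fl) (shift id fl tp0))))).
apply: (@frag_FPt_stk X (aux M) F (fun n => 18 * n + 11 + C n)) => [||s];
  [by det_tac | by pbound_tac |].
set x := fst_s s; set w := snd_s s.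
have E1 := @split_pair_stk V (aux M) tp0 tp1 (input_store [:: s]) s [::] isT erefl erefl.
rewrite cats0 -/x in E1; set t1 := upd _ tp1 _ in E1.
have E2 := @shift_stk V (aux M) tp1 b0 t1 (rev x) [::] isT erefl erefl.
rewrite revK cats0 size_rev in E2; set t2 := upd _ b0 _ in E2.
have E3 := @shift_stk V (aux M) tp0 tp1 t2 w [::] isT erefl erefl.
rewrite cats0 in E3; set t3 := upd _ tp1 _ in E3.
have E4 := @shift_stk V (aux M) tp1 gt t3 (rev w) [::] isT erefl erefl.
rewrite revK cats0 size_rev in E4; set t4 := upd _ gt _ in E4.
have t4tau (m : 'I_(work M).+1) : t4 (tau m) = stk (nth [::] [:: x] m).
  by case: m => [[|m] lt] //=; rewrite nth_nil.
have [t5 E5 [t5fl t5o]] := E t4 [:: x] w erefl t4tau erefl erefl.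
have t50 : t5 tp0 = stk [::] by rewrite t5o.
have E6 := @shift_stk V (aux M) fl tp0 t5 _ [::] isT t5fl t50.
eexists; first apply: ends_le (seqf_ends E1 (seqf_ends E2 (seqf_ends E3 (seqf_ends E4
  (seqf_ends E5 E6))))) _; last by rewrite upd_eq.
have le1 := size_unpair s; rewrite -/x -/w in le1.
have := leC (sumn [seq size x | x <- [:: x]]); rewrite /= addn0 => le2.
have := monoC _ _ (leq_trans (leq_addr _ _) le1); move: le1 le2; clear; lia.
Qed.

Lemma pred3_PP Q : PP Q -> polytime_pred3 (fun x y z => Q (bpair x (bpair y z))).
Proof.
move=> /FPt_computes[M [B cM]]; have [pB monoB _ _] := cM.
pose X := ('I_3 + 'I_(work M).+1)%type; pose V := ('I_3 + X)%type.
pose tau (m : 'I_(work M).+1) : V := inr (inr m).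
pose gt : V := inr (inl ord0); pose fl : V := inr (inl (@Ordinal 3 1 isT)).
pose tmp : V := inr (inl (@Ordinal 3 2 isT)).
have tau_inj : injective tau by move=> m m' [].
have someK : pcancel (@id (aux M)) Some by [].
pose F : frag V (aux M) := seqf (mkpair tp1 tp2 tmp) (seqf (mkpair tp0 tp2 tmp)
  (seqf (shift id tp2 tmp) (seqf (shift id tmp tp0) (call tau id Some gt fl tp0 tp1)))).
apply: (@frag_pred3 X (aux M) F (fun n => 42 * n + 46 + 9 * B (2 * n + 2))) => [||x y z].
- by det_tac.
- by pbound_tac.
pose s := bpair x (bpair y z).
have E1 := @mkpair_ends V (aux M) tp1 tp2 tmp (input_store [:: x; y; z]) y z isT
  erefl erefl erefl.
set t1 := upd _ tp2 _ in E1.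
have E2 := @mkpair_ends V (aux M) tp0 tp2 tmp t1 x (bpair y z) isT erefl erefl erefl.
rewrite -/s in E2; set t2 := upd _ tp2 _ in E2.
have E3 := @shift_stk V (aux M) tp2 tmp t2 s [::] isT erefl erefl.
rewrite cats0 in E3; set t3 := upd _ tmp _ in E3.
have E4 := @shift_stk V (aux M) tmp tp0 t3 (rev s) [::] isT erefl erefl.
rewrite revK cats0 size_rev in E4; set t4 := upd _ tp0 _ in E4.
have [t5 E5 [t50 _]] := @call_ends V (aux M) M B _ tau id Some cM tau_inj someK gt fl tp0 tp1
  (fun=> isT) isT t4 s (fun=> erefl) erefl erefl erefl.
exists t5; last by rewrite t50 /=; case: (Q s).
apply: ends_le (seqf_ends E1 (seqf_ends E2 (seqf_ends E3 (seqf_ends E4 E5)))) _.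
have szs : size s <= 2 * (size x + (size y + size z)) + 2.
  by rewrite /s !size_pair -!muln2; clear; lia.
have := monoB _ _ szs; move: szs; clear; lia.
Qed.

Definition guess_bit (V G : finType) (j : V) : frag V G :=
  seqf (act1 j (fun r => (r j, GoLeft)))
    (@Frag V G unit tt (fun _ r => FGuess (fun b =>
       (None, fun i => if i == j then (bit b, Stay) else nop r i)))).

Lemma guess_bit_ends (V G : finType) (j : V) b (t : store V G) u : t j = stk u ->
  ends (guess_bit G j) t [:: b] 2 (upd t j (stk (b :: u))).
Proof.
move=> tj; have E1 := act1_ends j (fun r => (r j, GoLeft)) t.
apply: (seqf_ends (w1 := [::]) (B1 := 1) (B2 := 1) E1).
exists 1 => //; apply: run_guess => //=.
set t1 := act _ _; set t2 := upd t j _; suff -> : t1 = t2 by apply: run_exit.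
apply/funext => i; rewrite /t1 /t2 /act /nop /look /upd.
case: eqP => _; first by rewrite tj /= stail_scons scons_stail.
by case: (t i) => l r /=; rewrite scons_stail.
Qed.

Definition guess_loop (V G : finType) (i j : V) : frag V G :=
  whilef (fun r => r i == bit true) (seqf (pop i) (guess_bit G j)).

Lemma guess_loop_ends (V G : finType) (i j : V) (t : store V G) w u v : i != j ->
  t i = stk (nseq (size w) true ++ false :: u) -> t j = stk v ->
  ends (guess_loop G i j) t w (4 * size w + 1)
    (upd (upd t i (stk (false :: u))) j (stk (rev w ++ v))).
Proof.
move=> ij; have ji : j != i by rewrite eq_sym.
elim: w t v => [|b w IHw] t v ti tj.
  by rewrite /= -ti -tj !upd_id; apply: whilef_stop; rewrite (look_stk ti).
pose t1 := upd t i (stk (nseq (size w) true ++ false :: u)).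
pose t2 := upd t1 j (stk (b :: v)).
have E1 : ends (pop i) t [::] 1 t1 by apply: pop_stk ti.
have E2 : ends (guess_bit G j) t1 [:: b] 2 t2.
  by apply: guess_bit_ends; rewrite /t1 upd_ne.
have ct : look t i == bit true by rewrite (look_stk ti).
have t2i : t2 i = stk (nseq (size w) true ++ false :: u) by rewrite /t2 upd_ne // /t1 upd_eq.
have E3 := IHw t2 (b :: v) t2i (upd_eq _ _ _).
have E := whilef_step (b := fun r => r i == bit true) ct (seqf_ends E1 E2) E3.
rewrite rev_cons cat_rcons [upd _ j _](_ : _ =
  upd (upd t2 i (stk (false :: u))) j (stk (rev w ++ b :: v))).
  by apply: ends_le E _; rewrite /=; clear; lia.
by rewrite /t2 /t1; upd_ext.
Qed.

Lemma dbl_nseq n : dbl (nseq n true) = nseq (n + n) true.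
Proof. by elim: n => //= n ->; rewrite addnS. Qed.

(* The pair of [1^q] and [x] is [1^2q 0 x]; its leading ones count the guesses,
   and what is left becomes the pair of the guessed string and [x]. *)
Lemma PP_NPTM Q (q : {poly nat}) : PP Q -> FPt (fun x => nseq q.[size x]%R true) ->
  exists M, [/\ NPTM M, balanced (q + q)%R M &
    forall x w, acc M x w <-> size w = (q + q).[size x]%R /\ Q (bpair w x)].
Proof.
move=> /FPt_computes[N [BN cN]] Fq.
have /FPt_computes[M [BM cM]] : FPt (fun x => bpair (nseq q.[size x]%R true) x).
  apply: FPt_bpair Fq _; have := FPt_comp FPt_behead (FPt_cons true).
  by congr (FPt _).
have [pBM _ szM _] := cM; have [pBN monoN szN _] := cN.
pose F : frag (vars2 M N) (aux2 M N) := seqf (@call1 M N tp0 tp1) (seqf (guess_loop _ tp0 tp1)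
  (seqf (shift_dbl tp1 tp0) (@call2 M N tp0 tp1))).
apply: (@frag_NPTM _ _ F (fun n => 8 * n + 9 * BM n + 4 + (4 * BM n + 1 + (6 * BM n + 1 +
    (8 * (4 * BM n + n + 1) + 9 * BN (4 * BM n + n + 1) + 4)))) _
  (fun x w => Q (bpair w x))) => [|x w szw]; first by pbound_tac.
have [t1 E1 [t10 t1g t1u t1t]] :=
  @call1_ends M N BM _ cM tp0 tp1 (input_store [:: x]) x isT isT isT (fun=> erefl) erefl erefl erefl.
have qq : (q + q).[size x]%R = q.[size x]%R + q.[size x]%R :> nat by rewrite hornerD.
rewrite /bpair dbl_nseq -qq -szw in t10.
have t11 : t1 tp1 = stk [::] by rewrite t1u.
have E2 := @guess_loop_ends (vars2 M N) (aux2 M N) tp0 tp1 t1 w x [::] isT t10 t11.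
rewrite cats0 in E2; set t2 := upd _ tp1 _ in E2.
have E3 := @shift_dbl_ends (vars2 M N) (aux2 M N) tp1 tp0 t2 (rev w) (@blank _)
  (str (false :: x) (@blank _)) isT erefl isT erefl.
rewrite revK size_rev -str_cat -/(bpair w x) -!stkE in E3; set t3 := upd _ tp0 _ in E3.
have [||t4 E4 [t40 _]] := @call2_ends M N BN _ cN tp0 tp1 t3 (bpair w x) isT isT isT _ _ erefl erefl.
- by move=> m; rewrite -[LHS]/(t1 (tau2 _ m)) t1t.
- exact: t1g.
exists t4; last by rewrite t40 /=; case: (Q _).
have le : size w <= BM (size x).
  by apply: leq_trans (szM x); rewrite size_pair size_nseq szw qq -addnn; apply: leq_addr.
have sz : size (bpair w x) <= 4 * BM (size x) + size x + 1.
  by rewrite size_pair -muln2; move: le; clear; lia.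
have := seqf_ends E1 (seqf_ends E2 (seqf_ends E3 E4)); rewrite !cats0 => E.
apply: ends_le E _; have := monoN _ _ sz; move: le sz; clear; lia.
Qed.

(** * Boolean combinations, canonical padding and unary polynomials *)

Lemma FPt_id : FPt id.
Proof. by have := FPt_comp FPt_behead (FPt_cons true); congr (FPt _). Qed.

Lemma FPt_if P f g : PP P -> FPt f -> FPt g -> FPt (fun s => if P s then f s else g s).
Proof.
move=> pP pf pg; have := FPt_comp FPt_ite (FPt_bpair pP (FPt_bpair pf pg)).
congr (FPt _); apply/funext => s.
by rewrite /ite_fun fst_pair !snd_pair fst_pair.
Qed.

Lemma PP_comp Q f : PP Q -> FPt f -> PP (fun s => Q (f s)).
Proof. exact: FPt_comp. Qed.

Lemma FPt_seq1 b : FPt (fun=> [:: b]).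
Proof. exact: FPt_comp (FPt_cons b) FPt_nil. Qed.

Lemma PP_and P Q : PP P -> PP Q -> PP (fun s => P s && Q s).
Proof.
move=> pP pQ; have := FPt_if pP pQ (FPt_seq1 false).
by congr (FPt _); apply/funext => s; case: (P s).
Qed.

Lemma PP_not P : PP P -> PP (fun s => ~~ P s).
Proof.
move=> pP; have := FPt_if pP (FPt_seq1 false) (FPt_seq1 true).
by congr (FPt _); apply/funext => s; case: (P s).
Qed.

Lemma PP_or P Q : PP P -> PP Q -> PP (fun s => P s || Q s).
Proof.
move=> pP pQ; have := FPt_if pP (FPt_seq1 true) pQ.
by congr (FPt _); apply/funext => s; case: (P s).
Qed.

Lemma PP_if P Q R : PP P -> PP Q -> PP R -> PP (fun s => if P s then Q s else R s).
Proof.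
move=> pP pQ pR; have := FPt_if pP pQ pR.
by congr (FPt _); apply/funext => s; case: (P s).
Qed.

Lemma PP_eq f g : FPt f -> FPt g -> PP (fun s => f s == g s).
Proof.
move=> pf pg; have := FPt_comp FPt_eq (FPt_bpair pf pg).
by congr (FPt _); apply/funext => s; rewrite /eq_test fst_pair snd_pair.
Qed.

Lemma PP_head f : FPt f -> PP (fun s => head false (f s)).
Proof.
move=> pf; have := FPt_comp FPt_ite (FPt_bpair pf (FPt_bpair (FPt_seq1 true) (FPt_seq1 false))).
congr (FPt _); apply/funext => s.
by rewrite /ite_fun fst_pair !snd_pair fst_pair; case: head.
Qed.

Lemma PP_eqb P Q : PP P -> PP Q -> PP (fun s => P s == Q s).
Proof.
move=> pP pQ; have := PP_eq pP pQ.
by congr (FPt _); apply/funext => s; case: (P s) (Q s) => -[].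
Qed.

Definition PP2 (P : string -> string -> bool) : Prop := PP (fun s => P (fst_s s) (snd_s s)).

Definition PP3 (P : string -> string -> string -> bool) : Prop :=
  PP (fun s => P (fst_s s) (fst_s (snd_s s)) (snd_s (snd_s s))).

Lemma PP2_comp (P : string -> string -> bool) f g :
  PP2 P -> FPt f -> FPt g -> PP (fun s => P (f s) (g s)).
Proof.
move=> pP pf pg; have := PP_comp pP (FPt_bpair pf pg).
by congr (FPt _); apply/funext => s; rewrite fst_pair snd_pair.
Qed.

Lemma PP3_comp (P : string -> string -> string -> bool) f g h :
  PP3 P -> FPt f -> FPt g -> FPt h -> PP (fun s => P (f s) (g s) (h s)).
Proof.
move=> pP pf pg ph; have := PP_comp pP (FPt_bpair pf (FPt_bpair pg ph)).
by congr (FPt _); apply/funext => s; rewrite fst_pair !snd_pair fst_pair.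
Qed.

Definition zeros : string -> string := map (fun=> false).

Lemma zerosE s : zeros s = nseq (size s) false.
Proof. by elim: s => //= b s ->. Qed.

(** The filler must consist of zeros, so for each total length a string has only one padded form.
    Unique certificates of varying length thus become unique paths of one fixed length. *)
Definition padded (s : string) : bool := s == bpair (fst_s s) (zeros (snd_s s)).

(** The number subtracted is the length of the pair whose second component is empty. *)
Definition pad (n : nat) (s : string) : string := bpair s (nseq (n - (size s).*2.+1) false).

Lemma padded_pad n s : padded (pad n s).
Proof. by rewrite /padded /pad fst_pair snd_pair zerosE size_nseq. Qed.

Lemma fst_pad n s : fst_s (pad n s) = s. Proof. exact: fst_pair. Qed.

Lemma size_pad n s : (size s).*2 < n -> size (pad n s) = n.
Proof. by rewrite size_pair size_nseq; lia. Qed.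

Lemma paddedE s : padded s -> s = pad (size s) (fst_s s).
Proof.
move=> /eqP ds; rewrite {1}ds /pad zerosE; congr (bpair _ (nseq _ _)).
by rewrite {2}ds size_pair zerosE size_nseq addnS -addSn addnC addnK.
Qed.

Ltac FPt_tac := repeat lazymatch goal with
  | |- FPt (fun s => s) => exact: FPt_id
  | |- FPt fst_s => exact: FPt_fst
  | |- FPt snd_s => exact: FPt_snd
  | |- FPt (fun s => [::]) => exact: FPt_nil
  | |- FPt (fun s => fst_s (@?f s)) => apply: (@FPt_comp fst_s f FPt_fst)
  | |- FPt (fun s => snd_s (@?f s)) => apply: (@FPt_comp snd_s f FPt_snd)
  | |- FPt (fun s => behead (@?f s)) => apply: (@FPt_comp behead f FPt_behead)
  | |- FPt (fun s => inc (@?f s)) => apply: (@FPt_comp inc f FPt_inc)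
  | |- FPt (fun s => zeros (@?f s)) => apply: (@FPt_comp zeros f (FPt_map _))
  | |- FPt (fun s => map ?g (@?f s)) => apply: (@FPt_comp (map g) f (FPt_map _))
  | |- FPt (fun s => bpair (@?f s) (@?g s)) => apply: (@FPt_bpair f g)
  | |- FPt (fun s => ?b :: (@?f s)) => apply: (@FPt_comp (cons b) f (FPt_cons b))
  | |- FPt (fun s => if _ then _ else _) => apply: FPt_if
  | |- PP (fun s => @?P s && @?Q s) => apply: (@PP_and P Q)
  | |- PP (fun s => @?P s || @?Q s) => apply: (@PP_or P Q)
  | |- PP (fun s => ~~ @?P s) => apply: (@PP_not P)
  | |- PP (fun s => if _ then _ else _) => apply: PP_if
  | |- PP (fun s => head false (@?f s)) => apply: (@PP_head f)
  | |- PP (fun s => padded _) => rewrite /padded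
  | |- PP (fun s => @?f s == @?g s) => first [apply: (@PP_eq f g) | apply: (@PP_eqb f g)]
  | |- PP _ => match goal with
      | H : PP2 _ |- _ => apply: (PP2_comp H)
      | H : PP3 _ |- _ => apply: (PP3_comp H)
      end
  end.

(** Horner's rule in unary: multiply by the length of [x], then prepend one symbol for each unit of
    the constant coefficient. *)
Lemma FPt_ones (q : {poly nat}) : FPt (fun x => nseq q.[size x]%R true).
Proof.
elim/poly_ind: q => [|q c IHq].
  by have := FPt_nil; congr (FPt _); apply/funext => x; rewrite horner0.
have : FPt (fun x => ones_mul (bpair (nseq q.[size x]%R true) x)).
  by apply: FPt_comp FPt_mul (FPt_bpair IHq FPt_id).
elim: c => [|c IHc] Fm.
  move: Fm; congr (FPt _); apply/funext => x; rewrite /ones_mul fst_pair snd_pair size_nseq.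
  by rewrite GRing.addr0 hornerM hornerX.
have := FPt_comp (FPt_cons true) (IHc Fm); congr (FPt _); apply/funext => x.
by rewrite !hornerD !hornerC -[RHS]/(nseq (_ + c.+1) true) addnS.
Qed.

(** * Certificates for complements of UP languages *)

Lemma size_guesses M (c : config M) w n d : reach c w n d -> size w <= n.
Proof. by elim=> //= *; apply: leqW. Qed.

(** Unique short witnesses for [P] make its projection a UP language; the hypothesis yields a UP
    machine for the complement, and the accepting paths of that machine are the new witnesses. Their
    length is bounded by its running time, as each guess costs a step. *)
Lemma UP_complement (P : string -> string -> bool) B :
  PP2 P -> pbound B ->
  (forall u z, P u z -> size z <= B (size u)) ->
  (forall u z z', P u z -> P u z' -> z = z') -> UP = coUP ->
  exists P' B', [/\ PP2 P', pbound B',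
    forall u w, P' u w -> size w <= B' (size u),
    forall u w w', P' u w -> P' u w' -> w = w' &
    forall u, (exists w, P' u w) <-> ~ exists z, P u z].
Proof.
(* The padded form of [z] needs more than [2|z|] symbols. [PP_NPTM] doubles the polynomial, so paths
   have length [2 * q0 + 2], which is enough. *)
move=> pP [q0 hq0] Bz uniq_z up; pose q : {poly nat} := (q0 + 1%:P)%R.
pose Q s := padded (fst_s s) && P (snd_s s) (fst_s (fst_s s)).
have pQ : PP Q by rewrite /Q; FPt_tac.
have [M [npM bM accM]] := PP_NPTM pQ (FPt_ones q).
pose N (u : string) : nat := (q + q).[size u]%R.
have accE u w : acc M u w <-> [/\ size w = N u, padded w & P u (fst_s w)].
  rewrite accM /Q fst_pair snd_pair; split=> [[sz /andP[]]|[sz pw Pw]] //.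
  by rewrite pw Pw.
have accN u w : acc M u w -> w = pad (N u) (fst_s w).
  by move=> /accE[<- pw _]; apply: paddedE.
have szN u z : P u z -> (size z).*2 < N u.
  move=> /Bz; have := hq0 (size u); rewrite /N /q !hornerD !hornerC /=.
  rewrite -[X in _ < X]/((q0.[size u]%R + 1) + (q0.[size u]%R + 1)); lia.
pose L : set string := [set u | exists z, P u z]%classic.
have UPL : UP L.
  exists M; split=> // [u w1 w2 a1 a2|u].
    rewrite (accN _ _ a1) (accN _ _ a2).
    by have [_ _ p1] := (accE _ _).1 a1; have [_ _ p2] := (accE _ _).1 a2; rewrite (uniq_z _ _ _ p1 p2).
  split=> [[z Pz]|[w /accE[_ _ Pw]]]; last by exists (fst_s w).
  by exists (pad (N u) z); apply/accE; rewrite size_pad ?padded_pad ?fst_pad //; exact: szN.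
(* The only place where the equality of the two classes is used: the complement, in coUP by
   definition, is in UP. *)
have : UP (~` L)%classic by rewrite up; exists L.
move=> [M' [npM' uniqM' accM']].
have [q' hq'] := npM'.
exists (fun u w => `[< acc M' u w >]), (fun n => q'.[n]%R); split.
- exact: NPTM_PP.
- exact: pbound_poly.
- move=> u w /asboolP[d [[n R] _] _].
  apply: leq_trans (size_guesses R) _.
  by have := hq' [:: u] erefl _ _ _ R; rewrite /= addn0.
- by move=> u w w' /asboolP a /asboolP a'; apply: uniqM' a a'.
- move=> u; rewrite -[~ _]/((~` L)%classic u) accM'; split=> -[w].
    by move=> /asboolP; exists w.
  by move=> a; exists w; apply/asboolP.
Qed.
(** * Orderings of the strings of a given length as lists *)

Import Order.TTheory.

Definition lexs (n : nat) : seq string :=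
  sort (<=%O : rel (seqlexi bool)) [seq tval t | t <- enum {: n.-tuple bool}].

Lemma mem_lexs n y : (y \in lexs n) = (size y == n).
Proof.
rewrite mem_sort; apply/mapP/eqP => [[t _ ->]|sz]; first exact: size_tuple.
by move/eqP: sz => sz; exists (Tuple sz); rewrite ?mem_enum.
Qed.

Lemma lexs_uniq n : uniq (lexs n).
Proof. by rewrite sort_uniq map_inj_uniq ?enum_uniq //; apply: val_inj. Qed.

Lemma size_lexs n : size (lexs n) = 2 ^ n.
Proof. by rewrite size_sort size_map -cardE card_tuple card_bool. Qed.

Lemma sorted_lexs n : sorted (<%O : rel (seqlexi bool)) (lexs n).
Proof. by rewrite lt_sorted_uniq_le lexs_uniq; apply: sort_le_sorted. Qed.

Lemma index_lexs n a : size a = n -> index a (lexs n) < size (lexs n).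
Proof. by move=> /eqP sa; rewrite index_mem mem_lexs. Qed.

Lemma lex_ltE n a b : size a = n -> size b = n ->
  lex_lt a b = (index a (lexs n) < index b (lexs n)).
Proof.
move=> sa sb; have [ia ib] := (index_lexs sa, index_lexs sb).
rewrite -(lt_sorted_ltn_nth ([::] : seqlexi bool) (sorted_lexs n)) ?inE //.
by rewrite !nth_index // mem_lexs ?sa ?sb.
Qed.

Lemma lex_leE n a b : size a = n -> size b = n ->
  lex_le a b = (index a (lexs n) <= index b (lexs n)).
Proof.
move=> sa sb; have [ia ib] := (index_lexs sa, index_lexs sb).
rewrite -(lt_sorted_leq_nth ([::] : seqlexi bool) (sorted_lexs n)) ?inE //.
by rewrite !nth_index // mem_lexs ?sa ?sb.
Qed.

Lemma nth_lexs n i : i < 2 ^ n -> size (nth [::] (lexs n) i) = n.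
Proof. by move=> lt; apply/eqP; rewrite -mem_lexs mem_nth // size_lexs. Qed.

Lemma lex_succE n a b : size a = n -> size b = n ->
  lex_succ a b <-> index b (lexs n) = (index a (lexs n)).+1.
Proof.
move=> sa sb; have [ia ib] := (index_lexs sa, index_lexs sb); split.
  move=> [_ lt_ab no]; rewrite (lex_ltE sa sb) in lt_ab.
  apply/eqP; rewrite eqn_leq lt_ab andbT leqNgt; apply/negP => lt1.
  have lt2 : (index a (lexs n)).+1 < size (lexs n) by apply: leq_trans ib; exact: ltnW.
  apply: (no (nth [::] (lexs n) (index a (lexs n)).+1)).
    by rewrite nth_lexs -?size_lexs.
  by rewrite !(@lex_ltE n) ?nth_lexs -?size_lexs // index_uniq ?lexs_uniq.
move=> e; split; [by rewrite sa | by rewrite (lex_ltE sa sb) e |].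
by move=> c; rewrite sa => sc; rewrite !(@lex_ltE n) // e; lia.
Qed.

Lemma index_lexs_zeros n : index (nseq n false) (lexs n) = 0.
Proof.
have le y : size y = n -> lex_le (nseq n false) y.
  elim: n y => [|n IHn] [|b y] //= [sz]; rewrite /lex_le.
  have := IHn y sz; rewrite /lex_le /= => le; rewrite lexi_cons /=.
  by case: b; rewrite ?le.
have [|sz] := posnP (size (lexs n)); first by rewrite size_lexs; have := expn_gt0 2 n; lia.
have := le _ (nth_lexs (_ : 0 < 2 ^ n)); rewrite -size_lexs => /(_ sz).
rewrite (@lex_leE n) ?size_nseq ?nth_lexs -?size_lexs // index_uniq ?lexs_uniq //.
by rewrite leqn0 => /eqP.
Qed.

Lemma index_lexs_ones n : index (nseq n true) (lexs n) = (2 ^ n).-1.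
Proof.
have le y : size y = n -> lex_le y (nseq n true).
  elim: n y => [|n IHn] [|b y] //= [sz]; rewrite /lex_le.
  have := IHn y sz; rewrite /lex_le /= => le; rewrite lexi_cons /=.
  by case: b; rewrite ?le.
have pos : 0 < 2 ^ n by rewrite expn_gt0.
have sz : (2 ^ n).-1 < 2 ^ n by rewrite prednK.
have := le _ (nth_lexs sz).
rewrite (@lex_leE n) ?size_nseq ?nth_lexs // index_uniq ?lexs_uniq ?size_lexs //.
have := @index_lexs n (nseq n true); rewrite size_nseq size_lexs => /(_ erefl).
by move=> lt1 lt2; apply/eqP; rewrite eqn_leq lt2 andbT -ltnS prednK.
Qed.

(* A bijection [h] of the strings of length [n] is encoded by the list [T] of
   these strings in which [y] has the position of [h y] in lexicographic order. *)
Definition lists (n : nat) (T : seq string) : Prop :=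
  uniq T /\ forall y, (y \in T) = (size y == n).

Definition encodes (n : nat) (h : string -> string) (T : seq string) : Prop :=
  forall y, size y = n -> index (h y) (lexs n) = index y T.

Lemma size_lists n T : lists n T -> size T = 2 ^ n.
Proof.
move=> [uT mT]; rewrite -size_lexs; apply/eqP.
by rewrite eqn_leq !uniq_leq_size ?lexs_uniq // => y; rewrite mT mem_lexs.
Qed.

Lemma list_bij n T : lists n T ->
  exists2 h, set_bij (strings n) (strings n) h & encodes n h T.
Proof.
move=> lT; have szT := size_lists lT; have [uT mT] := lT.
have ltT y : size y = n -> index y T < 2 ^ n.
  by move=> /eqP; rewrite -mT -szT index_mem.
exists (fun y => nth [::] (lexs n) (index y T)).
  split.
  - by move=> y /ltT; apply: nth_lexs.
  - move=> y z; rewrite !inE => /mem_set; rewrite ?inE => sy sz.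
    have {}sy : size y = n by []. have {}sz : size z = n by [].
    move/eqP; rewrite nth_uniq ?lexs_uniq ?size_lexs ?ltT // => /eqP e.
    by rewrite -(nth_index [::] (_ : y \in T)) ?mT ?sy // e nth_index // mT sz.
  - move=> z sz; have {}sz : size z = n by [].
    have lt : index z (lexs n) < size T by rewrite szT -size_lexs index_lexs.
    exists (nth [::] T (index z (lexs n))).
      by apply/eqP; rewrite -mT mem_nth.
    by rewrite index_uniq // nth_index // mem_lexs sz.
by move=> y sy; rewrite index_uniq ?lexs_uniq ?size_lexs ?ltT.
Qed.

(** The list is the image of the lexicographic list under an inverse of [h]. Since [h] is controlled
    only on strings of length [n], that inverse is obtained by choice. *)
Lemma bij_list n h : set_bij (strings n) (strings n) h ->
  exists2 T, lists n T & encodes n h T.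
Proof.
move=> [fun_h inj_h surj_h].
have [g gP] : exists g, forall z, size z = n -> size (g z) = n /\ h (g z) = z.
  have /choice[g gP] z : exists y, size z = n -> size y = n /\ h y = z.
    case: (eqVneq (size z) n) => [sz|/eqP nz]; last by exists z.
    by have [y sy hy] := surj_h z sz; exists y.
  by exists g.
have hg y : size y = n -> g (h y) = y.
  move=> sy; have [sg hgy] := gP (h y) (fun_h y sy).
  by apply: inj_h; rewrite ?inE.
have inj_g : {in lexs n &, injective g}.
  move=> y z; rewrite !mem_lexs => /eqP/gP[_ hy] /eqP/gP[_ hz] e.
  by rewrite -hy -hz e.
exists [seq g z | z <- lexs n].
  split; first by rewrite map_inj_in_uniq ?lexs_uniq.
  move=> y; apply/mapP/eqP => [[z]|sy].
    by rewrite mem_lexs => /eqP/gP[sg _] ->.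
  by exists (h y); rewrite ?hg // mem_lexs; apply/eqP; apply: fun_h.
move=> y sy; rewrite -{2}(hg y sy).
have : h y \in lexs n by rewrite mem_lexs; apply/eqP; apply: fun_h.
elim: (lexs n) inj_g => //= z s IHs inj_g; rewrite inE => hy.
have zs : z \in z :: s by rewrite inE eqxx.
have hys : h y \in z :: s by rewrite inE.
rewrite (inj_in_eq inj_g) //; case: (eqVneq z (h y)) => // ne.
rewrite IHs //; first by move=> a b sa sb; apply: inj_g; rewrite inE ?sa ?sb orbT.
by case/orP: hy ne => // /eqP ->; rewrite eqxx.
Qed.

Lemma encodes_lex_succ n h T y z : set_bij (strings n) (strings n) h -> encodes n h T ->
  size y = n -> size z = n -> lex_succ (h y) (h z) <-> index z T = (index y T).+1.
Proof.
move=> [fun_h _ _] hT sy sz; rewrite -!hT //.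
by apply: lex_succE; apply: fun_h.
Qed.

Lemma encodes_lex_le n h T y z : set_bij (strings n) (strings n) h -> encodes n h T ->
  size y = n -> size z = n -> lex_le (h y) (h z) = (index y T <= index z T).
Proof.
move=> [fun_h _ _] hT sy sz; rewrite -!hT //.
by apply: lex_leE; apply: fun_h.
Qed.

Lemma index_lexs_inj n a b : size a = n -> size b = n ->
  index a (lexs n) = index b (lexs n) -> a = b.
Proof.
move=> sa sb e; rewrite -(nth_index [::] (_ : a \in lexs n)) ?mem_lexs ?sa // e.
by rewrite nth_index // mem_lexs sb.
Qed.

Lemma encodes_zeros n h T y : set_bij (strings n) (strings n) h -> encodes n h T ->
  size y = n -> h y = nseq n false <-> index y T = 0.
Proof.
move=> [fun_h _ _] hT sy; rewrite -hT // -(index_lexs_zeros n).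
split=> [->//|]; apply: index_lexs_inj; last exact: size_nseq.
exact: fun_h.
Qed.

Lemma encodes_ones n h T y : set_bij (strings n) (strings n) h -> encodes n h T ->
  size y = n -> h y = nseq n true <-> index y T = (2 ^ n).-1.
Proof.
move=> [fun_h _ _] hT sy; rewrite -hT // -(index_lexs_ones n).
split=> [->//|]; apply: index_lexs_inj; last exact: size_nseq.
exact: fun_h.
Qed.

Lemma card_list (s : seq string) (A : set string) k : uniq s ->
  (forall w, A w <-> w \in s) -> (A #= `I_k)%card <-> k = size s.
Proof.
move=> us As.
have e : (A #= `I_(size s))%card.
  apply/card_set_bijP; exists (fun w => index w s); split.
  - by move=> w /As ws /=; rewrite index_mem.
  - move=> w w'; rewrite !inE => /As ws /As ws' e.
    by rewrite -(nth_index [::] ws) e nth_index.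
  - move=> i /= lt; exists (nth [::] s i); first by apply/As; rewrite mem_nth.
    by rewrite index_uniq.
split=> [Ak|-> //].
by apply/card_eq_II; apply: card_eq_trans e; rewrite card_eq_sym.
Qed.
(** * Splicing a chain into the ordering by binary increments *)

Lemma sorted_flatten (T U : eqType) (e : rel T) (e' : rel U) (F : U -> seq T) x0 s :
  (forall u, u \in s -> F u != [::] /\ sorted e (F u)) ->
  (forall u v, u \in s -> v \in s -> e' u v -> e (last x0 (F u)) (head x0 (F v))) ->
  sorted e' s -> sorted e (flatten (map F s)).
Proof.
elim: s => // u s IHs Fs Fe srt.
have [Fu su] : F u != [::] /\ sorted e (F u) by apply: Fs; rewrite inE eqxx.
have {}IHs : sorted e (flatten (map F s)).
  apply: IHs (path_sorted srt) => [v vs|v w vs ws]; first by apply: Fs; rewrite inE vs orbT.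
  by apply: Fe; rewrite inE ?vs ?ws orbT.
case: s srt Fs Fe IHs => [|v s] /=; first by rewrite cats0.
move=> /andP[euv _] Fs Fe.
have [Fv _] : F v != [::] /\ sorted e (F v) by apply: Fs; rewrite !inE eqxx orbT.
have {Fe} := Fe u v; rewrite !inE !eqxx orbT => /(_ isT isT euv).
case: (F u) Fu su => // a l _ /= pal; case: (F v) Fv => // b l' _ /=.
by move=> ab srt; rewrite cat_path pal /= ab.
Qed.

(** An entry that is not the last is related to the next one, and functionality identifies any other
    related entry with it; the last entry needs the hypothesis of its own. This turns a locally
    tested relation into the successor relation of a list. *)
Lemma sorted_index (T : eqType) (e : rel T) x0 (s : seq T) : uniq s -> sorted e s ->
  (forall a b b', a \in s -> b \in s -> b' \in s -> e a b -> e a b' -> b = b') ->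
  (forall b, b \in s -> ~~ e (last x0 s) b) ->
  forall a b, a \in s -> b \in s -> e a b = (index b s == (index a s).+1).
Proof.
move=> us /(sortedP x0) srt fn lst a b ia ib; apply/idP/eqP => [eab|iab]; last first.
  have := srt (index a s); rewrite -iab index_mem ib !nth_index //; exact.
case: (ltnP (index a s).+1 (size s)) => [lt|ge].
  have ea := srt _ lt; rewrite nth_index // in ea.
  by rewrite (fn _ _ _ ia ib (mem_nth _ lt) eab ea) index_uniq.
have : a = last x0 s.
  rewrite -nth_last -(nth_index x0 ia); congr nth; apply/eqP.
  by have := ia; rewrite -index_mem; move: ge; lia.
by move=> al; move: eab; rewrite al (negbTE (lst _ ib)).
Qed.

(** The second test excludes the wrap-around of [inc] from all ones to all zeros. *)
Definition nxt (s t : string) : bool := (t == inc s) && (t != zeros t).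

(** Complementing the bits exchanges counting up and counting down, so no separate program for
    decrements is required. *)
Definition dec (s : string) : string := map negb (inc (map negb s)).

Lemma incK : cancel inc dec.
Proof.
rewrite /dec; elim=> //= -[] s IHs /=; first by rewrite IHs.
by rewrite (mapK negbK).
Qed.

Lemma size_inc s : size (inc s) = size s.
Proof. by elim: s => //= -[] s //= ->. Qed.

Lemma size_dec s : size (dec s) = size s.
Proof. by rewrite /dec size_map size_inc size_map. Qed.

Fixpoint incs (m : nat) : seq string :=
  if m is m'.+1 then flatten [seq [:: false :: s; true :: s] | s <- incs m'] else [:: [::]].

Lemma mem_incs m s : (s \in incs m) = (size s == m).
Proof.
elim: m s => [|m IHm] s /=; first by rewrite inE; case: s.
apply/flatten_mapP/idP => [[t]|]; first by rewrite IHm !inE => st /orP[] /eqP ->.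
case: s => // b s; rewrite /= eqSS -IHm => is_; exists s => //.
by rewrite !inE; case: b; rewrite eqxx ?orbT.
Qed.

Lemma size_incs m : size (incs m) = 2 ^ m.
Proof.
elim: m => //= m IHm; rewrite expnS -IHm.
by elim: (incs m) => //= s r ->; lia.
Qed.

Lemma incs_uniq m : uniq (incs m).
Proof.
apply: (leq_size_uniq (lexs_uniq m)); first by move=> s; rewrite mem_lexs mem_incs.
by rewrite size_lexs size_incs.
Qed.

Lemma head_flatten (T U : Type) (F : U -> seq T) x0 u s : size (F u) != 0 ->
  head x0 (flatten (map F (u :: s))) = head x0 (F u).
Proof. by rewrite /=; case: (F u). Qed.

Lemma last_flatten (T U : Type) (F : U -> seq T) x0 u s : size (F (last u s)) != 0 ->
  last x0 (flatten (map F (u :: s))) = last x0 (F (last u s)).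
Proof.
elim: s u => [|v s IHs] u nz /=; first by rewrite cats0.
rewrite -[RHS](IHs v nz).
have : size (flatten (map F (v :: s))) != 0.
  elim: s v nz {IHs} => [|w s IHs] v nz /=; first by rewrite cats0.
  by rewrite size_cat addn_eq0 negb_and (IHs w nz) orbT.
by rewrite /=; case: (F v ++ _) => // a l _; rewrite last_cat.
Qed.

Lemma incs_ends m : exists2 l, incs m = nseq m false :: l & last (nseq m false) l = nseq m true.
Proof.
elim: m => [|m [l el ll]]; first by exists [::].
exists ((true :: nseq m false) :: flatten [seq [:: false :: s; true :: s] | s <- l]).
  by rewrite /= el.
have := @last_flatten _ _ (fun s => [:: false :: s; true :: s]) [::] (nseq m false) l isT.
by rewrite ll /=.
Qed.

Lemma sorted_incs m : sorted nxt (incs m).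
Proof.
elim: m => //= m IHm.
apply: (@sorted_flatten _ _ _ nxt _ [::]) => [s _|s t _ _ /andP[/eqP -> nz]|//].
  by split; rewrite //= /nxt eqxx.
by rewrite /nxt /= eqxx /= eqseq_cons negb_and nz orbT.
Qed.

Section Splice.
Variables (m : nat) (U : seq string) (isU isR : pred string) (S H L : rel string).
Hypotheses (uniqU : uniq U) (sizeU : forall u, u \in U -> size u = m)
  (isUE : forall s, size s = m -> isU s = (s \in U))
  (SE : forall u v, u \in U -> v \in U -> S u v = (index v U == (index u U).+1))
  (HE : forall r u, isR r -> u \in U -> H r u = (index u U == 0))
  (LE : forall r u, isR r -> u \in U -> L r u = (index u U == (size U).-1))
  (isR_uniq : forall r r', size r = m -> size r' = m -> isR r -> isR r' -> r = r')
  (isR_ex : U != [::] -> exists2 r, size r = m & isR r)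
  (isR_ne : forall r, size r = m -> isR r -> U != [::])
  (isR_ones : ~~ isR (nseq m true)) (isU_zeros : ~~ isU (nseq m false)).

(** The first bit is a flag in front of a string of length [m]. Only strings flagged [false] can
    leave their place, so every [s] keeps at least [true :: s] there. Hence the group of [s] starts
    with flag [isU s], which is what the tests [head false b == isU (behead b)] check. *)
Definition in_chain (a : string) : bool := ~~ head false a && isU (behead a).

(* The strings [false :: u], for [u] in [U], are taken out of the ordering
   0s, 1s, 0(s+1), 1(s+1), ..., and reinserted as a block right after [true :: r],
   where [isR r]. *)
Definition splice_step (a b : string) : bool :=
  if in_chain a then
    if in_chain b then S (behead a) (behead b)
    else nxt (dec (behead b)) (behead b) && isR (dec (behead b)) &&
         L (dec (behead b)) (behead a) && (head false b == isU (behead b))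
  else
    if in_chain b then head false a && isR (behead a) && H (behead a) (behead b)
    else (~~ head false a && head false b && (behead a == behead b)) ||
         (head false a && nxt (behead a) (behead b) && ~~ isR (behead a) &&
          (head false b == isU (behead b))).

Definition splice_block (s : string) : seq string :=
  (if isU s then [:: true :: s] else [:: false :: s; true :: s]) ++
  (if isR s then map (cons false) U else [::]).

Definition splice : seq string := flatten (map splice_block (incs m)).

Lemma head_block s : head [::] (splice_block s) = isU s :: s.
Proof. by rewrite /splice_block; case: (isU s). Qed.

Lemma last_block s : size s = m ->
  last [::] (splice_block s) = if isR s then false :: last [::] U else true :: s.
Proof.
move=> sm; rewrite /splice_block last_cat; case: (boolP (isR s)) => Rs; last by case: (isU s).
have := isR_ne sm Rs; rewrite -size_eq0; case: U => //= u l _.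
by rewrite last_map.
Qed.

Lemma sorted_splice : sorted splice_step splice.
Proof.
apply: (@sorted_flatten _ _ _ nxt _ [::]); last exact: sorted_incs.
  move=> s; rewrite mem_incs => /eqP sm.
  split; first by rewrite /splice_block; case: (isU s).
  have : path splice_step (true :: s) (if isR s then map (cons false) U else [::]).
    case: ifP => // Rs; apply/(pathP [::]) => i; rewrite size_map => iU.
    case: i iU => [|i] iU /=.
      rewrite (nth_map [::]) // /splice_step /in_chain /= isUE ?sizeU ?mem_nth //= Rs HE ?mem_nth //.
      by rewrite index_uniq.
    have ilt := ltnW iU.
    rewrite !(nth_map [::]) // /splice_step /in_chain /= !isUE ?sizeU ?mem_nth // SE ?mem_nth //.
    by rewrite !index_uniq.
  rewrite /splice_block; case: (boolP (isU s)) => //= Us p; rewrite p andbT.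
  by rewrite /splice_step /in_chain /= (negbTE Us) /= eqxx.
move=> s t; rewrite !mem_incs => /eqP sm /eqP tm st.
rewrite (last_block sm) head_block.
have nb : in_chain (isU t :: t) = false by rewrite /in_chain /=; case: (isU t).
(* A chain element carries no certificates, so leaving the chain is decided from the target: the
   decrement of its tail is the string [r] behind which the chain was inserted. *)
have ds : dec t = s by case/andP: st => /eqP -> _; rewrite incK.
case: ifP => Rs; rewrite /splice_step nb /in_chain /=; last by rewrite st Rs eqxx.
have lU : last [::] U \in U.
  by have := isR_ne sm Rs; case: U => // u l _; rewrite /= mem_last.
rewrite isUE ?sizeU // lU ds st Rs eqxx LE // -nth_last index_uniq ?eqxx //.
by rewrite prednK // lt0n size_eq0 (isR_ne sm Rs).
Qed.

Lemma mem_splice y : (y \in splice) = (size y == m.+1).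
Proof.
apply/flatten_mapP/idP => [[s]|].
  rewrite mem_incs => sm; rewrite /splice_block mem_cat => /orP[].
    by case: ifP => _; rewrite !inE; [|case/orP] => /eqP ->; rewrite /= eqSS.
  by case: ifP => // _ /mapP[u /sizeU su ->]; rewrite /= su.
case: y => // c s; rewrite /= eqSS => sm.
have is_ : s \in incs m by rewrite mem_incs.
case: (boolP (isU s && ~~ c)) => [/andP[Us /negbTE ->]|nUc].
  have sU : s \in U by rewrite -isUE // (eqP sm).
  have [|r rm Rr] := isR_ex; first by apply: contraL sU => /eqP ->.
  exists r; first by rewrite mem_incs rm.
  by rewrite /splice_block Rr mem_cat map_f ?orbT.
exists s => //; rewrite /splice_block mem_cat; apply/orP; left.
by move: nUc; case: (isU s); case: c => //= _; rewrite !inE eqxx ?orbT.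
Qed.

(** Repetitions are excluded by counting. Apart from inserted chains the list has
    [2 * 2 ^ m - size U] entries, and at most one [r] carries a chain; so the list is no longer than
    the set of strings that it covers. *)
Lemma lists_splice : lists m.+1 splice.
Proof.
split; last exact: mem_splice.
apply: (leq_size_uniq (lexs_uniq m.+1)); first by move=> s; rewrite mem_lexs mem_splice.
have szE s : size (flatten (map splice_block s)) + count isU s =
    2 * size s + count isR s * size U.
  have szb a : size (splice_block a) + isU a = 2 + isR a * size U.
    rewrite /splice_block size_cat; case: (isU a); case: (isR a);
      by rewrite /= ?size_map ?mul1n ?mul0n ?addn0 ?add2n ?addn1 ?add1n.
  elim: s => //= a s IHs; rewrite size_cat mulnDl.
  by have := szb a; move: IHs; clear; lia.
have := szE (incs m); rewrite -/splice size_incs.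
have -> : count isU (incs m) = size U.
  rewrite -size_filter; apply/perm_size/uniq_perm; rewrite ?filter_uniq ?incs_uniq //.
  move=> s; rewrite mem_filter mem_incs; case: eqP => [sm|ns]; rewrite ?andbT ?andbF ?isUE //.
  by apply/esym/negP => /sizeU.
have cR : count isR (incs m) <= 1.
  rewrite -size_filter; have := filter_uniq isR (incs_uniq m).
  have : all (fun s => isR s && (size s == m)) (filter isR (incs m)).
    by apply/allP => s; rewrite mem_filter mem_incs.
  case: filter => [|a [|b l]] //= /and3P[/andP[Ra /eqP sa] /andP[Rb /eqP sb] _].
  by rewrite (isR_uniq sa sb Ra Rb) inE eqxx.
rewrite size_lexs expnS => e; rewrite -(leq_add2r (size U)) e leq_add2l.
by rewrite -[leqRHS]mul1n leq_mul2r cR orbT.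
Qed.

Lemma last_splice : last [::] splice = nseq m.+1 true.
Proof.
rewrite /splice; have [l -> ll] := incs_ends m.
rewrite last_flatten ll; first by rewrite last_block ?size_nseq // (negbTE isR_ones).
by rewrite /splice_block size_cat; case: isU.
Qed.

Lemma head_splice : head [::] splice = nseq m.+1 false.
Proof.
rewrite /splice; have [l -> _] := incs_ends m.
rewrite head_flatten ?head_block ?(negbTE isU_zeros) //.
by rewrite /splice_block size_cat; case: isU.
Qed.

(** By [sorted_index] it remains that no string has two successors and that the last has none. Each
    test determines [b] from [a]: the flag by [isU], and the rest by increment, by the position in
    [U], or by uniqueness of [r]. *)
Lemma splice_stepE a b : a \in splice -> b \in splice ->
  splice_step a b = (index b splice == (index a splice).+1).
Proof.
have [us _] := lists_splice.
apply: (@sorted_index _ splice_step [::] splice us sorted_splice) => {a b} [a b b'|b].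
  rewrite !mem_splice; case: a => // c s; case: b => // d t; case: b' => // d' t'.
  rewrite /= !eqSS => /eqP sm /eqP tm /eqP tm'.
  rewrite /splice_step /in_chain /= !isUE //.
  case: (boolP (~~ c && (s \in U))) => [/andP[_ sU]|nsU].
  - case: (boolP (~~ d && (t \in U))) => [/andP[/negbTE -> tU]|ntU];
      case: (boolP (~~ d' && (t' \in U))) => [/andP[/negbTE -> tU']|ntU'].
    + rewrite !SE // => /eqP e /eqP e'.
      by congr cons; rewrite -(nth_index [::] tU) e -e' nth_index.
    (* The mixed cases are void: an element at the last position of [U] has no successor inside
       [U]. *)
    + rewrite SE // => /eqP e /andP[/andP[/andP[_ Rt] /[!LE]// /eqP e'] _].
      by move: tU; rewrite -index_mem e e'; case: (size U) => //= k; rewrite ltnn.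
    + rewrite SE // => /andP[/andP[/andP[_ Rt] /[!LE]// /eqP e'] _] /eqP e.
      by move: tU'; rewrite -index_mem e e'; case: (size U) => //= k; rewrite ltnn.
    + move=> /andP[/andP[/andP[/andP[/eqP et _] Rt] _] /eqP ->].
      move=> /andP[/andP[/andP[/andP[/eqP et' _] Rt'] _] /eqP ->].
      suff -> : t = t' by [].
      by rewrite et et' (isR_uniq _ _ Rt Rt') ?size_dec.
  - case: (boolP (~~ d && (t \in U))) => [/andP[/negbTE -> tU]|ntU];
      case: (boolP (~~ d' && (t' \in U))) => [/andP[/negbTE -> tU']|ntU'].
    + move=> /andP[/andP[_ Rs] e] /andP[_ e'].
      move: e e'; rewrite !HE // => /eqP e /eqP e'.
      by congr cons; rewrite -(nth_index [::] tU) e -e' nth_index.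
    + by move=> /andP[/andP[-> ->] _] /=; rewrite andbF.
    + by move=> h /andP[/andP[ct Rs] _]; move: h; rewrite ct Rs /= andbF.
    + case: c {nsU} => /=.
        move=> /andP[/andP[/andP[/eqP -> _] _] /eqP ->].
        by move=> /andP[/andP[/andP[/eqP -> _] _] /eqP ->].
      by rewrite !orbF => /andP[-> /eqP <-] /andP[-> /eqP <-].
(* The last string is all ones: its increment wraps around, which [nxt] rejects, and its tail is not
   an [r], so no chain can follow it either. *)
rewrite mem_splice last_splice /splice_step /in_chain /= => sb.
rewrite (negbTE isR_ones) andbT /=; case: ifP => // _; rewrite negb_and; apply/orP; left.
rewrite /nxt; have -> : inc (nseq m true) = nseq m false by elim: (m) => //= k ->.
by case: eqP => // ->; rewrite zerosE size_nseq eqxx.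
Qed.

Lemma splice_infix : exists T1 T2, splice = T1 ++ map (cons false) U ++ T2.
Proof.
case: (eqVneq U [::]) => [->|nU]; first by exists [::], splice.
have [r rm Rr] := isR_ex nU.
have : r \in incs m by rewrite mem_incs rm.
rewrite /splice; case/splitPr => l1 l2; rewrite map_cat flatten_cat /= {2}/splice_block Rr.
exists (flatten (map splice_block l1) ++
  (if isU r then [:: true :: r] else [:: false :: r; true :: r])).
by exists (flatten (map splice_block l2)); rewrite -!catA.
Qed.

End Splice.
(** * From chains of accepting paths to orderings with known endpoints *)

Lemma infix_mem (T1 C T2 : seq string) w : uniq (T1 ++ C ++ T2) -> w \in T1 ++ C ++ T2 ->
  (w \in C) = (size T1 <= index w (T1 ++ C ++ T2) < size T1 + size C).
Proof.
rewrite cat_uniq => /and3P[_ /hasPn T1n]; rewrite cat_uniq => /and3P[_ /hasPn Cn _].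
rewrite !mem_cat !index_cat => wT.
case: (boolP (w \in T1)) => [w1|nw1].
  have /negbTE -> : w \notin C.
    by apply: contraL w1 => wC; apply: T1n; rewrite mem_cat wC.
  by have := w1; rewrite -index_mem; move: (size T1) => a; rewrite ltnNge => /negbTE ->.
case: (boolP (w \in C)) => [wC|nwC]; first by rewrite leq_addr ltn_add2l index_mem wC.
by rewrite leq_addr ltn_add2l ltnNge leq_addr.
Qed.

Lemma infix_index (T1 C T2 : seq string) w : uniq (T1 ++ C ++ T2) -> w \in C ->
  index w (T1 ++ C ++ T2) = size T1 + index w C.
Proof.
rewrite cat_uniq => /and3P[_ /hasPn T1n _] wC; rewrite !index_cat wC ifN //.
by apply: T1n; rewrite mem_cat wC.
Qed.

(** The list comes from the bijection and the segment from the cluster condition, so this serves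
    both notions of adjacency. For [f x = 0] the segment is empty. *)
Lemma cluster_list adj n M prec f x h : cluster_order adj n M prec f x h ->
  exists T1 C T2, [/\ lists n (T1 ++ C ++ T2), encodes n h (T1 ++ C ++ T2),
    forall w, acc M x w <-> w \in C & size C = f x].
Proof.
move=> [bij _ clu card]; have [T [uT mT] eT] := bij_list bij.
have [f0|/clu[l [u [sl su accE]]]] := EM (f x = 0).
  exists T, [::], [::]; rewrite /= cats0; split=> // w; split=> // aw.
  have : (acc M x #= `I_0)%card by rewrite -f0.
  by rewrite II0 card_eq0 => /eqP a0; rewrite a0 in aw.
have lT : l \in T by rewrite mT; apply/eqP.
have uT' : u \in T by rewrite mT; apply/eqP.
pose i := index l T; pose j := index u T.
have iT : i < size T by rewrite index_mem.
have jT : j < size T by rewrite index_mem.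
(* The truncated difference gives an empty segment when [u] precedes [l], as the interval condition
   does. *)
have TE : take i T ++ take (j.+1 - i) (drop i T) ++ drop (j.+1 - i) (drop i T) = T.
  by rewrite !cat_take_drop.
exists (take i T), (take (j.+1 - i) (drop i T)), (drop (j.+1 - i) (drop i T)).
have accC w : acc M x w <-> w \in take (j.+1 - i) (drop i T).
  rewrite accE /mkset; case: (boolP (w \in T)) => [wT|nwT]; last first.
    split=> [[sw _ _]|wC]; first by move: nwT; rewrite mT sw eqxx.
    by move: nwT; rewrite -TE !mem_cat wC orbT.
  have sw : size w = n by apply/eqP; rewrite -mT.
  have := @infix_mem (take i T) (take (j.+1 - i) (drop i T)) (drop (j.+1 - i) (drop i T)) w.
  rewrite TE => /(_ uT wT) ->; rewrite size_takel ?(ltnW iT) //.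
  rewrite size_takel ?size_drop; last by lia.
  have sl' : size l = n by []. have su' : size u = n by [].
  rewrite !(encodes_lex_le bij eT) // -/i -/j.
  by split=> [[_ a b]|/andP[a b]]; [apply/andP; split | split=> //]; move: a b; clear; lia.
rewrite TE; split=> //.
have uC : uniq (take (j.+1 - i) (drop i T)) by rewrite take_uniq ?drop_uniq.
exact: esym ((card_list (f x) uC accC).1 card).
Qed.

(* What the two relaxed classes have in common: the accepting paths, or their
   codes, form a chain under a polynomial-time successor relation, while nothing
   is required of the remaining strings. *)
Definition chain_counted (f : string -> nat) : Prop :=
  exists (A : string -> string -> bool) (S : string -> string -> string -> bool) B,
  [/\ PP2 A,
      PP3 S,
      pbound B, forall x e, A x e -> size e <= B (size x) &
      forall x, exists C, [/\ uniq C, size C = f x, forall e, (e \in C) = A x e &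
        forall e e', e \in C -> e' \in C -> S x e e' = (index e' C == (index e C).+1)]].

Lemma size_fst s : size (fst_s s) <= size s.
Proof. by apply: leq_trans (size_unpair s); apply: leq_addr. Qed.

Lemma index_inj_in (T : eqType) (s : seq T) x y : x \in s -> y \in s ->
  index x s = index y s -> x = y.
Proof. by move=> xs ys e; rewrite -(nth_index x xs) e nth_index. Qed.

Section ChainToCluster.
Variables (f : string -> nat) (A : string -> string -> bool)
  (S : string -> string -> string -> bool) (B : nat -> nat).
Hypotheses (pA : PP2 A)
  (pS : PP3 S)
  (pB : pbound B) (monoB : forall m n, m <= n -> B m <= B n)
  (sizeA : forall x e, A x e -> size e <= B (size x))
  (chainA : forall x, exists C, [/\ uniq C, size C = f x, forall e, (e \in C) = A x e &
        forall e e', e \in C -> e' \in C -> S x e e' = (index e' C == (index e C).+1)]).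
Hypothesis up : UP = coUP.

(** Here [u] codes [x] together with a path [e], and [P u z] says that [z] comes immediately before
    [e] in the chain; positions in the chain make [z] unique. For [e] outside [A] there is no such
    [z], so [W] is satisfied vacuously, and [A x e] has to be tested beside it. *)
Lemma first_witness : exists W D, [/\ PP2 W,
  pbound D /\ forall m n, m <= n -> D m <= D n, forall u w, W u w -> size w <= D (size u),
  forall u w w', W u w -> W u w' -> w = w' &
  forall x e, A x e -> (exists w, W (bpair x e) w) <-> forall z, A x z -> ~~ S x z e].
Proof.
pose P u z := A (fst_s u) (snd_s u) && A (fst_s u) z && S (fst_s u) z (snd_s u).
have pP : PP2 P by rewrite /PP2 /P; FPt_tac.
have [|u z z'|W [D [pW pD szW uW WE]]] := UP_complement pP pB _ _ up.
- move=> u z /andP[/andP[_ /sizeA le] _]; exact: leq_trans le (monoB (size_fst u)).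
- have [C [_ _ mC SC]] := chainA (fst_s u); rewrite /P -!mC => /andP[/andP[uC zC]].
  rewrite SC // => /eqP e /andP[/andP[_ zC']]; rewrite SC // e => /eqP[e'].
  exact: index_inj_in zC zC' e'.
- have [D' [pD' leD monoD]] := pbound_mono pD; exists W, D'; split=> //.
    by move=> u w /szW le; apply: leq_trans le (leD _).
  move=> x e Ae; rewrite WE /P fst_pair snd_pair Ae; split=> [no z Az|no [z /andP[Az Sz]]].
    by apply/negP => Sz; apply: no; exists z; rewrite Az Sz.
  by have := no z Az; rewrite Sz.
Qed.

Lemma last_witness : exists W D, [/\ PP2 W,
  pbound D /\ forall m n, m <= n -> D m <= D n, forall u w, W u w -> size w <= D (size u),
  forall u w w', W u w -> W u w' -> w = w' &
  forall x e, A x e -> (exists w, W (bpair x e) w) <-> forall z, A x z -> ~~ S x e z].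
Proof.
pose P u z := A (fst_s u) (snd_s u) && A (fst_s u) z && S (fst_s u) (snd_s u) z.
have pP : PP2 P by rewrite /PP2 /P; FPt_tac.
have [|u z z'|W [D [pW pD szW uW WE]]] := UP_complement pP pB _ _ up.
- move=> u z /andP[/andP[_ /sizeA le] _]; exact: leq_trans le (monoB (size_fst u)).
- have [C [_ _ mC SC]] := chainA (fst_s u); rewrite /P -!mC => /andP[/andP[uC zC]].
  rewrite SC // => /eqP e /andP[/andP[_ zC']]; rewrite SC // => /eqP e'.
  by apply: index_inj_in zC zC' _; rewrite e e'.
- have [D' [pD' leD monoD]] := pbound_mono pD; exists W, D'; split=> //.
    by move=> u w /szW le; apply: leq_trans le (leD _).
  move=> x e Ae; rewrite WE /P fst_pair snd_pair Ae; split=> [no z Az|no [z /andP[Az Sz]]].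
    by apply/negP => Sz; apply: no; exists z; rewrite Az Sz.
  by have := no z Az; rewrite Sz.
Qed.

Lemma chain_CLU : CLUsharpP f.
Proof.
have [W0 [D0 [pW0 [pD0 monoD0] szW0 uW0 W0E]]] := first_witness.
have [W1 [D1 [pW1 [pD1 monoD1] szW1 uW1 W1E]]] := last_witness.
(* [g] packs the first path, its certificate, the last path and its certificate. The first test
   rejects strings that merely decode to the same four components, which would spoil uniqueness. *)
pose G x g := (g == bpair (fst_s g) (bpair (fst_s (snd_s g))
    (bpair (fst_s (snd_s (snd_s g))) (snd_s (snd_s (snd_s g)))))) &&
  (A x (fst_s g) && W0 (bpair x (fst_s g)) (fst_s (snd_s g))) &&
  (A x (fst_s (snd_s (snd_s g))) &&
     W1 (bpair x (fst_s (snd_s (snd_s g)))) (snd_s (snd_s (snd_s g)))).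
(* The leading bit keeps the codes of paths apart from the string that holds the certificates. It
   also keeps all zeros out of [U] and prevents a chain from following all ones, so the new order
   has the same endpoints as counting. *)
pose isU x s := head false s && padded (behead s) && A x (fst_s (behead s)).
pose isR x s := ~~ head false s && padded (behead s) && G x (fst_s (behead s)).
pose S' x u v := S x (fst_s (behead u)) (fst_s (behead v)).
pose H r u := fst_s (behead u) == fst_s (fst_s (behead r)).
pose L r u := fst_s (behead u) == fst_s (snd_s (snd_s (fst_s (behead r)))).
pose prec x a b := splice_step (isU x) (isR x) (S' x) H L a b.
have pprec : polytime_pred3 prec.
  have : PP3 prec.
    rewrite /PP3.
    rewrite /prec /splice_step /in_chain /nxt /dec /isU /isR /S' /H /L /G.
    by FPt_tac.
  move/pred3_PP; congr polytime_pred3; do 3!apply/funext => ?.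
  by rewrite fst_pair !snd_pair fst_pair.
(* [D] bounds the length of the pair of [x] and a path, on which the certificates depend, and [Gam]
   the length of the whole quadruple. Padding doubles lengths, and so does [PP_NPTM]; the added 2
   pays for the two flag bits and the delimiter. *)
pose D n := 2 * n + 1 + B n.
pose Gam n := 2 * B n + 1 + (2 * D0 (D n) + 1 + (2 * B n + 1 + D1 (D n))).
have [q hq] : pbound (fun n => Gam n + B n + 2).
  have pD : pbound D by rewrite /D; pbound_tac.
  by rewrite /Gam; pbound_tac.
pose N (x : string) : nat := (q + q)%R.[size x]%R.
have NE x : N x = q.[size x]%R + q.[size x]%R by rewrite /N hornerD.
have pQ : PP (fun s => in_chain (isU (snd_s s)) (fst_s s)).
  by rewrite /in_chain /isU; FPt_tac.
have [M [npM bM accM]] := PP_NPTM pQ (FPt_ones q).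
have accE x w : acc M x w <-> size w = N x /\ in_chain (isU x) w.
  by rewrite accM fst_pair snd_pair.
exists (q + q)%R, M, (fun x => zeros (nseq (N x) true)), (fun x => nseq (N x) true), prec.
split=> //.
- exact: FPt_comp (FPt_map _) (FPt_ones (q + q)%R).
- exact: FPt_ones.
move=> x; rewrite -/(N x); cbv zeta.
have [C [uC sC mC SC]] := chainA x.
have [m Nm sz_m] : exists2 m, N x = m.+1 & 2 * (Gam (size x) + B (size x)) + 2 < m.
  exists (N x).-1; have := hq (size x); rewrite NE; clear; lia.
pose ecode e := true :: pad m.-1 e.
have ecode_inj : injective ecode by move=> e e' [] /(congr1 fst_s); rewrite !fst_pad.
have ecodeK e : fst_s (behead (ecode e)) = e by rewrite fst_pad.
have size_pad_m g : size g <= Gam (size x) + B (size x) -> size (pad m.-1 g) = m.-1.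
  by move=> le; rewrite size_pad // -muln2; move: sz_m le; clear; lia.
have m0 : m = m.-1.+1 by rewrite prednK //; apply: leq_trans sz_m.
pose U := map ecode C.
have uU : uniq U by rewrite map_inj_uniq.
have UP_ u : u \in U -> exists2 e, e \in C & u = ecode e by move/mapP.
have sizeC (e : string) : e \in C -> size e <= B (size x) by rewrite mC => /sizeA.
have sizeU u : u \in U -> size u = m.
  move=> /UP_[e /sizeC le ->]; rewrite /= size_pad_m -?m0 //.
  exact: leq_trans le (leq_addl _ _).
have isUE s : size s = m -> isU x s = (s \in U).
  move=> sm; apply/idP/idP => [/andP[/andP[hs ps] As]|/UP_[e eC ->]]; last first.
    by rewrite /isU /= padded_pad fst_pad -mC.
  apply/mapP; exists (fst_s (behead s)); first by rewrite mC.
  case: s sm hs ps {As} => // b s /= sm -> ps.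
  by rewrite /ecode -sm /= -paddedE.
have iU e : index (ecode e) U = index e C by exact: index_map.
have SE u v : u \in U -> v \in U -> S' x u v = (index v U == (index u U).+1).
  by move=> /UP_[e eC ->] /UP_[e' eC' ->]; rewrite !iU /S' !ecodeK SC.
have GE g : G x g -> exists e0 w0 e1 w1, [/\ g = bpair e0 (bpair w0 (bpair e1 w1)),
    e0 \in C /\ W0 (bpair x e0) w0, e1 \in C /\ W1 (bpair x e1) w1,
    index e0 C = 0 & index e1 C = (size C).-1].
  move=> /andP[/andP[/eqP gE /andP[A0 w0]] /andP[A1 w1]].
  have i0 := A0; have i1 := A1; rewrite -mC in i0; rewrite -mC in i1.
  do 4 eexists; split; [exact: gE | split; [exact: i0 | exact: w0] |
    split; [exact: i1 | exact: w1] | |].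
  (* At a position [k.+1] the entry at [k] would be a predecessor, which the certificate rules out.
     The argument for the last path is symmetric. *)
  - have /(W0E _ _ A0) no : exists w, W0 (bpair x (fst_s g)) w by eexists; exact: w0.
    case i: (index _ _) => [//|k]; have kC : k < size C.
      by apply: ltnW; rewrite -i index_mem.
    have := no (nth [::] C k); rewrite -mC mem_nth // SC ?mem_nth // i index_uniq //.
    by rewrite eqxx => /(_ isT).
  - have /(W1E _ _ A1) no : exists w, W1 (bpair x (fst_s (snd_s (snd_s g)))) w.
      by eexists; exact: w1.
    have := i1; rewrite -index_mem; set k := index _ _ => kC.
    case: (ltngtP k.+1 (size C)) kC => // [lt|<-] kC; last by [].
    have := no (nth [::] C k.+1); rewrite -mC mem_nth // SC ?mem_nth // -/k index_uniq //.
    by rewrite eqxx => /(_ isT).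
have eqC e e' : e \in C -> e' \in C -> (e == e') = (index e C == index e' C).
  by move=> eC eC'; apply/eqP/eqP => [->//|]; apply: index_inj_in.
have HE r u : isR x r -> u \in U -> H r u = (index u U == 0).
  move=> /andP[_ /GE[e0 [w0 [e1 [w1 [gE [e0C _] _ i0 _]]]]]] /UP_[e eC ->].
  by rewrite /H ecodeK gE fst_pair iU eqC // i0.
have LE r u : isR x r -> u \in U -> L r u = (index u U == (size U).-1).
  move=> /andP[_ /GE[e0 [w0 [e1 [w1 [gE _ [e1C _] _ i1]]]]]] /UP_[e eC ->].
  by rewrite /L ecodeK gE !snd_pair fst_pair iU eqC // i1 size_map.
have isR_code r : size r = m -> isR x r -> r = false :: pad m.-1 (fst_s (behead r)).
  move=> + /andP[/andP[]]; case: r => [|b r] /=; first by rewrite m0.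
  move=> rm /negbTE -> pr _; by rewrite -rm /= -paddedE.
have isR_uniq r r' : size r = m -> size r' = m -> isR x r -> isR x r' -> r = r'.
  (* Positions fix the two paths, uniqueness fixes their certificates, and the canonical padding
     fixes the remaining symbols. *)
  move=> sr sr' Rr Rr'; rewrite (isR_code _ sr Rr) (isR_code _ sr' Rr').
  case/andP: Rr => _ /GE[e0 [w0 [e1 [w1 [-> [e0C W0e] [e1C W1e] i0 i1]]]]].
  case/andP: Rr' => _ /GE[f0 [v0 [f1 [v1 [-> [f0C W0f] [f1C W1f] j0 j1]]]]].
  have ef0 : e0 = f0 by apply: (index_inj_in e0C f0C); rewrite i0 j0.
  have ef1 : e1 = f1 by apply: (index_inj_in e1C f1C); rewrite i1 j1.
  subst f0 f1; by rewrite (uW0 _ _ _ W0e W0f) (uW1 _ _ _ W1e W1f).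
have isR_ex : U != [::] -> exists2 r, size r = m & isR x r.
  rewrite -size_eq0 size_map => C0; pose e0 := nth [::] C 0; pose e1 := nth [::] C (size C).-1.
  have lt0 : 0 < size C by rewrite lt0n.
  have lt1 : (size C).-1 < size C by rewrite prednK.
  have e0C : e0 \in C by rewrite mem_nth.
  have e1C : e1 \in C by rewrite mem_nth.
  have [w0 w0P] : exists w, W0 (bpair x e0) w.
    apply/W0E => [|z]; rewrite -mC // => zC; rewrite SC // index_uniq //.
  have [w1 w1P] : exists w, W1 (bpair x e1) w.
    apply/W1E => [|z]; rewrite -mC // => zC; rewrite SC // index_uniq // prednK //.
    by rewrite neq_ltn index_mem zC.
  pose g := bpair e0 (bpair w0 (bpair e1 w1)).
  have le (e : string) : e \in C -> size (bpair x e) <= D (size x).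
    by move=> /sizeC le; rewrite /D size_pair -muln2; move: le; clear; lia.
  have sg : size g <= Gam (size x) + B (size x).
    rewrite /g /Gam !size_pair -!muln2.
    have := leq_trans (szW0 _ _ w0P) (monoD0 _ _ (le _ e0C)).
    have := leq_trans (szW1 _ _ w1P) (monoD1 _ _ (le _ e1C)).
    by have := sizeC _ e0C; have := sizeC _ e1C; clear; lia.
  exists (false :: pad m.-1 g); first by rewrite /= size_pad_m // -m0.
  rewrite /isR /= padded_pad fst_pad /G /g !(fst_pair, snd_pair) eqxx -!mC.
  by rewrite e0C e1C w0P w1P.
have isR_ne r : size r = m -> isR x r -> U != [::].
  move=> _ /andP[_ /GE[e0 [w0 [e1 [w1 [_ [e0C _] _ _ _]]]]]].
  by rewrite -size_eq0 size_map size_eq0; case: (C) e0C.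
have isR_ones : ~~ isR x (nseq m true) by rewrite m0.
have isU_zeros : ~~ isU x (nseq m false) by rewrite m0.
have lT := lists_splice (m := m) uU sizeU isUE isR_uniq isR_ex.
set T := splice _ _ _ _ in lT.
have [uT mT] := lT; have szT := size_lists lT.
have [h bij eT] := list_bij lT; rewrite -Nm in lT mT szT bij eT.
have stepE := splice_stepE (m := m) uU sizeU isUE SE HE LE isR_uniq isR_ex isR_ne isR_ones.
have T0 : 0 < size T by rewrite szT expn_gt0.
have indT y : size y = N x -> y \in T by move=> sy; rewrite mT sy.
have sz0 : size (zeros (nseq (N x) true)) = N x by rewrite size_map size_nseq.
have sz1 : size (nseq (N x) true) = N x by rewrite size_nseq.
exists h; split=> //.
- have [T1 [T2 TE]] := splice_infix (isU x) isR_ex.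
  have accC w : acc M x w <-> w \in map (cons false) U.
    rewrite accE; split=> [[sw /andP[hw]]|/mapP[u uU' ->]].
      case: w sw hw => [|b w]; rewrite Nm //= => -[sw] /negbTE ->.
      by rewrite isUE // => wU; rewrite map_f.
    by rewrite Nm /= sizeU // /in_chain /= isUE ?sizeU.
  have uC' : uniq (map (cons false) U) by rewrite map_inj_uniq // => u v [].
  split=> //.
  + move=> y z sy sz; rewrite (encodes_lex_succ bij eT) // /prec stepE ?indT //.
    by split=> /eqP.
  + rewrite -sC => C0; have {C0} : map (cons false) U != [::].
      by move: C0; rewrite /U; case: (C).
    case E: (map _ U) => [//|l c] _; exists l, (last l c).
    rewrite -/T in TE; rewrite E in TE; rewrite TE in uT.
    have lC : l \in l :: c by rewrite inE eqxx.
    have uC1 : last l c \in l :: c by rewrite mem_last.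
    have szE w : w \in l :: c -> size w = N x.
      by rewrite -E => /accC/accE[].
    have sl := szE _ lC; have su := szE _ uC1; split=> //.
    apply/seteqP; split=> w.
      move=> /accC; rewrite E => wC; have sw := szE _ wC.
      split=> //; rewrite (encodes_lex_le bij eT) // TE !infix_index // leq_add2l.
        by rewrite /= eqxx.
      rewrite (index_last (_ : uniq (l :: c))); first by rewrite -ltnS -[(size c).+1]/(size (l :: c)) index_mem.
      by rewrite -E.
    move=> [sw]; rewrite !(encodes_lex_le bij eT) // => le1 le2.
    have wT : w \in T1 ++ (l :: c) ++ T2 by rewrite -TE indT.
    apply/accC; rewrite E (infix_mem uT wT) -TE; apply/andP; split.
      by apply: leq_trans le1; rewrite TE infix_index // leq_addr.
    apply: leq_ltn_trans le2 _; rewrite TE infix_index // ltn_add2l.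
    by rewrite index_mem.
  + apply/(card_list _ uC' accC); by rewrite !size_map.
- apply/(encodes_zeros bij eT) => //; rewrite zerosE sz1 Nm.
  rewrite -(head_splice U (isR x) isU_zeros) -/T.
  by case: (T) T0 => //= a s _; rewrite eqxx.
- apply/(encodes_ones bij eT) => //; rewrite Nm.
  rewrite -(last_splice (isU x) isR_ne isR_ones) -/T -Nm -szT.
  by case: (T) T0 uT => // a s _ us; rewrite [last _ _]/(last a s) index_last.
Qed.

End ChainToCluster.

(** * The inclusions between the three classes *)

Lemma chain_counted_CLU f : UP = coUP -> chain_counted f -> CLUsharpP f.
Proof.
move=> up [A [S [B [pA pS pB sA cA]]]]; have [B' [pB' leB monoB]] := pbound_mono pB.
apply: (chain_CLU pA pS pB' monoB _ cA up) => x e /sA le; exact: leq_trans le (leB _).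
Qed.

Lemma acc_size p M x w : balanced p M -> acc M x w -> size w = p.[size x]%R.
Proof. by move=> bM [d dP _]; apply/(bM x w); exists d. Qed.

Lemma free_chain f : CLUsharpP_free f -> chain_counted f.
Proof.
move=> [p [M [prec [npM bM pp clu]]]].
exists (fun x e => `[< acc M x e >]), prec, (fun n => p.[n]%R); split.
- exact: NPTM_PP.
- exact: PP_pred3.
- exact: pbound_poly.
- by move=> x e /asboolP /(acc_size bM) ->.
move=> x; have [h cl] := clu x; have [bij precE _ _] := cl.
have [T1 [C [T2 [lT eT accC sC]]]] := cluster_list cl; have [uT mT] := lT.
have CT y : y \in C -> size y = p.[size x]%R.
  by move=> yC; apply/eqP; rewrite -mT !mem_cat yC orbT.
exists C; split=> //.
- by move: uT; rewrite !cat_uniq => /and3P[_ _ /and3P[]].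
- by move=> e; apply/idP/asboolP => /accC.
- move=> e e' eC eC'; apply/idP/eqP => [|i].
    move=> /precE -/(_ (CT _ eC) (CT _ eC')) /(encodes_lex_succ bij eT (CT _ eC) (CT _ eC')).
    by rewrite !infix_index // -addnS => /addnI.
  apply/precE; [exact: CT | exact: CT |].
  by apply/(encodes_lex_succ bij eT) => //; [exact: CT | exact: CT | rewrite !infix_index // i addnS].
Qed.

(** Circular adjacency is [next] on the list. In this form it mentions no endpoints and is invariant
    under rotation, so the circle may be cut anywhere. *)
Lemma circular_index (T : seq string) y z : uniq T -> y \in T -> z \in T ->
  (index z T = (index y T).+1 \/ (index y T = (size T).-1 /\ index z T = 0)) <->
  z = next T y.
Proof.
move=> uT yT zT; have iy := yT; rewrite -index_mem in iy.
have iz := zT; rewrite -index_mem in iz.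
rewrite next_nth yT; case: T uT yT zT iy iz => // a s us yT zT iy iz.
case: (ltnP (index y (a :: s)) (size s)) => [lt|ge].
  rewrite -[nth a s _]/(nth a (a :: s) (index y (a :: s)).+1).
  split=> [[<-|[i _]]|->]; first by rewrite nth_index.
    by move: lt; rewrite i ltnn.
  by left; rewrite index_uniq.
have ey : index y (a :: s) = size s by apply/eqP; rewrite eqn_leq ge andbT -ltnS.
rewrite nth_default ?ey //; split=> [[i|[_ i0]]|->].
- by move: iz; rewrite i /= ltnn.
- by rewrite -[LHS](nth_index a zT) i0.
- by right; rewrite /= eqxx.
Qed.

(** The test in [S] must know whether the wrap-around can stay inside the cluster. This one bit of
    information, with its certificate, is attached to every accepting path; as there is exactly one
    certificate per input, the count is unchanged. *)
Lemma circ_chain f : UP = coUP -> CLUsharpP_circular f -> chain_counted f.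
Proof.
move=> up [p [M [prec [npM bM pp clu]]]].
pose n (x : string) : nat := p.[size x]%R.
pose A x y := `[< acc M x y >].
have pA : PP2 A by apply: NPTM_PP.
have pprec : PP3 prec by apply: PP_pred3.
have sizeA x y : A x y -> size y = n x by move=> /asboolP /(acc_size bM).
(* A pair of adjacent strings at which acceptance begins: it exists, and is unique,
   unless all paths accept or none does. *)
pose P x v := (v == bpair (fst_s v) (snd_s v)) && prec x (fst_s v) (snd_s v) &&
  (~~ A x (fst_s v) && A x (snd_s v)) && (zeros (fst_s v) == zeros (snd_s v)).
have pP : PP2 P by rewrite /PP2 /P; FPt_tac.
(* Equality of [zeros] compares lengths. Acceptance fixes the length of the second component of the
   pair, and so the first also has the length at which [prec] is meaningful. *)
have size_zeros s t : zeros s = zeros t -> size s = size t.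
  by move=> /(congr1 size); rewrite !size_map.
have sizeP x v : P x v -> size v <= 3 * n x + 1.
  move=> /andP[/andP[/andP[/eqP vE _] /andP[_ Ay]] /eqP/size_zeros e].
  by rewrite vE size_pair -muln2 e (sizeA _ _ Ay); clear; lia.
have nextP x : exists T1 C T2, [/\ lists (n x) (T1 ++ C ++ T2), size C = f x,
    forall y, A x y = (y \in C) & forall y z, size y = n x -> size z = n x ->
      prec x y z = (z == next (T1 ++ C ++ T2) y)].
  have [h cl] := clu x; have [bij precE _ _] := cl.
  have [T1 [C [T2 [lT eT accC sC]]]] := cluster_list cl; exists T1, C, T2; split=> //.
    by move=> y; apply/asboolP/idP => /accC.
  move=> y z sy sz; have [uT mT] := lT; have szT := size_lists lT.
  have yT : y \in T1 ++ C ++ T2 by rewrite mT sy.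
  have zT : z \in T1 ++ C ++ T2 by rewrite mT sz.
  have adjE : circ_succ (n x) (h y) (h z) <-> z = next (T1 ++ C ++ T2) y.
    rewrite -(circular_index uT yT zT) szT /circ_succ.
    by rewrite (encodes_lex_succ bij eT) // (encodes_ones bij eT) // (encodes_zeros bij eT).
  apply/idP/eqP => [/(precE _ _ sy sz)/adjE//|/adjE].
  by move/(precE _ _ sy sz).
have uniqP x v v' : P x v -> P x v' -> v = v'.
  have [T1 [C [T2 [[uT mT] _ AC nextE]]]] := nextP x.
  have key z y : prec x z y -> ~~ A x z -> A x y -> zeros z = zeros y ->
      index y C = 0 /\ next (T1 ++ C ++ T2) z = y.
    move=> pzy Az Ay /size_zeros e; have sy := sizeA _ _ Ay.
    have sz : size z = n x by rewrite e.
    have ny : y = next (T1 ++ C ++ T2) z by apply/eqP; rewrite -nextE.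
    split=> //; have zT : z \in T1 ++ C ++ T2 by rewrite mT sz.
    have yT : y \in T1 ++ C ++ T2 by rewrite mT sy.
    have yC : y \in C by rewrite -AC.
    have zC : z \notin C by rewrite -AC.
    (* [a] is the size of [T1], [b] the position of [y] in [C], [d] the size of [C], [c] the
       position of [z] and [k] the last position of the circle. The cluster can be entered from
       outside only at its first element; in the wrap-around case [a + b = 0] says so directly. *)
    have arith a b c d k : a + b = c.+1 \/ (c = k /\ a + b = 0) -> ~~ (a <= c < a + d) ->
      b < d -> b = 0 by clear; lia.
    have := (circular_index uT zT yT).2 ny; rewrite (infix_index uT yC) => i.
    rewrite (infix_mem uT zT) in zC; have iy := yC; rewrite -index_mem in iy.
    exact: arith i zC iy.
  move=> /andP[/andP[/andP[/eqP vE pv] /andP[zv yv]] /eqP e].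
  move=> /andP[/andP[/andP[/eqP vE' pv'] /andP[zv' yv']] /eqP e'].
  have [i n1] := key _ _ pv zv yv e; have [i' n1'] := key _ _ pv' zv' yv' e'.
  have ey : snd_s v = snd_s v'.
    by apply: (@index_inj_in _ C); rewrite -?AC // i i'.
  have : next (T1 ++ C ++ T2) (fst_s v) = next (T1 ++ C ++ T2) (fst_s v').
    by rewrite n1 n1' ey.
  by move/(can_inj (prev_next uT)) => ez; rewrite vE vE' ez ey.
have pn : pbound (fun m => 3 * p.[m]%R + 1).
  by apply: pbound_add (pbound_mul (pbound_const 3) (pbound_poly p)) (pbound_const 1).
have [P' [D [pP' pD sizeP' uniqP' P'E]]] := UP_complement pP pn sizeP uniqP up.
(* A tagged sum: tag [true] for the pair at which acceptance begins, tag [false] for a certificate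
   that there is none. Exactly one side is inhabited, and by a single element. *)
pose W x w := (w != [::]) && (if head false w then P x (behead w) else P' x (behead w)).
have pW : PP2 W by rewrite /PP2 /W /P; FPt_tac.
have uniqW x w w' : W x w -> W x w' -> w = w'.
  have no u u' : P x u -> ~ P' x u'.
    by move=> Pu Pu'; apply: ((P'E x).1 _); [exists u' | exists u].
  case: w w' => [|[] w] [|[] w'] //.
  - by rewrite /W /= => a b; rewrite (uniqP _ _ _ a b).
  - by rewrite /W /= => a b; case: (no _ _ a b).
  - by rewrite /W /= => a b; case: (no _ _ b a).
  - by rewrite /W /= => a b; rewrite (uniqP' _ _ _ a b).
have sizeW x w : W x w -> size w <= 3 * n x + 1 + D (size x) + 1.
  by case: w => [|[] w] //; rewrite /W /= => le;
    [apply: leq_ltn_trans (sizeP _ _ le) _ | apply: leq_ltn_trans (sizeP' _ _ le) _]; clear; lia.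
exists (fun x e => (e == bpair (fst_s e) (snd_s e)) && A x (fst_s e) && W x (snd_s e)).
exists (fun x e e' => prec x (fst_s e) (fst_s e') &&
  ~~ (~~ head false (snd_s e) && (fst_s e' == zeros (fst_s e')))).
exists (fun m => 2 * p.[m]%R + 1 + (3 * p.[m]%R + 1 + D m + 1)); split.
- by rewrite /PP2; FPt_tac.
- by rewrite /PP3; FPt_tac.
- have pp_ := pbound_poly p.
  do !apply: pbound_add => //; try exact: pbound_const; apply: pbound_mul pp_; exact: pbound_const.
- move=> x e /andP[/andP[/eqP eE Ae] We]; rewrite eE size_pair -muln2.
  by rewrite addnS -addSn leq_add ?(sizeW _ _ We) // (sizeA _ _ Ae) addn1 mulnC.
move=> x; have [T1 [C [T2 [[uT mT] sC AC nextE]]]] := nextP x.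
set T := T1 ++ C ++ T2 in uT mT nextE.
have uC : uniq C by move: uT; rewrite !cat_uniq => /and3P[_ _ /and3P[]].
have CT y : y \in C -> y \in T by move=> yC; rewrite !mem_cat yC orbT.
have sizeC y : y \in C -> size y = n x by rewrite -AC; apply: sizeA.
have [w Ww] : exists w, W x w.
  have [[v Pv]|nv] := EM (exists v, P x v); first by exists (true :: v).
  by have [w Pw] := (P'E x).2 nv; exists (false :: w).
pose code y := bpair y w.
have code_inj : injective code by move=> y z /(congr1 fst_s); rewrite !fst_pair.
have codesP (C' : seq string) : (forall y, (y \in C') = (y \in C)) ->
    forall e, (e \in map code C') =
      (e == bpair (fst_s e) (snd_s e)) && A x (fst_s e) && W x (snd_s e).
  move=> CC e; apply/mapP/idP => [[y yC ->]|/andP[/andP[/eqP eE Ae] We]].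
    by rewrite fst_pair snd_pair eqxx AC -CC yC.
  exists (fst_s e); first by rewrite CC -AC.
  by rewrite /code (uniqW _ _ _ Ww We).
(* Since [w] is common to all codes on input [x], it suffices to order the paths. The order may
   differ from that of [C]: only its members are prescribed. *)
suff [C' [uC' CC' CE']] : exists C', [/\ uniq C', forall y, (y \in C') = (y \in C) &
    forall y z, y \in C' -> z \in C' -> (z == next T y) && ~~ (~~ head false w && (z == zeros z)) =
      (index z C' == (index y C').+1)].
  exists (map code C'); split.
  - by rewrite map_inj_uniq.
  - by rewrite size_map -sC; apply/perm_size/uniq_perm.
  - exact: codesP.
  move=> _ _ /mapP[y yC ->] /mapP[z zC ->]; rewrite !(fst_pair, snd_pair) !index_map //.
  by rewrite nextE ?CE' // sizeC // -CC'.
have [[v Pv]|nv] := EM (exists v, P x v).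
  have -> : head false w = true by rewrite (uniqW x w (true :: v)).
  exists C; split=> // y z yC zC; rewrite /= andbT.
  have szC : size C < size T.
    case/andP: Pv => /andP[_ /andP[zv yv]] /eqP/size_zeros e.
    have zT : fst_s v \in T by rewrite mT e (sizeA _ _ yv).
    rewrite ltnNge; apply/negP => le.
    by move: zv; rewrite AC (uniq_min_size uC CT le).2 zT.
  apply/eqP/eqP => [/(circular_index uT (CT _ yC) (CT _ zC))|i]; last first.
    by apply/(circular_index uT (CT _ yC) (CT _ zC)); left; rewrite !infix_index // i addnS.
  (* A wrap-around edge inside [C] would make [C] reach from the first to the last entry of [T],
     which the rejecting string in [v] forbids. *)
  have arith a y' z' c k : a + z' = (a + y').+1 \/ (a + y' = k.-1 /\ a + z' = 0) ->
    y' < c -> c < k -> z' = y'.+1 by clear; lia.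
  have iy := yC; rewrite -index_mem in iy.
  by rewrite !infix_index // => i; apply: arith i iy szC.
have -> : head false w = false.
  case: w Ww {code code_inj codesP} => [|[] w] //; rewrite /W /= => Pw.
  by case: nv; exists w.
have [C0|[y0 y0C]] : C = [::] \/ exists y, y \in C.
  by case: (C) => [|y s]; [left | right; exists y; rewrite inE eqxx].
  by exists C; split=> // y z; rewrite C0.
have CE : C =i T.
  (* If the circular predecessor of the first accepting path rejected, the two would form a pair
     satisfying [P]. So it accepts, and a segment containing the predecessor of its own start is the
     full circle. *)
  pose y := nth [::] C 0; pose z := prev T y.
  have lt0 : 0 < size C by case: (C) y0C.
  have yC : y \in C by rewrite mem_nth.
  have zT : z \in T by rewrite mem_prev CT.
  have sz : size z = n x by apply/eqP; rewrite -mT.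
  have ny : y = next T z by rewrite next_prev.
  have zC : z \in C.
    apply/negPn/negP => nC; apply: nv; exists (bpair z y).
    have zy : zeros z == zeros y by rewrite !zerosE sz (sizeC _ yC).
    by rewrite /P fst_pair snd_pair eqxx !AC nC yC zy nextE ?(sizeC _ yC) // -ny eqxx.
  have arith a c k i : a = i.+1 \/ (i = k.-1 /\ a = 0) -> a <= i < a + c -> k <= c.
    by clear; lia.
  have := (circular_index uT zT (CT _ yC)).2 ny.
  rewrite infix_index // index_uniq // addn0 => i.
  have iz := zC; rewrite (infix_mem uT zT) in iz.
  exact: (uniq_min_size uC CT (arith _ _ _ _ i iz)).2.
have nT : nseq (n x) false \in T by rewrite mT size_nseq.
have zE z : z \in T -> (z == zeros z) = (z == nseq (n x) false).
  by rewrite mT zerosE => /eqP ->.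
(* Read from the all-zero string on, the circle becomes a list. The only adjacency that is not a
   step of this list is the one into its head, and the test against [zeros z] removes precisely that
   one. *)
set zs := nseq _ _ in nT zE; have := rot_index nT; set k := index zs T; set R' := _ ++ _ => RE.
have uR : uniq (rot k T) by rewrite rot_uniq.
exists (rot k T); split=> // [y|y z]; rewrite ?mem_rot ?CE // => yT zT.
rewrite andTb zE // -(next_rot k uT).
have yR : y \in rot k T by rewrite mem_rot.
have zR : z \in rot k T by rewrite mem_rot.
have z0 : (z == zs) = (index z (rot k T) == 0) by rewrite RE /= eq_sym; case: (zs == z).
rewrite z0; have ci := circular_index uR yR zR.
apply/andP/eqP => [[/eqP/ci[//|[_ ->]] //]|i].
by split; [apply/eqP/ci; left | rewrite i].
Qed.

Lemma CLU_free f : CLUsharpP f -> CLUsharpP_free f.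
Proof.
move=> [p [M [b [t [prec [[npM bM] _ _ pp clu]]]]]]; exists p, M, prec; split=> // x.
by have [h [cl _ _ _ _]] := clu x; exists h.
Qed.

(** With both endpoints computable, the missing pair from the top to the bottom is added to the
    adjacency predicate; injectivity of [h] ensures that no other pair is meant. *)
Lemma CLU_circular f : CLUsharpP f -> CLUsharpP_circular f.
Proof.
move=> [p [M [b [t [prec [[npM bM] pb pt pp clu]]]]]].
pose prec' x y z := prec x y z || ((y == t x) && (z == b x)).
exists p, M, prec'; split=> //.
  have pprec := PP_pred3 pp.
  have tE g : FPt g -> FPt (fun s => t (g s)) by apply: FPt_comp.
  have bE g : FPt g -> FPt (fun s => b (g s)) by apply: FPt_comp.
  have : PP3 prec'.
    rewrite /PP3 /prec'; apply: PP_or; first by FPt_tac.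
    by apply: PP_and; apply: PP_eq; try (apply: tE); try (apply: bE); FPt_tac.
  move/pred3_PP; congr polytime_pred3; do 3!apply/funext => ?.
  by rewrite fst_pair !snd_pair fst_pair.
move=> x; have [h [[bij precE clust card] sb st hb ht]] := clu x; exists h; split=> //.
have [fun_h inj_h _] := bij.
have injE y z : strings p.[size x]%R y -> strings p.[size x]%R z -> h y = h z -> y = z.
  by move=> sy sz; apply: inj_h; rewrite inE.
move=> y z sy sz; rewrite /prec' /circ_succ; split.
  move=> /orP[/(precE _ _ sy sz)|/andP[/eqP -> /eqP ->]]; first by left.
  by right.
move=> [/(precE _ _ sy sz) -> //|[hy hz]]; apply/orP; right.
by rewrite (injE y (t x)) ?ht // (injE z (b x)) ?hb // !eqxx.
Qed.

Theorem theorem5p1 :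
  UP = coUP ->
  CLUsharpP = CLUsharpP_free /\ CLUsharpP_free = CLUsharpP_circular.
Proof.
move=> up; have free_CLU f : CLUsharpP_free f -> CLUsharpP f.
  by move=> /free_chain; apply: chain_counted_CLU.
split; apply/seteqP; split=> f.
- exact: CLU_free.
- exact: free_CLU.
- by move=> /free_CLU/CLU_circular.
- by move=> /(circ_chain up)/(chain_counted_CLU up)/CLU_free.
Qed.
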